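(* Let $g\in\mathrm{BMOA}$ be locally univalent in $\mathbb{D}$ and let $1\le p<\infty$. Then $h\in V_g^p$ if and only if there exists a function $f\in T_g(H^\infty)$ such that $h=f+h(0)$. In other words, $V_g^p=T_g(H^\infty)+\mathbb{C}$.
   Context: $\mathbb{D}$ is the open unit disc of $\mathbb{C}$; $\mathrm{Hol}(\mathbb{D})$ is the set of holomorphic functions on $\mathbb{D}$. $H^p$ ($0<p<\infty$) is the Hardy space of $f\in\mathrm{Hol}(\mathbb{D})$ with $\|f\|_{H^p}^p=\sup_{0\le r<1}\int_0^{2\pi}|f(re^{it})|^p\frac{dt}{2\pi}<\infty$; $H^\infty$ is the space of bounded holomorphic functions on $\mathbb{D}$. $\mathrm{BMOA}$ consists of all $f\in H^2$ with $\|f\|_*:=\sup_{a\in\mathbb{D}}\|f\circ\varphi_a-f(a)\|_{H^2}<\infty$, where $\varphi_a(z)=\frac{z-a}{1-\overline{a}z}$. A function $g\in\mathrm{Hol}(\mathbb{D})$ is locally univalent if and only if $g'$ never vanishes in $\mathbb{D}$. For $g,f\in\mathrm{Hol}(\mathbb{D})$, $T_g(f)(z)=\int_0^z f(\zeta)g'(\zeta)\,d\zeta$; $T_g(H^\infty)=\{T_g(k):k\in H^\infty\}$. The holomorphic optimal domain is $[T_g,H^p]=\{f\in\mathrm{Hol}(\mathbb{D}): T_g(f)\in H^p\}$. Define $V_g^p=\{h\in\mathrm{BMOA}:[T_h,H^p]\supseteq[T_g,H^p]\}$.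
   Formalization: BMOA is defined with φ_a(z)=(a−z)/(1−āz), so that φ_a(0)=a, instead of (z−a)/(1−āz); with the printed sign the seminorm does not give BMOA and the claim fails, e.g. for g(z)=log(1−z²)+2iz. *)

(* Defs.v *)
From HB Require Import structures.
From mathcomp Require Import all_boot all_order all_algebra.
From mathcomp Require Import complex.
From mathcomp Require Import all_classical all_reals all_analysis.

Set Implicit Arguments.
Unset Strict Implicit.
Unset Printing Implicit Defensive.

Import Order.TTheory GRing.Theory Num.Theory.
Import numFieldNormedType.Exports.
Import ComplexField.

Local Open Scope classical_set_scope.
Local Open Scope ring_scope.
Local Open Scope complex_scope.

(* R[i] gets the topology of its modulus and is a normed space over itself, so
   that derivable and derive1 on R[i] -> R[i] are complex differentiability and
   the complex derivative. *)
HB.instance Definition _ (R : rcfType) := NormedModule.copy R[i] R[i]^o.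

(* A function on the disc is represented by a total function R[i] -> R[i] whose
   values off the disc are irrelevant. *)

Definition disc (R : realType) : set R[i] := [set z | `|z| < 1].

Definition eq_on_disc (R : realType) (f g : R[i] -> R[i]) : Prop :=
  forall z, disc z -> f z = g z.

Definition Hol (R : realType) : set (R[i] -> R[i]) :=
  [set f | forall z : R[i], disc z -> derivable f z 1].

Definition expit (R : realType) (t : R) : R[i] := cos t +i* sin t.

Definition circle_mean (R : realType) (p : R) (f : R[i] -> R[i]) (r : R)
    : \bar R :=
  (((2 * pi)^-1)%:E *
   \int[lebesgue_measure]_(t in `[0%R, (2 * pi)%R])
      (Normc.normc (f (r%:C * expit t)) `^ p)%:E)%E.

Definition Hardy_norm (R : realType) (p : R) (f : R[i] -> R[i]) : \bar R :=
  (ereal_sup [set circle_mean p f r | r in `[0%R, 1%R[] `^ p^-1)%E.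

Definition Hardy (R : realType) (p : R) : set (R[i] -> R[i]) :=
  [set f | Hol f /\ (Hardy_norm p f < +oo)%E].

Definition Hinf (R : realType) : set (R[i] -> R[i]) :=
  [set f | Hol f /\
           exists M : R, forall z, disc z -> Normc.normc (f z) <= M].

(* The sign is such that disc_aut a 0 = a. The seminorm of BMOA subtracts the
   value f a of f \o disc_aut a at 0; with (z - a) / (1 - a^* z) that value
   would be f (- a) instead. *)
Definition disc_aut (R : realType) (a z : R[i]) : R[i] :=
  (a - z) / (1 - a^* * z).

Definition BMOA_seminorm (R : realType) (f : R[i] -> R[i]) : \bar R :=
  ereal_sup [set Hardy_norm 2 (fun z => f (disc_aut a z) - f a)
            | a in @disc R].

Definition BMOA (R : realType) : set (R[i] -> R[i]) :=
  [set f | Hardy 2 f /\ (BMOA_seminorm f < +oo)%E].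

Definition locally_univalent (R : realType) (g : R[i] -> R[i]) : Prop :=
  Hol g /\ forall z, disc z -> derive1 g z != 0.

Definition cintegral01 (R : realType) (F : R -> R[i]) : R[i] :=
  (\int[lebesgue_measure]_(t in `[0%R, 1%R]) complex.Re (F t))
  +i* (\int[lebesgue_measure]_(t in `[0%R, 1%R]) complex.Im (F t)).

(* For f and g holomorphic in the disc the integral from 0 to z does not depend
   on the path; the path here is the segment t |-> t z. *)
Definition volterra (R : realType) (g f : R[i] -> R[i]) : R[i] -> R[i] :=
  fun z => cintegral01 (fun t : R => f (t%:C * z) * derive1 g (t%:C * z) * z).

Definition opt_domain (R : realType) (g : R[i] -> R[i]) (p : R)
    : set (R[i] -> R[i]) :=
  [set f | Hol f /\ Hardy p (volterra g f)].

Definition Vspace (R : realType) (g : R[i] -> R[i]) (p : R)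
    : set (R[i] -> R[i]) :=
  [set h | BMOA h /\ opt_domain g p `<=` opt_domain h p].

(* Main.v *)
Require Import Defs.
From HB Require Import structures.
From mathcomp Require Import all_boot all_order all_algebra.
From mathcomp Require Import complex.
From mathcomp Require Import all_classical all_reals all_analysis.
From mathcomp Require Import measurable_realfun.
From mathcomp Require Import ring lra.

Set Implicit Arguments.
Unset Strict Implicit.
Unset Printing Implicit Defensive.

Import Order.TTheory GRing.Theory Num.Theory.
Import numFieldNormedType.Exports.

Local Open Scope classical_set_scope.
Local Open Scope ring_scope.
Local Open Scope complex_scope.

(* Let m = h'/g'. If F = T_g f then T_h f is the primitive of m F', so the
   inclusion of the domains says that multiplication by m preserves derivatives
   of functions of H^p; and h = T_g m + h(0).

   If m is bounded one needs that |G'| <= |F'| bounds the means of |G|^p by those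
   of |F|^p. With P = p/2 the functions
     (1 + |F|^2 + |G|^2)^P - (2/P) (1 + |F|^2)^P         for p <= 2,
     2 (1 + |G|^2)^P - (1 + |G|^2 + 2P |F|^2)^P          for p >= 2
   are superharmonic, because the Laplacian of the subtracted term dominates, so
   their circular means decrease with the radius; for p >= 2 one concludes with
   (x + y)^P <= (3/2) x^P + K y^P. Applied to g o phi_a and h o phi_a with p = 2
   this also puts h in BMOA.

   Conversely G in H^p satisfies |G'(z)| <= A (1 - |z|)^(-1-1/p), so
   |m F'| (1 - |z|)^(1+1/p) is bounded for each F in H^p. If m were unbounded, a
   gliding hump would contradict this: F = sum b^n e_n k_n, where k_n is a
   normalised function (1 - conj(z_n) z)^(-2), |m(z_n)| is huge, and e_n in {0, 1}
   is chosen such that the terms up to the n-th do not cancel at z_n. *)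

(** Local univalence makes m holomorphic and lets every F in H^p arise, up to a constant, as T_g f
    with f = F'/g'; this is what turns the inclusion of domains into a statement on multipliers.

    The comparison must be uniform in F and G, since for BMOA it is applied to all g o phi_a at
    once. The summand 1 keeps the powers smooth at the zeros of F and G. For N = 1 + a|F|^2 + b|G|^2
    the Laplacian of N^P lies between min(P, P^2) and max(P, P^2) times 4 N^(P-1) (a|F'|^2 +
    b|G'|^2), and N^(P-1) decreases with N for P <= 1 and increases for P >= 1: this dictates what
    is subtracted and the factors 2/P and 2P. The coefficient 3/2 only has to be less than 2, so
    that the term in G can be absorbed.

    The hump replaces a closed graph argument and the completeness of H^p that it would need. The
    selection e_n lets all z_n be fixed in advance: none has to be placed where the earlier terms
    are small. *)

Lemma is_derive_eps (K : numFieldType) (f : K -> K^o) (x l : K) :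
  is_derive x (1:K) f l <->
  (forall e : K, 0 < e -> exists2 d : K, 0 < d & forall h : K, `|h| < d ->
    `|f (x + h) - f x - h * l| <= e * `|h|).
Proof.
split.
- move=> [df dfl] e e0.
  have : (h^-1 *: (f (h *: (1:K) + x) - f x)) @[h --> 0^'] --> l.
    by rewrite -dfl; exact: df.
  move=> /cvgrPdist_le /(_ e e0).
  rewrite near_withinE => /(@nbhs_norm0P K K^o)[d /= d0 H].
  exists d => // h hd.
  have [->|h0] := eqVneq h 0.
    by rewrite addr0 subrr mul0r subr0 normr0 mulr0.
  have := H h hd h0; rewrite /= scaler1 (addrC h) distrC.
  have -> : f (x + h) - f x - h * l = h * (h^-1 *: (f (x + h) - f x) - l).
    by rewrite mulrBr /GRing.scale/= mulVKf.
  by rewrite normrM mulrC => ?; rewrite ler_wpM2r.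
- move=> H.
  have K0 : (h^-1 *: (f (h *: (1:K) + x) - f x)) @[h --> 0^'] --> l.
    apply/cvgrPdist_le => e e0.
    have [d d0 Hd] := H e e0.
    rewrite near_withinE; apply/(@nbhs_norm0P K K^o); exists d => //= h hd h0.
    have := Hd h hd.
    have -> : f (x + h) - f x - h * l = h * (h^-1 *: (f (x + h) - f x) - l).
      by rewrite mulrBr /GRing.scale/= mulVKf.
    rewrite normrM mulrC ler_pM2r ?normr_gt0// distrC scaler1.
    by rewrite (addrC h).
  by split; [apply/cvg_ex; exists l|apply: cvg_lim].
Qed.

(* The structures found on R[i] by unification mix the instance of Defs with
   those of numFieldType, which makes the library rules for derivatives diverge
   there; they are therefore stated over an abstract K and instantiated. *)
Section field_derive.
Variable K : numFieldType.
Implicit Types f g : K -> K^o.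

Lemma field_derivable_is_derive f (x : K) :
  derivable f x 1 -> is_derive x (1 : K) f (derive1 f x).
Proof. by move=> df; split => //; rewrite derive1E. Qed.

Lemma field_is_derive_derivable f (x l : K) :
  is_derive x (1 : K) f l -> derivable f x 1 /\ derive1 f x = l.
Proof. by move=> [df <-]; rewrite derive1E. Qed.

Lemma field_is_deriveD f g (x a b : K) :
  is_derive x (1 : K) f a -> is_derive x (1 : K) g b ->
  is_derive x (1 : K) (fun t => f t + g t) (a + b).
Proof. by move=> df dg; apply: is_deriveD. Qed.

Lemma field_is_deriveM f g (x a b : K) :
  is_derive x (1 : K) f a -> is_derive x (1 : K) g b ->
  is_derive x (1 : K) (fun t => f t * g t) (f x * b + g x * a).
Proof. by move=> df dg; apply: is_deriveM. Qed.

Lemma field_is_deriveV f (x a : K) : f x != 0 ->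
  is_derive x (1 : K) f a ->
  is_derive x (1 : K) (fun t => (f t)^-1) (- a / f x ^+ 2).
Proof.
move=> fx [df dfa]; split; first exact: derivableV.
by rewrite deriveV// dfa /GRing.scale/= mulNr mulrC mulNr.
Qed.

Lemma field_is_derive_cst (c x : K) : is_derive x (1 : K) (fun _ => c : K^o) 0.
Proof. exact: is_derive_cst. Qed.

Lemma field_is_derive_id (x : K) : is_derive x (1 : K) (fun t => t : K^o) 1.
Proof. exact: is_derive_id. Qed.

End field_derive.

(** * The complex derivative *)

Section cder.
Variable R : realType.
Local Notation C := R[i].
Local Notation nrm := (@Normc.normc R).
Implicit Types (f g : C -> C) (z w : C).

Definition cder f z (l : C) : Prop := is_derive z (1 : C) f l.

Lemma cder_derive1 f z : derivable f z 1 -> cder f z (derive1 f z).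
Proof. exact: (@field_derivable_is_derive R[i] f z). Qed.

Lemma cder_derivable f z l : cder f z l -> derivable f z 1 /\ derive1 f z = l.
Proof. exact: (@field_is_derive_derivable R[i] f z l). Qed.

Lemma cderD f g z a b :
  cder f z a -> cder g z b -> cder (fun t => f t + g t) z (a + b).
Proof. exact: (@field_is_deriveD R[i] f g z a b). Qed.

Lemma cderM f g z a b :
  cder f z a -> cder g z b -> cder (fun t => f t * g t) z (f z * b + g z * a).
Proof. exact: (@field_is_deriveM R[i] f g z a b). Qed.

Lemma cderV f z a :
  f z != 0 -> cder f z a -> cder (fun t => (f t)^-1) z (- a / f z ^+ 2).
Proof. exact: (@field_is_deriveV R[i] f z a). Qed.

Lemma cder_cst c z : cder (fun=> c) z 0.
Proof. exact: (@field_is_derive_cst R[i] c z). Qed.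

Lemma cder_id z : cder (fun t => t) z 1.
Proof. exact: (@field_is_derive_id R[i] z). Qed.

Lemma nrmE z : `|z| = (nrm z)%:C.
Proof. by case: z. Qed.

Lemma discE z : disc z <-> nrm z < 1.
Proof. by rewrite /disc/= nrmE (_ : 1 = 1%:C)// ltcR. Qed.

(** In the order of [R[i]] a positive element is a positive real number, so that epsilon and delta
    may be taken in [R] and the modulus in place of the complex-valued norm. *)
Lemma cderP f z l : cder f z l <->
  (forall e : R, 0 < e -> exists2 d : R, 0 < d & forall h : C, nrm h < d ->
    nrm (f (z + h) - f z - h * l) <= e * nrm h).
Proof.
apply: (iff_trans (@is_derive_eps R[i] f z l)); split => H e e0.
- have e0' : 0 < e%:C by rewrite ltcR.
  have [d d0 Hd] := H _ e0'; exists (complex.Re d).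
    by move: d0; rewrite ltcE => /andP[].
  move=> h hd; have := Hd h; rewrite !nrmE -rmorphM lecR; apply.
  by move: d0; rewrite !ltcE /= hd andbT => /andP[].
- have [eI eR] : complex.Im e = 0 /\ 0 < complex.Re e.
    by move: e0; rewrite ltcE => /andP[/eqP ? ?].
  have [d d0 Hd] := H _ eR; exists d%:C; first by rewrite ltcR.
  move=> h; rewrite !nrmE ltcR => /Hd.
  rewrite -lecR rmorphM/=; congr (_ <= _ * _).
  by case: e eI {e0 eR H Hd} => a b /= ->.
Qed.

Lemma nrm_ge0 z : 0 <= nrm z.
Proof. by case: z => a b; exact: sqrtr_ge0. Qed.

Lemma nrm0 : nrm 0 = 0.
Proof. exact: ComplexField.Normc.normc0. Qed.

Lemma nrm1 : nrm 1 = 1.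
Proof. exact: ComplexField.Normc.normc1. Qed.

Lemma nrm_eq0 z : (nrm z == 0) = (z == 0).
Proof.
apply/eqP/eqP => [/ComplexField.Normc.eq0_normc//|->]; exact: nrm0.
Qed.

Lemma nrm_gt0 z : (0 < nrm z) = (z != 0).
Proof. by rewrite lt_neqAle nrm_ge0 andbT eq_sym nrm_eq0. Qed.

Lemma nrmM z w : nrm (z * w) = nrm z * nrm w.
Proof. exact: ComplexField.Normc.normcM. Qed.

Lemma nrmV z : nrm z^-1 = (nrm z)^-1.
Proof. exact: ComplexField.Normc.normcV. Qed.

Lemma nrmX z n : nrm (z ^+ n) = nrm z ^+ n.
Proof. by elim: n => [|n IH]; rewrite ?expr0 ?nrm1// !exprS nrmM IH. Qed.

Lemma nrmN z : nrm (- z) = nrm z.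
Proof. by apply: complexI; rewrite -!nrmE normrN. Qed.

Lemma nrmD z w : nrm (z + w) <= nrm z + nrm w.
Proof. by rewrite -lecR rmorphD/= -!nrmE; exact: ler_normD. Qed.

Lemma nrmB z w : nrm (z - w) <= nrm z + nrm w.
Proof. by rewrite -(nrmN w); exact: nrmD. Qed.

Lemma nrmBC z w : nrm (z - w) = nrm (w - z).
Proof. by rewrite -nrmN opprB. Qed.

Lemma nrm_subl z w : nrm z - nrm w <= nrm (z - w).
Proof. by rewrite lerBlDr (le_trans _ (nrmD _ _))// subrK. Qed.

Lemma nrm_subr z w : nrm w - nrm z <= nrm (z - w).
Proof. by rewrite nrmBC nrm_subl. Qed.

Lemma nrm_real (x : R) : nrm x%:C = `|x|.
Proof. by rewrite /= expr0n addr0 sqrtr_sqr. Qed.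

Lemma nrm_nat n : nrm n%:R = n%:R :> R.
Proof. by rewrite -(rmorph_nat (real_complex R)) nrm_real ger0_norm. Qed.

Lemma nrm_bool (e : bool) : nrm e%:R <= 1.
Proof. by rewrite nrm_nat lern1; case: e. Qed.

Lemma nrm_conj z : nrm z^*%C = nrm z.
Proof. by case: z => a b /=; rewrite sqrrN. Qed.

Lemma nrm_i : nrm 'i%C = 1.
Proof. by rewrite /= expr0n expr1n add0r sqrtr1. Qed.

Lemma nrm_sqr z : nrm z ^+ 2 = complex.Re z ^+ 2 + complex.Im z ^+ 2.
Proof. by case: z => a b /=; rewrite sqr_sqrtr// addr_ge0 ?sqr_ge0. Qed.

Lemma nrm_Re z : `|complex.Re z| <= nrm z.
Proof.
by case: z => a b /=; rewrite -sqrtr_sqr ler_wsqrtr// lerDl sqr_ge0.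
Qed.

Lemma nrm_Im z : `|complex.Im z| <= nrm z.
Proof.
by case: z => a b /=; rewrite -sqrtr_sqr ler_wsqrtr// lerDr sqr_ge0.
Qed.

Lemma nrm_ReIm z : nrm z <= `|complex.Re z| + `|complex.Im z|.
Proof.
case: z => a b /=; rewrite -[leRHS]ger0_norm ?addr_ge0// -sqrtr_sqr.
by apply: ler_wsqrtr; rewrite sqrrD !real_normK ?num_real// lerD2r lerDl mulrn_wge0// mulr_ge0.
Qed.

Lemma ReD z w : complex.Re (z + w) = complex.Re z + complex.Re w.
Proof. by case: z; case: w. Qed.
Lemma ImD z w : complex.Im (z + w) = complex.Im z + complex.Im w.
Proof. by case: z; case: w. Qed.
Lemma ReN z : complex.Re (- z) = - complex.Re z.
Proof. by case: z. Qed.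
Lemma ImN z : complex.Im (- z) = - complex.Im z.
Proof. by case: z. Qed.
Lemma ReM z w : complex.Re (z * w) =
  complex.Re z * complex.Re w - complex.Im z * complex.Im w.
Proof. by case: z; case: w. Qed.
Lemma ImM z w : complex.Im (z * w) =
  complex.Re z * complex.Im w + complex.Im z * complex.Re w.
Proof. by case: z; case: w. Qed.

Lemma nrm_expit (t : R) : nrm (expit t) = 1.
Proof. by rewrite /expit /= cos2Dsin2 sqrtr1. Qed.

Lemma nrm_rexpit (r t : R) : 0 <= r -> nrm (r%:C * expit t) = r.
Proof. by move=> r0; rewrite nrmM nrm_real nrm_expit mulr1 ger0_norm. Qed.

(** Integrals of kernels and series come with quadratic remainders; their derivatives are all
    obtained in this way. *)
Lemma cder_quad f z l (B d : R) : 0 < d ->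
  (forall h, nrm h < d -> nrm (f (z + h) - f z - h * l) <= B * nrm h ^+ 2) ->
  cder f z l.
Proof.
move=> d0 H; apply/cderP => e e0.
have B1 : 0 < `|B| + 1 by rewrite ltr_wpDl.
exists (Num.min d (e / (`|B| + 1))).
  by rewrite lt_min d0 divr_gt0.
move=> h; rewrite lt_min => /andP[hd he].
apply: (le_trans (H h hd)).
rewrite expr2 mulrA ler_wpM2r ?nrm_ge0//.
apply: (@le_trans _ _ ((`|B| + 1) * nrm h)).
  by rewrite ler_wpM2r ?nrm_ge0// ler_wpDr// ler_norm.
by rewrite mulrC -ler_pdivlMr// ltW.
Qed.

(** Locality of the derivative: it serves for functions given by a formula only on the disc, or only
    away from a point. *)
Lemma cder_near f g z l (d : R) : 0 < d ->
  (forall w, nrm (w - z) < d -> f w = g w) -> cder f z l -> cder g z l.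
Proof.
move=> d0 fg /cderP H; apply/cderP => e e0.
have [d' d'0 Hd'] := H e e0; exists (Num.min d d'); first by rewrite lt_min d0.
move=> h; rewrite lt_min => /andP[hd hd'].
rewrite -!fg ?subrr ?nrm0//; last by rewrite addrC addKr.
exact: Hd'.
Qed.

Lemma cder_cont f z l : cder f z l ->
  forall e : R, 0 < e -> exists2 d : R, 0 < d &
    forall w, nrm (w - z) < d -> nrm (f w - f z) <= e.
Proof.
move=> /cderP /(_ 1 ltr01)[d d0 H] e e0.
have l1 : 0 < 1 + nrm l by rewrite ltr_wpDr ?nrm_ge0.
exists (Num.min d (e / (1 + nrm l))); first by rewrite lt_min d0 divr_gt0.
move=> w; rewrite lt_min => /andP[wd we].
have := H (w - z) wd; rewrite [z + _]addrC subrK mul1r => H1.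
have -> : f w - f z = (f w - f z - (w - z) * l) + (w - z) * l by rewrite subrK.
apply: (le_trans (nrmD _ _)); rewrite nrmM.
apply: (@le_trans _ _ (nrm (w - z) * (1 + nrm l))).
  by rewrite mulrDr mulr1 lerD2r.
by rewrite -ler_pdivlMr// ltW.
Qed.

Lemma cder_comp f g z a b :
  cder f z a -> cder g (f z) b -> cder (fun t => g (f t)) z (b * a).
Proof.
move=> df dg; apply/cderP => e e0.
set A := nrm a + 1; have A0 : 0 < A by rewrite ltr_wpDl ?nrm_ge0.
set B := nrm b + 1; have B0 : 0 < B by rewrite ltr_wpDl ?nrm_ge0.
have e1 : 0 < e / (2 * A) by rewrite divr_gt0// mulr_gt0.
have e2 : 0 < Num.min 1 (e / (2 * B)).
  by rewrite lt_min ltr01 divr_gt0// mulr_gt0.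
have [d1 d10 H1] := (cderP _ _ _).1 dg _ e1.
have [d2 d20 H2] := (cderP _ _ _).1 df _ e2.
exists (Num.min d2 (d1 / A)); first by rewrite lt_min d20 divr_gt0.
move=> h; rewrite lt_min => /andP[hd2 hd1].
set k := f (z + h) - f z.
have Hk := H2 h hd2; rewrite -/k in Hk.
have kA : nrm k <= A * nrm h.
  have -> : k = (k - h * a) + h * a by rewrite subrK.
  apply: (le_trans (nrmD _ _)); rewrite nrmM mulrDl mul1r addrC.
  rewrite (mulrC (nrm h)) lerD2l (le_trans Hk)//.
  by rewrite ler_piMl ?nrm_ge0// ge_min lexx.
have kd1 : nrm k < d1.
  by apply: (le_lt_trans kA); rewrite mulrC -ltr_pdivlMr.
have -> : f (z + h) = f z + k by rewrite /k [f z + _]addrC subrK.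
(* The error is that of g for the increment [k], plus b times that of f; each is given half of e. *)
have -> : g (f z + k) - g (f z) - h * (b * a) =
  (g (f z + k) - g (f z) - k * b) + b * (k - h * a) by ring.
apply: (le_trans (nrmD _ _)); rewrite nrmM.
rewrite -[in leRHS](mulr1 e) (splitr 1) mulrDr mulrDl; apply: lerD.
  apply: (le_trans (H1 k kd1)).
  apply: (@le_trans _ _ (e / (2 * A) * (A * nrm h))).
    by rewrite ler_wpM2l// ltW.
  by rewrite le_eqVlt; apply/orP; left; apply/eqP; field; rewrite ?gt_eqF.
apply: (@le_trans _ _ (B * (e / (2 * B) * nrm h))).
  apply: ler_pM; rewrite ?nrm_ge0//; first by rewrite lerDl.
  by apply: (le_trans Hk); rewrite ler_wpM2r ?nrm_ge0// ge_min lexx orbT.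
by rewrite le_eqVlt; apply/orP; left; apply/eqP; field; rewrite ?gt_eqF.
Qed.

Lemma HolP f : Hol f <-> forall z, nrm z < 1 -> cder f z (derive1 f z).
Proof.
split => H z hz.
  by apply: cder_derive1; apply: H; apply/discE.
by have [] := cder_derivable (H z ((discE z).1 hz)).
Qed.

Lemma Hol_cder f (l : C -> C) :
  (forall z, nrm z < 1 -> cder f z (l z)) ->
  Hol f /\ forall z, nrm z < 1 -> derive1 f z = l z.
Proof.
move=> H; split=> z hz; last by have [] := cder_derivable (H z hz).
by have [] := cder_derivable (H z ((discE z).1 hz)).
Qed.

End cder.

#[global] Opaque Normc.normc.

(** * Integrals of complex functions on an interval *)

Section cint.
Variable R : realType.
Local Notation C := R[i].
Local Notation nrm := (@Normc.normc R).
Local Notation mu := (@lebesgue_measure R).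
Implicit Types (F G : R -> C) (f g : R -> R) (a b c : R).

Definition icont a b f := forall t, a <= t <= b -> forall e, 0 < e ->
  exists2 d, 0 < d & forall s, a <= s <= b -> `|s - t| < d -> `|f s - f t| <= e.

Definition iccont a b F := forall t, a <= t <= b -> forall e : R, 0 < e ->
  exists2 d : R, 0 < d & forall s, a <= s <= b -> `|s - t| < d ->
    nrm (F s - F t) <= e.

Definition rintble a b f := mu.-integrable `[a, b] (EFin \o f).

Definition cintble a b F :=
  rintble a b (fun t => complex.Re (F t)) /\
  rintble a b (fun t => complex.Im (F t)).

Definition cint a b F : C :=
  (\int[mu]_(t in `[a, b]) complex.Re (F t))
  +i* (\int[mu]_(t in `[a, b]) complex.Im (F t)).

Lemma cintE a b F : cint a b F = (\int[mu]_(t in `[a, b]) complex.Re (F t))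
  +i* (\int[mu]_(t in `[a, b]) complex.Im (F t)).
Proof. by []. Qed.

Lemma cintegral01E F : cintegral01 F = cint 0 1 F.
Proof. by []. Qed.

Lemma icont_within a b f : icont a b f -> {within `[a, b], continuous f}.
Proof.
move=> H; apply/subspace_continuousP => t; rewrite /= in_itv/= => tab.
apply/cvgrPdist_le => e e0; have [d d0 Hd] := H t tab e e0.
rewrite near_withinE; near=> s => sab; rewrite distrC; apply: Hd.
  by move: sab; rewrite /= in_itv.
by rewrite distrC; near: s; exact: cvgr_dist_lt.
Unshelve. all: by end_near. Qed.

Lemma within_icont a b f : {within `[a, b], continuous f} -> icont a b f.
Proof.
move=> /subspace_continuousP H t tab e e0.
have := H t; rewrite /= in_itv/= tab => /(_ isT)/cvgrPdist_le/(_ _ e0).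
rewrite near_withinE => /nbhs_normP[d /= d0 Hd]; exists d => // s sab sd.
by rewrite distrC; apply: Hd; rewrite /= ?in_itv// distrC.
Qed.

Lemma icont_intble a b f : icont a b f -> rintble a b f.
Proof.
move=> H; apply: continuous_compact_integrable; first exact: segment_compact.
exact: icont_within.
Qed.

Lemma iccont_Re a b F : iccont a b F -> icont a b (fun t => complex.Re (F t)).
Proof.
move=> H t tab e e0; have [d d0 Hd] := H t tab e e0; exists d => // s sab sd.
by rewrite -ReN -ReD (le_trans (nrm_Re _)) ?Hd.
Qed.

Lemma iccont_Im a b F : iccont a b F -> icont a b (fun t => complex.Im (F t)).
Proof.
move=> H t tab e e0; have [d d0 Hd] := H t tab e e0; exists d => // s sab sd.
by rewrite -ImN -ImD (le_trans (nrm_Im _)) ?Hd.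
Qed.

Lemma iccont_nrm a b F : iccont a b F -> icont a b (fun t => nrm (F t)).
Proof.
move=> H t tab e e0; have [d d0 Hd] := H t tab e e0; exists d => // s sab sd.
have := Hd s sab sd; have := nrm_subl (F s) (F t); have := nrm_subr (F s) (F t).
by rewrite ler_norml => *; apply/andP; split; lra.
Qed.

Lemma iccont_intble a b F : iccont a b F -> cintble a b F.
Proof.
by move=> H; split; apply: icont_intble; [exact: iccont_Re|exact: iccont_Im].
Qed.

Lemma rintble_sub a b a' b' f :
  a <= a' -> b' <= b -> rintble a b f -> rintble a' b' f.
Proof.
move=> aa bb; apply: integrableS => //.
move=> x /=; rewrite !in_itv/= => /andP[ax xb].
by rewrite (le_trans aa ax) (le_trans xb bb).
Qed.

Lemma cintble_sub a b a' b' F :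
  a <= a' -> b' <= b -> cintble a b F -> cintble a' b' F.
Proof. by move=> aa bb [? ?]; split; apply: rintble_sub; eassumption. Qed.

Lemma rintble_cst a b (k : R) : rintble a b (fun=> k).
Proof.
apply: icont_intble => t _ e e0; exists 1 => // s _ _.
by rewrite subrr normr0 ltW.
Qed.

Lemma rintbleD a b f g :
  rintble a b f -> rintble a b g -> rintble a b (fun t => f t + g t).
Proof. by rewrite /rintble => Hf Hg; apply: (integrableD _ Hf Hg). Qed.

Lemma rintbleZ a b f k : rintble a b f -> rintble a b (fun t => k * f t).
Proof. by rewrite /rintble => Hf; apply: (integrableZl _ k Hf). Qed.

Lemma rintbleN a b f : rintble a b f -> rintble a b (fun t => - f t).
Proof.
by move=> /(rintbleZ (-1)); under eq_fun do rewrite mulN1r.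
Qed.

Lemma rintbleB a b f g :
  rintble a b f -> rintble a b g -> rintble a b (fun t => f t - g t).
Proof. by move=> Hf Hg; apply/rintbleD => //; exact: rintbleN. Qed.

Lemma rint_cst a b (k : R) : a <= b -> \int[mu]_(t in `[a, b]) k = (b - a) * k.
Proof.
move=> ab; rewrite Rintegral_cst//= lebesgue_measure_itv/= lte_fin mulrC.
case: ltP => ba /=; first by [].
by rewrite (_ : b = a) ?subrr//; apply/eqP; rewrite eq_le ab ba.
Qed.

Lemma rint_chasles a b c f : a <= b -> b <= c -> rintble a c f ->
  \int[mu]_(t in `[a, c]) f t =
  \int[mu]_(t in `[a, b]) f t + \int[mu]_(t in `[b, c]) f t.
Proof.
move=> ab bc fi.
have := @Rintegral_itvB R f (BLeft a) (BRight c) b fi.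
rewrite !bnd_simp => /(_ ab bc) H.
rewrite (_ : \int[mu]_(t in `[b, c]) f t = \int[mu]_(t in `]b, c]) f t).
  by rewrite -H addrC subrK.
rewrite Rintegral_itv_obnd_cbnd//.
apply: integrableS fi => //.
by move=> x /=; rewrite !in_itv/= => /andP[bx ->]; rewrite (le_trans ab)// ltW.
Qed.

Lemma le_rint a b f g : rintble a b f -> rintble a b g ->
  (forall t, a <= t <= b -> f t <= g t) ->
  \int[mu]_(t in `[a, b]) f t <= \int[mu]_(t in `[a, b]) g t.
Proof.
by move=> fi gi fg; apply: le_Rintegral => // t; rewrite /= in_itv; exact: fg.
Qed.

Lemma eq_cint a b F G : (forall t, a <= t <= b -> F t = G t) ->
  cint a b F = cint a b G.
Proof.
move=> FG; rewrite /cint; congr (_ +i* _); apply: eq_Rintegral => t;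
  by rewrite inE/= in_itv/= => /FG ->.
Qed.

Lemma cintbleD a b F G :
  cintble a b F -> cintble a b G -> cintble a b (fun t => F t + G t).
Proof.
move=> [F1 F2] [G1 G2]; split.
  by under eq_fun do rewrite ReD; exact: rintbleD.
by under eq_fun do rewrite ImD; exact: rintbleD.
Qed.

Lemma cintbleZ a b (k : C) F : cintble a b F -> cintble a b (fun t => k * F t).
Proof.
move=> [F1 F2]; split.
  by under eq_fun do rewrite ReM; apply: rintbleB; apply: rintbleZ.
by under eq_fun do rewrite ImM; apply: rintbleD; apply: rintbleZ.
Qed.

Lemma cintbleN a b F : cintble a b F -> cintble a b (fun t => - F t).
Proof. by move=> /(cintbleZ (-1)); under eq_fun do rewrite mulN1r. Qed.

Lemma cintbleB a b F G :
  cintble a b F -> cintble a b G -> cintble a b (fun t => F t - G t).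
Proof. by move=> *; apply: cintbleD => //; exact: cintbleN. Qed.

Lemma cintble_cst a b (k : C) : cintble a b (fun=> k).
Proof. by split; exact: rintble_cst. Qed.

Lemma cintD a b F G : cintble a b F -> cintble a b G ->
  cint a b (fun t => F t + G t) = cint a b F + cint a b G.
Proof.
move=> [F1 F2] [G1 G2]; rewrite /cint.
under eq_Rintegral do rewrite ReD.
under [X in _ +i* X]eq_Rintegral do rewrite ImD.
by rewrite !RintegralD.
Qed.

Lemma cintZ a b (k : C) F : cintble a b F ->
  cint a b (fun t => k * F t) = k * cint a b F.
Proof.
move=> [F1 F2]; rewrite /cint.
under eq_Rintegral do rewrite ReM.
under [X in _ +i* X]eq_Rintegral do rewrite ImM.
rewrite RintegralB ?RintegralD ?RintegralZl//; try exact: rintbleZ.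
by case: k.
Qed.

Lemma cintN a b F : cintble a b F ->
  cint a b (fun t => - F t) = - cint a b F.
Proof.
move=> Fi; rewrite -mulN1r -cintZ//.
by apply: eq_cint => t _; rewrite mulN1r.
Qed.

Lemma cintB a b F G : cintble a b F -> cintble a b G ->
  cint a b (fun t => F t - G t) = cint a b F - cint a b G.
Proof. by move=> Fi Gi; rewrite cintD ?cintN//; exact: cintbleN. Qed.

Lemma cint_cst a b (k : C) : a <= b -> cint a b (fun=> k) = (b - a)%:C * k.
Proof.
move=> ab; rewrite /cint !rint_cst//; case: k => x y /=.
by apply/eqP; rewrite eq_complex/= !mul0r subr0 addr0 !eqxx.
Qed.

Lemma cint_chasles a b c F : a <= b -> b <= c -> cintble a c F ->
  cint a c F = cint a b F + cint b c F.
Proof.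
by move=> ab bc [F1 F2]; rewrite /cint (rint_chasles ab bc F1) (rint_chasles ab bc F2).
Qed.

(** Real and imaginary parts are estimated separately, which costs the factor 2; sharp constants are
    never at stake. *)
Lemma cint_le a b F g : cintble a b F -> rintble a b g ->
  (forall t, a <= t <= b -> nrm (F t) <= g t) ->
  nrm (cint a b F) <= 2 * \int[mu]_(t in `[a, b]) g t.
Proof.
move=> [F1 F2] gi H; apply: (le_trans (nrm_ReIm _)) => /=.
have aux f : rintble a b f -> (forall t, a <= t <= b -> `|f t| <= g t) ->
    `|\int[mu]_(t in `[a, b]) f t| <= \int[mu]_(t in `[a, b]) g t.
  move=> fi fg; apply: (le_trans (le_normr_Rintegral _ fi)) => //.
  apply: le_rint => //; exact: (integrable_norm fi).
rewrite mulr_natl mulr2n; apply: lerD; apply: aux => // t /H Ht.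
  exact: le_trans (nrm_Re _) Ht.
exact: le_trans (nrm_Im _) Ht.
Qed.

Lemma cint_bound a b F (B : R) : a <= b -> cintble a b F ->
  (forall t, a <= t <= b -> nrm (F t) <= B) ->
  nrm (cint a b F) <= 2 * ((b - a) * B).
Proof.
move=> ab Fi H; rewrite -(rint_cst B ab).
by apply: cint_le => //; exact: rintble_cst.
Qed.

(* The integral of phi(x, y) d(x + iy) along the boundary of [a, b] x [c, d]. *)
Definition rectint (phi : R -> R -> C) a b c d : C :=
  'i%C * (cint c d (phi b) - cint c d (phi a))
  - (cint a b (phi ^~ d) - cint a b (phi ^~ c)).

(** Complex differentiability relative to the closed rectangle: no room around the edges is
    required, and subrectangles inherit it. *)
Definition rectdiff (phi : R -> R -> C) a b c d := forall x0 y0,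
  a <= x0 <= b -> c <= y0 <= d -> exists L : C, forall e : R, 0 < e ->
  exists2 del : R, 0 < del & forall x y, a <= x <= b -> c <= y <= d ->
    `|x - x0| < del -> `|y - y0| < del ->
    nrm (phi x y - phi x0 y0 - L * ((x - x0) +i* (y - y0)))
    <= e * (`|x - x0| + `|y - y0|).

Lemma rectdiff_cont phi a b c d : rectdiff phi a b c d ->
  (forall x, a <= x <= b -> iccont c d (phi x)) /\
  (forall y, c <= y <= d -> iccont a b (phi ^~ y)).
Proof.
move=> H.
have key x0 y0 : a <= x0 <= b -> c <= y0 <= d -> forall e : R, 0 < e ->
  exists2 del : R, 0 < del & forall x y, a <= x <= b -> c <= y <= d ->
    `|x - x0| < del -> `|y - y0| < del -> nrm (phi x y - phi x0 y0) <= e.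
  move=> x0i y0i e e0; have [L /(_ 1 ltr01)[del del0 Hd]] := H x0 y0 x0i y0i.
  have K0 : 0 < 2 * (1 + nrm L) by rewrite mulr_gt0// ltr_wpDr ?nrm_ge0.
  exists (Num.min del (e / (2 * (1 + nrm L)))).
    by rewrite lt_min del0 divr_gt0.
  move=> x y xi yi; rewrite !lt_min => /andP[xd xe] /andP[yd ye].
  have := Hd x y xi yi xd yd; rewrite mul1r.
  set l := L * _ => H1.
  have -> : phi x y - phi x0 y0 = (phi x y - phi x0 y0 - l) + l by rewrite subrK.
  apply: (le_trans (nrmD _ _)); rewrite /l nrmM.
  have H2 := nrm_ReIm ((x - x0) +i* (y - y0)); rewrite /= in H2.
  apply: (@le_trans _ _ ((1 + nrm L) * (`|x - x0| + `|y - y0|))).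
    by rewrite mulrDl mul1r lerD// ler_wpM2l ?nrm_ge0.
  have -> : e = (1 + nrm L) * (e / (2 * (1 + nrm L)) + e / (2 * (1 + nrm L))).
    by field; rewrite gt_eqF// ltr_wpDr ?nrm_ge0.
  rewrite ler_wpM2l ?addr_ge0 ?nrm_ge0//.
  by apply: lerD; exact: ltW.
split=> [x xi y yi|y yi x xi] e e0; have [del del0 Hd] := key x y xi yi e e0;
  exists del => // s si sd; apply: Hd => //; by rewrite subrr normr0.
Qed.

(** Each edge in the interior is traversed twice, in opposite directions. *)
Lemma rectint_quarter phi a b c d (x y : R) : rectdiff phi a b c d ->
  a <= x -> x <= b -> c <= y -> y <= d ->
  rectint phi a b c d = rectint phi a x c y + rectint phi x b c y +
    rectint phi a x y d + rectint phi x b y d.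
Proof.
move=> H ax xb cy yd; have [H1 H2] := rectdiff_cont H.
have ab := le_trans ax xb; have cd := le_trans cy yd.
have V s : a <= s <= b -> cint c d (phi s) = cint c y (phi s) + cint y d (phi s).
  by move=> si; apply: cint_chasles => //; apply: iccont_intble; exact: H1.
have W s : c <= s <= d ->
    cint a b (phi ^~ s) = cint a x (phi ^~ s) + cint x b (phi ^~ s).
  by move=> si; apply: cint_chasles => //; apply: iccont_intble; exact: H2.
rewrite /rectint !V ?W ?lexx ?ax ?xb ?ab ?cd//; ring.
Qed.

End cint.

#[global] Opaque cint.

(** * Goursat's theorem *)

Section goursat.
Variable R : realType.
Local Notation C := R[i].
Local Notation nrm := (@Normc.normc R).

Lemma le_eps0 (x k : R) : (forall e, 0 < e -> x <= e * k) -> x <= 0.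
Proof.
move=> H; rewrite leNgt; apply/negP => x0.
have k1 : 0 < 2 * (`|k| + 1) by rewrite mulr_gt0// ltr_wpDl.
have /H := divr_gt0 x0 k1; apply/negP; rewrite -ltNge.
rewrite -mulrA gtr_pMr// mulrC ltr_pdivrMr// mul1r.
apply: (le_lt_trans (ler_norm k)); have := normr_ge0 k; lra.
Qed.

Lemma le_sum4 (q a b c d : R) : q <= a + b + c + d ->
  4 * a < q -> 4 * b < q -> 4 * c < q -> 4 * d < q -> q < q.
Proof. lra. Qed.

Lemma nrm_le0 (z : C) : nrm z <= 0 -> z = 0.
Proof. by move=> H; apply/eqP; rewrite -nrm_eq0 eq_le H nrm_ge0. Qed.

(** The affine part contributes i v (L w) from the vertical edges and w (L i v) from the horizontal
    ones, and these cancel. Only the remainders are left, each at most E = e (w + v) on the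
    boundary, whose length is 2 (w + v); the remaining factor 2 is that of [cint_bound]. *)
Lemma rectint_small phi a b c d (x y w v x0 y0 e : R) (L : C) :
  rectdiff phi a b c d -> a <= x -> x + w <= b -> c <= y -> y + v <= d ->
  0 <= w -> 0 <= v -> 0 <= e ->
  x <= x0 <= x + w -> y <= y0 <= y + v ->
  (forall s t, x <= s <= x + w -> y <= t <= y + v ->
    nrm (phi s t - phi x0 y0 - L * ((s - x0) +i* (t - y0)))
    <= e * (`|s - x0| + `|t - y0|)) ->
  nrm (rectint phi x (x + w) y (y + v)) <= e * (4 * (w + v) ^+ 2).
Proof.
move=> H ax wb cy vd w0 v0 e0 xi yi Hs; have [H1 H2] := rectdiff_cont H.
have xb : x <= x + w by rewrite lerDl.
have yd : y <= y + v by rewrite lerDl.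
pose E := e * (w + v).
have HE s t : x <= s <= x + w -> y <= t <= y + v ->
    nrm (phi s t - phi x0 y0 - L * ((s - x0) +i* (t - y0))) <= E.
  move=> si ti; apply: (le_trans (Hs s t si ti)); rewrite ler_wpM2l//.
  by move: si ti xi yi => *; apply: lerD; rewrite ler_norml; lra.
have I1 s : a <= s <= b -> cintble y (y + v) (phi s).
  by move=> si; apply: (cintble_sub cy vd); apply: iccont_intble; exact: H1.
have I2 t : c <= t <= d -> cintble x (x + w) (phi ^~ t).
  by move=> si; apply: (cintble_sub ax wb); apply: iccont_intble; exact: H2.
have xab : a <= x <= b by lra.
have xwab : a <= x + w <= b by lra.
have ycd : c <= y <= d by lra.
have yvcd : c <= y + v <= d by lra.
have B1 : nrm (cint y (y + v) (phi (x + w)) - cint y (y + v) (phi x)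
     - v%:C * (L * w%:C)) <= 2 * (v * (E + E)).
  have -> : v%:C * (L * w%:C) = cint y (y + v) (fun=> L * w%:C).
    by rewrite cint_cst// addrAC subrr add0r.
  rewrite -cintB; [|exact: I1|exact: I1].
  rewrite -cintB; [|by apply: cintbleB; exact: I1|exact: cintble_cst].
  have -> : v * (E + E) = (y + v - y) * (E + E) by ring.
  apply: cint_bound => //.
    by apply: cintbleB; [apply: cintbleB; exact: I1|exact: cintble_cst].
  move=> t ti; have := HE (x + w) t; have := HE x t.
  rewrite !lexx xb => /(_ isT ti) E1 /(_ isT ti) E2.
  have -> : phi (x + w) t - phi x t - L * w%:C =
    (phi (x + w) t - phi x0 y0 - L * ((x + w - x0) +i* (t - y0)))
     - (phi x t - phi x0 y0 - L * ((x - x0) +i* (t - y0))).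
    have -> : (x + w - x0) +i* (t - y0) = w%:C + ((x - x0) +i* (t - y0)).
      by apply/eqP; rewrite eq_complex/=; apply/andP; split; apply/eqP; ring.
    by ring.
  by apply: (le_trans (nrmB _ _)); apply: lerD.
have B2 : nrm (cint x (x + w) (phi ^~ (y + v)) - cint x (x + w) (phi ^~ y)
     - w%:C * (L * ('i%C * v%:C))) <= 2 * (w * (E + E)).
  have -> : w%:C * (L * ('i%C * v%:C)) = cint x (x + w) (fun=> L * ('i%C * v%:C)).
    by rewrite cint_cst// addrAC subrr add0r.
  rewrite -cintB; [|exact: I2|exact: I2].
  rewrite -cintB; [|by apply: cintbleB; exact: I2|exact: cintble_cst].
  have -> : w * (E + E) = (x + w - x) * (E + E) by ring.
  apply: cint_bound => //.
    by apply: cintbleB; [apply: cintbleB; exact: I2|exact: cintble_cst].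
  move=> t ti; have := HE t (y + v); have := HE t y.
  rewrite !lexx yd => /(_ ti isT) E1 /(_ ti isT) E2.
  have -> : phi t (y + v) - phi t y - L * ('i%C * v%:C) =
    (phi t (y + v) - phi x0 y0 - L * ((t - x0) +i* (y + v - y0)))
     - (phi t y - phi x0 y0 - L * ((t - x0) +i* (y - y0))).
    have -> : (t - x0) +i* (y + v - y0) = 'i%C * v%:C + ((t - x0) +i* (y - y0)).
      by apply/eqP; rewrite eq_complex/=; apply/andP; split; apply/eqP; ring.
    by ring.
  by apply: (le_trans (nrmB _ _)); apply: lerD.
rewrite /rectint.
set A := cint y (y + v) (phi (x + w)) - _ in B1 *.
set B := cint x (x + w) (phi ^~ (y + v)) - _ in B2 *.
have -> : 'i%C * A - B =
  'i%C * (A - v%:C * (L * w%:C)) - (B - w%:C * (L * ('i%C * v%:C))) by ring.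
apply: (le_trans (nrmB _ _)); rewrite nrmM nrm_i mul1r.
have -> : e * (4 * (w + v) ^+ 2) = 2 * (v * (E + E)) + 2 * (w * (E + E)).
  by rewrite /E; ring.
exact: lerD.
Qed.

(** Every right end bounds every left end, so the supremum of the left ends lies in all the
    intervals. It locates the limit of the subdivision in Goursat's theorem and, later, the sum of a
    series. *)
Lemma nested_point (x w : nat -> R) : (forall n, x n <= x n.+1) ->
  (forall n, x n.+1 + w n.+1 <= x n + w n) -> (forall n, 0 <= w n) ->
  exists x0, forall n, x n <= x0 <= x n + w n.
Proof.
move=> xi xwd w0.
have inc m n : (m <= n)%N -> x m <= x n.
  elim: n => [|n IH]; first by rewrite leqn0 => /eqP->.
  by rewrite leq_eqVlt => /predU1P[->//|]; rewrite ltnS => /IH /le_trans; apply.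
have dec m n : (m <= n)%N -> x n + w n <= x m + w m.
  elim: n => [|n IH]; first by rewrite leqn0 => /eqP->.
  rewrite leq_eqVlt => /predU1P[->//|]; rewrite ltnS => /IH; apply: le_trans.
  exact: xwd.
have ub m n : x n <= x m + w m.
  have [mn|/ltnW nm] := leqP m n.
    by apply: le_trans (dec _ _ mn); rewrite lerDl.
  by apply: (le_trans (inc _ _ nm)); rewrite lerDl.
have hs : has_sup (range x).
  by split; [exists (x 0%N), 0%N|exists (x 0%N + w 0%N) => _ [n _ <-]].
exists (sup (range x)) => n; apply/andP; split.
  by apply: ub_le_sup; [case: hs|exists n].
by apply: ge_sup; [case: hs|move=> _ [m _ <-]].
Qed.

(* The boundary integral is additive over the four quarters of a rectangle and
   vanishes on the affine part of phi. *)
Theorem goursat phi (a b c d : R) : a <= b -> c <= d ->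
  rectdiff phi a b c d -> rectint phi a b c d = 0.
Proof.
move=> ab cd H.
pose W n : R := (b - a) / 2 ^+ n; pose V n : R := (d - c) / 2 ^+ n.
have WS n : W n = W n.+1 + W n.+1.
  by rewrite /W exprS; field; rewrite expf_eq0 pnatr_eq0 andbF.
have VS n : V n = V n.+1 + V n.+1.
  by rewrite /V exprS; field; rewrite expf_eq0 pnatr_eq0 andbF.
have W0 n : 0 <= W n by rewrite divr_ge0 ?subr_ge0.
have V0 n : 0 <= V n by rewrite divr_ge0 ?subr_ge0.
pose Q n (p : R * R) := rectint phi p.1 (p.1 + W n) p.2 (p.2 + V n).
pose sub n (p : R * R) := [/\ a <= p.1, p.1 + W n <= b, c <= p.2 & p.2 + V n <= d].
pose next n (p p' : R * R) := [/\ sub n.+1 p', p.1 <= p'.1 <= p.1 + W n.+1,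
  p.2 <= p'.2 <= p.2 + V n.+1 & nrm (Q n p) <= 4 * nrm (Q n.+1 p')].
(* The condition on [p] is placed inside the existential so that a choice function is defined on all
   pairs. *)
have step n p : exists p', sub n p -> next n p p'.
  have [ps|ps] := pselect (sub n p); last by exists p.
  case: (ps) => ap pb cp pd.
  have Wn := W0 n.+1; have Vn := V0 n.+1; have WSn := WS n; have VSn := VS n.
  have inside (x y : R) : p.1 <= x <= p.1 + W n.+1 -> p.2 <= y <= p.2 + V n.+1 ->
      sub n.+1 (x, y).
    by move=> xi yi; split=> /=; lra.
  have Hn : rectdiff phi p.1 (p.1 + W n) p.2 (p.2 + V n).
    move=> x0 y0 xi yi; have [||L HL] := H x0 y0; [lra|lra|].
    exists L => e e0; have [del del0 Hd] := HL e e0; exists del => // x y xxi yyi.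
    by apply: Hd; lra.
  have := @rectint_quarter _ phi _ _ _ _ (p.1 + W n.+1) (p.2 + V n.+1) Hn.
  rewrite !lerDl Wn Vn (_ : p.1 + W n.+1 <= p.1 + W n); last by lra.
  rewrite (_ : p.2 + V n.+1 <= p.2 + V n); last by lra.
  move=> /(_ isT isT isT isT).
  pose q1 := Q n.+1 (p.1, p.2); pose q2 := Q n.+1 (p.1 + W n.+1, p.2).
  pose q3 := Q n.+1 (p.1, p.2 + V n.+1).
  pose q4 := Q n.+1 (p.1 + W n.+1, p.2 + V n.+1).
  have WE : p.1 + W n = p.1 + W n.+1 + W n.+1 by rewrite WSn addrA.
  have VE : p.2 + V n = p.2 + V n.+1 + V n.+1 by rewrite VSn addrA.
  move=> Hq; have {}Hq : Q n p = q1 + q2 + q3 + q4.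
    by rewrite /q1 /q2 /q3 /q4 /Q /= -WE -VE.
  have Hle : nrm (Q n p) <= nrm q1 + nrm q2 + nrm q3 + nrm q4.
    rewrite Hq; apply: (le_trans (nrmD _ _)); rewrite lerD2r.
    apply: (le_trans (nrmD _ _)); rewrite lerD2r; exact: nrmD.
  have h4 : [\/ nrm (Q n p) <= 4 * nrm q1, nrm (Q n p) <= 4 * nrm q2,
      nrm (Q n p) <= 4 * nrm q3 | nrm (Q n p) <= 4 * nrm q4].
    apply: contrapT => H4.
    have : nrm (Q n p) < nrm (Q n p); last by rewrite ltxx.
    have [h1 h2 h3 h4] : [/\ 4 * nrm q1 < nrm (Q n p), 4 * nrm q2 < nrm (Q n p),
        4 * nrm q3 < nrm (Q n p) & 4 * nrm q4 < nrm (Q n p)].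
      split; rewrite ltNge; apply/negP => h; apply: H4;
      [exact: Or41|exact: Or42|exact: Or43|exact: Or44].
    by move: Hle h1 h2 h3 h4; exact: le_sum4.
  have x0 : p.1 <= p.1 <= p.1 + W n.+1 by rewrite lexx lerDl.
  have x1 : p.1 <= p.1 + W n.+1 <= p.1 + W n.+1 by rewrite lexx lerDl Wn.
  have y0 : p.2 <= p.2 <= p.2 + V n.+1 by rewrite lexx lerDl.
  have y1 : p.2 <= p.2 + V n.+1 <= p.2 + V n.+1 by rewrite lexx lerDl Vn.
  case: h4 => h4; [exists (p.1, p.2)|exists (p.1 + W n.+1, p.2)
    |exists (p.1, p.2 + V n.+1)|exists (p.1 + W n.+1, p.2 + V n.+1)];
    by split=> //; exact: inside.
have [f Hf] : exists f : nat -> R * R -> R * R, forall n p, sub n p -> next n p (f n p).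
  have [F HF] := choice (fun np : nat * (R * R) => step np.1 np.2).
  by exists (fun n p => F (n, p)) => n p; exact: (HF (n, p)).
pose p_ := fix p_ n : R * R := if n is m.+1 then f m (p_ m) else (a, c).
have sub_ n : sub n (p_ n).
  elim: n => [|n IH]; last by have [] := Hf n _ IH.
  by split => //=; rewrite /W /V expr0 divr1; lra.
have next_ n := Hf n _ (sub_ n).
have Q0 n : nrm (Q 0%N (p_ 0%N)) <= 4 ^+ n * nrm (Q n (p_ n)).
  elim: n => [|n IH]; first by rewrite expr0 mul1r.
  apply: (le_trans IH); rewrite exprSr -mulrA ler_wpM2l ?exprn_ge0//.
  by have [] := next_ n.
have [|n|n|x0 Hx0] := @nested_point (fun n => (p_ n).1) W; [|..].
- by move=> n; have [_ /andP[]] := next_ n.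
- by have [_ /andP[_ ? _ _]] := next_ n; rewrite [W n]WS addrA lerD2r.
- exact: W0.
have [|n|n|y0 Hy0] := @nested_point (fun n => (p_ n).2) V; [|..].
- by move=> n; have [_ _ /andP[]] := next_ n.
- by have [_ _ /andP[_ ? _]] := next_ n; rewrite [V n]VS addrA lerD2r.
- exact: V0.
have Wa : W 0%N = b - a by rewrite /W expr0 divr1.
have Va : V 0%N = d - c by rewrite /V expr0 divr1.
have QE : Q 0%N (p_ 0%N) = rectint phi a b c d.
  by rewrite /Q /= Wa Va !(addrC _ (_ - _)) !subrK.
have [||L HL] := H x0 y0.
- by have := Hx0 0%N; rewrite /= Wa; lra.
- by have := Hy0 0%N; rewrite /= Va; lra.
apply: nrm_le0; rewrite -QE.
apply: (@le_eps0 _ (4 * (W 0%N + V 0%N) ^+ 2)) => e e0.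
have [del del0 Hd] := HL e e0.
have [n Hn] : exists n, W n + V n < del.
  pose K := (b - a) + (d - c).
  have [n Hn] : exists n, K / del < 2 ^+ n.
    exists (Num.truncn (K / del)).+1.
    apply: (lt_le_trans (truncnS_gt _)).
    by rewrite -natrX ler_nat ltnW// ltn_expl.
  exists n; rewrite /W /V -mulrDl -/K ltr_pdivrMr ?exprn_gt0//.
  by rewrite mulrC -ltr_pdivrMr.
have := Q0 n; move=> /le_trans; apply.
have [s1 s2 s3 s4] := sub_ n.
have Wn := W0 n; have Vn := V0 n.
have xi := Hx0 n; have yi := Hy0 n.
have := @rectint_small phi a b c d (p_ n).1 (p_ n).2 (W n) (V n) x0 y0 e L
  H s1 s2 s3 s4 Wn Vn (ltW e0) xi yi.
move=> Hsm.
(* The factor 4^n lost in n subdivisions is compensated by the square of the side lengths, which are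
   divided by 2^n. *)
apply: (@le_trans _ _ (4 ^+ n * (e * (4 * (W n + V n) ^+ 2)))).
  rewrite ler_wpM2l ?exprn_ge0//; apply: Hsm => s t si ti.
  apply: Hd; [lra|lra| |]; rewrite ltr_norml; lra.
rewrite /W /V !expr0 !divr1 -mulrDl expr_div_n -exprM mulnC exprM.
rewrite (_ : 2 ^+ 2 = 4 :> R); last by rewrite -natrX.
rewrite le_eqVlt; apply/orP; left; apply/eqP; field.
by rewrite expf_eq0 pnatr_eq0 andbF.
Qed.

End goursat.

(** * Circular means *)

Section polar.
Variable R : realType.
Local Notation C := R[i].
Local Notation nrm := (@Normc.normc R).

(** This is exp(s + it). In the logarithmic coordinate an annulus is a rectangle and a circle a
    vertical segment, so that Goursat's theorem for rectangles suffices. *)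
Definition expc (s t : R) : C := (expR s)%:C * expit t.

Lemma expitD (s t : R) : expit (s + t) = expit s * expit t :> C.
Proof.
rewrite /expit cosD sinD; apply/eqP; rewrite eq_complex/= eqxx/=.
by apply/eqP; ring.
Qed.

Lemma expitDpi (t : R) : expit (t + 2 * pi) = expit t :> C.
Proof.
by rewrite /expit mulr_natl cosD2pi sinD2pi.
Qed.

Lemma expcD s t h k : expc (s + h) (t + k) = expc s t * expc h k.
Proof.
rewrite /expc expRD expitD rmorphM/=; ring.
Qed.

Lemma nrm_expc s t : nrm (expc s t) = expR s.
Proof. by rewrite /expc nrm_rexpit// ltW// expR_gt0. Qed.

Lemma real_deriv_eps (f : R -> R) (x l : R) : is_derive x 1 f l ->
  forall e, 0 < e -> exists2 d, 0 < d & forall h, `|h| < d ->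
    `|f (x + h) - f x - h * l| <= e * `|h|.
Proof. by move=> /(@is_derive_eps R f x l). Qed.

Lemma expc_diff (e : R) : 0 < e -> exists2 d : R, 0 < d & forall h k : R,
  `|h| < d -> `|k| < d ->
  nrm (expc h k - 1 - (h +i* k)) <= e * (`|h| + `|k|).
Proof.
(* The error is split below into three terms, of sizes e/5 |h|, 4e/5 |k| and e/5 |k|. *)
move=> e0; have e4 : 0 < e / 5 by rewrite divr_gt0.
have dE : is_derive (0:R) 1 (@expR R) 1.
  by have := is_derive_expR (0:R); rewrite expR0.
have [d1 d10 H1] := real_deriv_eps dE e4.
have dc : is_derive (0:R) 1 (@cos R) 0.
  by have := is_derive_cos (0:R); rewrite sin0 oppr0.
have ds : is_derive (0:R) 1 (@sin R) 1.
  by have := is_derive_sin (0:R); rewrite cos0.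
have [d2 d20 H2] := real_deriv_eps dc e4.
have [d3 d30 H3] := real_deriv_eps ds e4.
exists (Num.min 1 (Num.min (Num.min d1 (e / 5)) (Num.min d2 d3))).
  by rewrite !lt_min ltr01 d10 d20 d30 e4.
move=> h k; rewrite !lt_min => /andP[h1 /andP[/andP[hd1 he] _]].
move=> /andP[_ /andP[_ /andP[kd2 kd3]]].
have := H1 h hd1; have := H2 k kd2; have := H3 k kd3.
rewrite !add0r expR0 cos0 sin0 mulr0 !subr0 !mulr1 => K3 K2 K1.
have -> : expc h k - 1 - (h +i* k) =
   (expR h - 1 - h)%:C * expit k + (1 + h)%:C * (expit k - 1 - 'i%C * k%:C)
   + 'i%C * (h * k)%:C.
  rewrite /expc /expit; apply/eqP; rewrite eq_complex/=.
  by apply/andP; split; apply/eqP; ring.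
have A1 : nrm ((expR h - 1 - h)%:C * expit k) <= e / 5 * `|h|.
  by rewrite nrmM nrm_expit mulr1 nrm_real.
have A2 : nrm (expit k - 1 - 'i%C * k%:C) <= 2 * (e / 5 * `|k|).
  apply: (le_trans (nrm_ReIm _)); rewrite mulr_natl mulr2n; apply: lerD.
    by rewrite /expit /= !mul0r mul1r oppr0 !(subr0, addr0).
  by rewrite /expit /= !mul0r !mul1r ?addr0 ?add0r ?subr0 ?oppr0 ?addr0.
have A3 : nrm ((1 + h)%:C * (expit k - 1 - 'i%C * k%:C)) <= 4 * (e / 5 * `|k|).
  rewrite nrmM nrm_real.
  have -> : 4 * (e / 5 * `|k|) = 2 * (2 * (e / 5 * `|k|)) by ring.
  apply: ler_pM; rewrite ?nrm_ge0//.
  by rewrite (le_trans (ler_normD _ _))// normr1; lra.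
have A4 : nrm ('i%C * (h * k)%:C) <= e / 5 * `|k|.
  rewrite nrmM nrm_real nrm_i mul1r.
  by rewrite normrM ler_wpM2r// ltW.
apply: (le_trans (nrmD _ _)); apply: (le_trans (lerD (le_trans (nrmD _ _) (lerD A1 A3)) A4)).
have hh : 0 <= e * `|h| by rewrite mulr_ge0// ltW.
move: (e * `|h|) (e * `|k|) hh (mulrDr e `|h| `|k|) (mulrAC e 5^-1 `|h|) (mulrAC e 5^-1 `|k|) => x y *; lra.
Qed.

(** The chain rule for u o exp. Since exp turns sums into products, the expansion of exp at 0 in
    [expc_diff] is enough at every point. *)
Lemma cder_polar (u : C -> C) (s0 t0 : R) (L : C) : cder u (expc s0 t0) L ->
  forall e : R, 0 < e -> exists2 d : R, 0 < d & forall s t : R,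
    `|s - s0| < d -> `|t - t0| < d ->
    nrm (u (expc s t) - u (expc s0 t0)
      - L * expc s0 t0 * ((s - s0) +i* (t - t0)))
    <= e * (`|s - s0| + `|t - t0|).
Proof.
move=> du e e0; set z := expc s0 t0 in du *.
pose A := nrm L * nrm z + 1.
have A0 : 0 < A by rewrite ltr_wpDl// mulr_ge0 ?nrm_ge0.
have z0 : 0 < nrm z by rewrite nrm_expc expR_gt0.
have e1 : 0 < Num.min 1 (e / (2 * A)) by rewrite lt_min ltr01 divr_gt0// mulr_gt0.
have e2 : 0 < e / (4 * nrm z) by rewrite divr_gt0// mulr_gt0.
have [d1 d10 H1] := expc_diff e1.
have [d2 d20 H2] := (cderP _ _ _).1 du _ e2.
have dz : 0 < d2 / (4 * nrm z) by rewrite divr_gt0// mulr_gt0.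
exists (Num.min d1 (d2 / (4 * nrm z))); first by rewrite lt_min d10.
move=> s t; rewrite !lt_min => /andP[s1 s2] /andP[t1 t2].
set h := s - s0 in s1 s2 *; set k := t - t0 in t1 t2 *.
have -> : expc s t = z + z * (expc h k - 1).
  by rewrite mulrBr mulr1 subrKC -expcD /h /k !subrKC.
have Hr := H1 h k s1 t1.
set r := expc h k - 1 - _ in Hr.
have rE : expc h k - 1 = (h +i* k) + r by rewrite /r subrKC.
have m0 : nrm (h +i* k) <= `|h| + `|k| by have := nrm_ReIm (h +i* k).
set m := `|h| + `|k| in m0 Hr *.
have m_ge0 : 0 <= m by rewrite addr_ge0.
have W : nrm (expc h k - 1) <= 2 * m.
  rewrite rE (le_trans (nrmD _ _))// mulr_natl mulr2n lerD//.
  by rewrite (le_trans Hr)// ler_piMl// ge_min lexx.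
set w := z * (expc h k - 1).
have wn : nrm w <= nrm z * (2 * m) by rewrite /w nrmM ler_wpM2l ?nrm_ge0.
have wd : nrm w < d2.
  apply: (le_lt_trans wn).
  rewrite (_ : d2 = nrm z * (2 * (d2 / (4 * nrm z) + d2 / (4 * nrm z)))).
    by rewrite ltr_pM2l// ltr_pM2l// ltrD.
  by field; rewrite gt_eqF.
have := H2 w wd.
have -> : u (z + w) - u z - L * z * (h +i* k) = (u (z + w) - u z - w * L) + L * z * r.
  by rewrite /w rE; ring.
move=> K; apply: (le_trans (nrmD _ _)).
rewrite (_ : e * m = e / (4 * nrm z) * (nrm z * (2 * m)) + A * (e / (2 * A) * m)); last first.
  by field; rewrite ?gt_eqF.
apply: lerD; first by apply: (le_trans K); rewrite ler_wpM2l// ltW.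
rewrite (nrmM (L * z)) (nrmM L); apply: ler_pM; rewrite ?mulr_ge0 ?nrm_ge0//.
  by rewrite /A lerDl.
by apply: (le_trans Hr); rewrite ler_wpM2r// ge_min lexx orbT.
Qed.

Definition cmean2pi (u : C -> C) (r : R) : C :=
  cint 0 (2 * pi) (fun t => u (r%:C * expit t)).

Lemma mulI_eq0 (x y : C) : 'i%C * x - (y - y) = 0 -> x = 0.
Proof.
have i0 : 'i%C != 0 :> C by rewrite eq_complex/= oner_eq0 andbF.
by rewrite subrr subr0 => E; apply: (mulfI i0); rewrite E mulr0.
Qed.

(** In logarithmic coordinates the horizontal edges cancel by periodicity, and the vertical edges
    carry the two means. *)
Lemma cmean_annulus (u : C -> C) (r1 r2 : R) : 0 < r1 -> r1 <= r2 ->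
  (forall z, r1 <= nrm z <= r2 -> exists L, cder u z L) ->
  cmean2pi u r1 = cmean2pi u r2.
Proof.
move=> r10 r12 H; have r20 := lt_le_trans r10 r12.
have ab : ln r1 <= ln r2 by rewrite ler_ln ?posrE.
have cd : 0 <= 2 * pi :> R by rewrite mulr_ge0// pi_ge0.
pose phi s t := u (expc s t).
have Hphi : rectdiff phi (ln r1) (ln r2) 0 (2 * pi).
  move=> s0 t0 si ti; have [|L HL] := H (expc s0 t0).
    rewrite nrm_expc; case/andP: si => s1 s2.
    by rewrite -ler_expR lnK ?posrE// in s1; rewrite s1 -ler_expR lnK ?posrE// in s2 *.
  exists (L * expc s0 t0) => e e0; have [d d0 Hd] := cder_polar HL e0.
  by exists d => // s t _ _; exact: Hd.
have := goursat ab cd Hphi; rewrite /rectint.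
have -> : cint (ln r1) (ln r2) (phi ^~ (2 * pi)) = cint (ln r1) (ln r2) (phi ^~ 0).
  apply: eq_cint => t _; rewrite /phi /expc -[2 * pi]add0r.
  by rewrite expitDpi.
move=> /mulI_eq0 /subr0_eq; rewrite /phi /expc !lnK ?posrE//.
Qed.

(** Compactness of the segment makes the radius around [x0] uniform; it gives continuity of the
    means in the radius. *)
Lemma tube (P : R -> R -> Prop) (a b x0 : R) :
  (forall t, a <= t <= b -> exists2 d : R, 0 < d & forall s x,
     `|s - t| < d -> `|x - x0| < d -> P x s) ->
  exists2 d : R, 0 < d & forall s x, a <= s <= b -> `|x - x0| < d -> P x s.
Proof.
move=> H.
have /compact_near_coveringP cpt := @segment_compact R a b.
have Hcov t : `[a, b]%classic t -> \forall t' \near t & x \near x0, P x t'.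
  rewrite /= in_itv/= => tab; have [d d0 Hd] := H t tab.
  exists (ball t d, ball x0 d) => /=.
    by split; apply: nbhsx_ballx.
  by move=> [s x] [/= sd xd]; apply: Hd; rewrite distrC.
have [d /= d0 Hd] := cpt R (nbhs x0) P _ Hcov.
exists d => // s x sab xd.
by apply: (Hd x); rewrite /= ?in_itv// distrC.
Qed.

Definition ccont_disc (u : C -> C) := forall z, nrm z < 1 -> forall e : R,
  0 < e -> exists2 d : R, 0 < d &
    forall w, nrm (w - z) < d -> nrm (u w - u z) <= e.

Lemma lipschitz1 (f df : R -> R) (s t : R) :
  (forall x : R, is_derive x 1 f (df x)) -> (forall x, `|df x| <= 1) ->
  `|f s - f t| <= `|s - t|.
Proof.
move=> Df df1; have [->|st] := eqVneq s t; first by rewrite !subrr normr0.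
wlog ts : s t st / t < s.
  move=> W; have [ts|ts|/eqP] := ltgtP t s; first exact: W.
    by rewrite distrC [leRHS]distrC; apply: W; rewrite // eq_sym.
  by rewrite eq_sym (negbTE st).
have cf : {within `[t, s], continuous f}.
  apply: derivable_within_continuous => x _; by have [] := Df x.
have [c _ ->] := @MVT R f df t s ts (fun x _ => Df x) cf.
by rewrite normrM ler_piMl.
Qed.

Lemma expit_lip (s t : R) : nrm (expit s - expit t) <= 2 * `|s - t|.
Proof.
apply: (le_trans (nrm_ReIm _)); rewrite mulr_natl mulr2n; apply: lerD => /=.
- apply: (@lipschitz1 cos (fun x => - sin x)) => x.
  by rewrite normrN ler_norml sin_geN1 sin_le1.
- apply: (@lipschitz1 sin cos) => x.
  by rewrite ler_norml cos_geN1 cos_le1.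
Qed.

Lemma polar_lip (r r0 s t : R) : `|r| <= 1 ->
  nrm (r%:C * expit s - r0%:C * expit t) <= 2 * `|s - t| + `|r - r0|.
Proof.
move=> r1.
have -> : r%:C * expit s - r0%:C * expit t =
    r%:C * (expit s - expit t) + (r - r0)%:C * expit t.
  by rewrite rmorphB/=; ring.
apply: (le_trans (nrmD _ _)); rewrite !nrmM !nrm_real nrm_expit mulr1 lerD2r.
by apply: (le_trans _ (expit_lip s t)); rewrite ler_piMl ?nrm_ge0.
Qed.

Lemma circle_iccont (u : C -> C) (r a b : R) : ccont_disc u -> 0 <= r < 1 ->
  iccont a b (fun t => u (r%:C * expit t)).
Proof.
move=> cu /andP[r0 r1] t _ e e0.
have [|d d0 Hd] := cu (r%:C * expit t) _ e e0; first by rewrite nrm_rexpit.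
exists (d / 2); first by rewrite divr_gt0.
move=> s _ sd; apply: Hd; apply: le_lt_trans (@polar_lip r r s t _) _.
  by rewrite ger0_norm// ltW.
by rewrite subrr normr0 addr0; lra.
Qed.

Lemma cmean_cont (u : C -> C) (r0 : R) : ccont_disc u -> 0 <= r0 < 1 ->
  forall e : R, 0 < e -> exists2 d : R, 0 < d &
    forall r, 0 <= r < 1 -> `|r - r0| < d ->
      nrm (cmean2pi u r - cmean2pi u r0) <= e * (4 * pi).
Proof.
move=> cu ri e e0.
have [|d d0 Hd] := @tube (fun r t => 0 <= r < 1 ->
  nrm (u (r%:C * expit t) - u (r0%:C * expit t)) <= e) 0 (2 * pi) r0.
  move=> t _; case/andP: (ri) => r00 r01.
  have e2 : 0 < e / 2 by rewrite divr_gt0.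
  have [|d d0 Hd] := cu (r0%:C * expit t) _ _ e2; first by rewrite nrm_rexpit.
  exists (d / 3); first by rewrite divr_gt0.
  move=> s r sd rd /andP[r_0 r_1].
  have H1 : nrm (u (r%:C * expit s) - u (r0%:C * expit t)) <= e / 2.
    apply: Hd; apply: le_lt_trans (@polar_lip r r0 s t _) _; last by lra.
    by rewrite ger0_norm// ltW.
  have H2 : nrm (u (r0%:C * expit s) - u (r0%:C * expit t)) <= e / 2.
    apply: Hd; apply: le_lt_trans (@polar_lip r0 r0 s t _) _.
      by rewrite ger0_norm// ltW.
    by rewrite subrr normr0 addr0; lra.
  have -> : u (r%:C * expit s) - u (r0%:C * expit s) =
    (u (r%:C * expit s) - u (r0%:C * expit t)) -
    (u (r0%:C * expit s) - u (r0%:C * expit t)) by ring.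
  by apply: (le_trans (nrmB _ _)); rewrite (splitr e) lerD.
exists d => // r r_i rd.
have cd : 0 <= 2 * pi :> R by rewrite mulr_ge0// pi_ge0.
have I s : 0 <= s < 1 -> cintble 0 (2 * pi) (fun t => u (s%:C * expit t)).
  by move=> si; apply: iccont_intble; exact: circle_iccont.
rewrite /cmean2pi -cintB; [|exact: I|exact: I].
rewrite (_ : e * _ = 2 * ((2 * pi - 0) * e)); last by ring.
apply: cint_bound => //; first by apply: cintbleB; exact: I.
by move=> t ti; exact: Hd.
Qed.

(* The exceptional circle allows for a difference quotient, which is only known
   to be continuous at its base point. On either side of it the mean is constant,
   and it is continuous across it. *)
Theorem mean_value (u : C -> C) (rho r : R) : ccont_disc u ->
  (forall z, nrm z < 1 -> nrm z != rho -> exists L, cder u z L) ->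
  0 <= r < 1 -> cmean2pi u r = (2 * pi)%:C * u 0.
Proof.
move=> cu du ri.
have M0 : cmean2pi u 0 = (2 * pi)%:C * u 0.
  rewrite /cmean2pi -[in RHS](subr0 (2 * pi)) -cint_cst ?mulr_ge0 ?pi_ge0//.
  by apply: eq_cint => t _; rewrite mul0r.
rewrite -M0.
have cst r1 r2 : 0 < r1 -> r1 <= r2 -> r2 < 1 -> rho < r1 \/ r2 < rho ->
    cmean2pi u r1 = cmean2pi u r2.
  move=> r10 r12 r21 Hr; apply: cmean_annulus => // z /andP[z1 z2].
  apply: du; first exact: le_lt_trans r21.
  case: Hr => Hr; first by rewrite gt_eqF// (lt_le_trans Hr).
  by rewrite lt_eqF// (le_lt_trans z2).
have near0 r1 : 0 <= r1 < 1 -> (rho <= 0 \/ r1 < rho) -> cmean2pi u r1 = cmean2pi u 0.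
  move=> /andP[]; rewrite le_eqVlt => /predU1P[<-//|r10 r11] Hr.
  apply/eqP; rewrite -subr_eq0; apply/eqP/nrm_le0.
  apply: (@le_eps0 _ _ (4 * pi)) => e e0.
  have [|d d0 Hd] := @cmean_cont u 0 cu _ e e0; first by rewrite lexx ltr01.
  pose r2 := Num.min r1 (d / 2).
  have r20 : 0 < r2 by rewrite lt_min r10 divr_gt0.
  have r21 : r2 <= r1 by rewrite ge_min lexx.
  have r22 : r2 <= d / 2 by rewrite ge_min lexx orbT.
  rewrite -(@cst r2 r1) //; last first.
    by case: Hr => Hr; [left; exact: le_lt_trans Hr r20|right].
  by apply: Hd; rewrite ?ltW// ?(le_lt_trans r21)// subr0 gtr0_norm//; lra.
(* A nonpositive [rho] excludes at most the origin, which lies in no annulus. *)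
have [rle|rgt] := leP rho 0; first by apply: near0 => //; left.
have [rr|rr|rr] := ltgtP r rho; first by apply: near0 => //; right.
- have rho1 : rho < 1 by case/andP: ri => _; exact: lt_trans.
  have -> : cmean2pi u 0 = cmean2pi u rho.
    apply/eqP; rewrite -subr_eq0; apply/eqP/nrm_le0.
    apply: (@le_eps0 _ _ (4 * pi)) => e e0.
    have [|d d0 Hd] := @cmean_cont u rho cu _ e e0; first by rewrite ltW.
    pose r2 := Num.max 0 (rho - d / 2).
    have r20 : 0 <= r2 by rewrite le_max lexx.
    have r21 : r2 < rho by rewrite gt_max rgt; lra.
    have r22 : rho - d / 2 <= r2 by rewrite le_max lexx orbT.
    rewrite -(@near0 r2); last 2 first.
      by rewrite r20 (lt_trans r21).
      by right.
    by apply: Hd; rewrite ?r20 ?(lt_trans r21)// ltr_norml; lra.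
  apply/esym/eqP; rewrite -subr_eq0; apply/eqP/nrm_le0.
  apply: (@le_eps0 _ _ (4 * pi)) => e e0.
  have [|d d0 Hd] := @cmean_cont u rho cu _ e e0; first by rewrite ltW.
  pose r2 := Num.min r (rho + d / 2).
  have r20 : rho < r2 by rewrite lt_min rr; lra.
  have r21 : r2 <= r by rewrite ge_min lexx.
  have r22 : r2 <= rho + d / 2 by rewrite ge_min lexx orbT.
  case/andP: ri => _ r1.
  rewrite -(@cst r2 r); last 4 first.
    exact: lt_trans r20.
    by [].
    by [].
    by left.
  rewrite nrmBC; apply: Hd.
    by rewrite (le_lt_trans r21)// andbT ltW// (lt_trans rgt).
  by rewrite ltr_norml; lra.
- rewrite rr.
  apply/eqP; rewrite -subr_eq0; apply/eqP/nrm_le0.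
  apply: (@le_eps0 _ _ (4 * pi)) => e e0.
  have rho1 : rho < 1 by case/andP: ri; rewrite rr.
  have [|d d0 Hd] := @cmean_cont u rho cu _ e e0; first by rewrite ltW.
  pose r2 := Num.max 0 (rho - d / 2).
  have r20 : 0 <= r2 by rewrite le_max lexx.
  have r21 : r2 < rho by rewrite gt_max rgt; lra.
  have r22 : rho - d / 2 <= r2 by rewrite le_max lexx orbT.
  rewrite -(@near0 r2); last 2 first.
    by rewrite r20 (lt_trans r21).
    by right.
  rewrite nrmBC; apply: Hd; first by rewrite r20 (lt_trans r21).
  by rewrite ltr_norml; lra.
Qed.

End polar.

(** * Cauchy's formula *)

Section cauchy.
Variable R : realType.
Local Notation C := R[i].
Local Notation nrm := (@Normc.normc R).
Implicit Types (f : C -> C) (z w : C).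

Lemma Hol_cont f : Hol f -> ccont_disc f.
Proof. by move=> /HolP H z hz; exact: cder_cont (H z hz). Qed.

Lemma twopi_gt0 : 0 < 2 * pi :> R.
Proof. by rewrite mulr_gt0// pi_gt0. Qed.

Lemma cder_cauchy_kernel z0 z : z != z0 ->
  exists L, cder (fun w => w / (w - z0)) z L.
Proof.
move=> zz0; eexists; apply: cderM; first exact: cder_id.
apply: cderV; first by rewrite subr_eq0.
by apply: cderD; [exact: cder_id|exact: cder_cst].
Qed.

(** The kernel w / (w - z0) is differentiable for |w| >= r, so its mean does not depend on the
    radius from r on, and it tends uniformly to 1 as the radius grows. *)
Lemma cauchy_kernel_mean z0 (r : R) : nrm z0 < r ->
  cint 0 (2 * pi) (fun t => r%:C * expit t / (r%:C * expit t - z0))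
  = (2 * pi)%:C.
Proof.
move=> z0r; have r0 : 0 < r := le_lt_trans (nrm_ge0 _) z0r.
have p0 := ltW twopi_gt0.
apply/eqP; rewrite -subr_eq0; apply/eqP/nrm_le0.
apply: (@le_eps0 _ _ (2 * (2 * pi))) => e e0.
have d0 : 0 < r - nrm z0 by rewrite subr_gt0.
(* With this radius e (S - |z0|) = e (r - |z0|) + |z0| >= |z0|, so the kernel differs from 1 by at
   most e on the circle. *)
pose S := r + nrm z0 / e.
have z00 := nrm_ge0 z0.
have rS : r <= S by rewrite lerDl divr_ge0 ?nrm_ge0// ltW.
have S0 : 0 < S by exact: lt_le_trans rS.
have S0' := ltW S0.
pose v w := w / (w - z0).
have dv z : r <= nrm z -> exists L, cder v z L.
  move=> rz; apply: cder_cauchy_kernel; apply: contraTneq rz => ->.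
  by rewrite -ltNge.
have -> : cint 0 (2 * pi) (fun t => r%:C * expit t / (r%:C * expit t - z0))
    = cmean2pi v S.
  by apply: (@cmean_annulus R v r S r0 rS) => z /andP[rz _]; exact: dv.
have ne t : S%:C * expit t - z0 != 0.
  rewrite subr_eq0; apply/eqP => /(congr1 nrm).
  rewrite nrm_rexpit// => E.
  by have := lt_le_trans z0r rS; rewrite E ltxx.
have Iv : cintble 0 (2 * pi) (fun t => v (S%:C * expit t)).
  apply: iccont_intble => t _ d dd.
  have rz : r <= nrm (S%:C * expit t) by rewrite nrm_rexpit.
  have [L HL] := dv _ rz.
  have [de de0 Hd] := cder_cont HL dd.
  exists (de / (2 * S)); first by rewrite divr_gt0// mulr_gt0.
  move=> s _ sd; apply: Hd.
  rewrite -mulrBr nrmM nrm_real gtr0_norm//.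
  apply: (@le_lt_trans _ _ (S * (2 * `|s - t|))).
    by rewrite ler_wpM2l ?(ltW S0)// expit_lip.
  by rewrite mulrCA mulrA mulrC -ltr_pdivlMr// mulr_gt0.
have -> : (2 * pi)%:C = cint 0 (2 * pi) (fun=> (1 : C)).
  by rewrite cint_cst// subr0 mulr1.
rewrite /cmean2pi -cintB//; last exact: cintble_cst.
rewrite (_ : e * _ = 2 * ((2 * pi - 0) * e)); last by ring.
apply: cint_bound => //; first by apply: cintbleB => //; exact: cintble_cst.
move=> t _; rewrite /v.
have -> : S%:C * expit t / (S%:C * expit t - z0) - 1 =
    z0 / (S%:C * expit t - z0).
  by field; exact: ne.
rewrite nrmM nrmV ler_pdivrMr; last by rewrite nrm_gt0.
have : S - nrm z0 <= nrm (S%:C * expit t - z0).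
  by rewrite -{1}(nrm_rexpit t S0'); exact: nrm_subl.
move=> H; apply: (@le_trans _ _ (e * (S - nrm z0))); last by rewrite ler_wpM2l// ltW.
rewrite /S mulrBr mulrDr (mulrC e (_ / _)) divfK ?gt_eqF//.
by rewrite -[leLHS]add0r addrAC lerD2r -mulrBr mulr_ge0// ltW.
Qed.

Lemma diffquot_cont f z0 : Hol f -> nrm z0 < 1 ->
  let q := fun w => if w == z0 then derive1 f z0 else (f w - f z0) / (w - z0) in
  ccont_disc q /\ (forall z, nrm z < 1 -> z != z0 -> exists L, cder q z L).
Proof.
move=> Hf z01 q; have df := (HolP f).1 Hf.
have dq z : nrm z < 1 -> z != z0 -> exists L, cder q z L.
  move=> z1 zz0.
  have [L HL] : exists L, cder (fun w => (f w - f z0) / (w - z0)) z L.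
    eexists; apply: cderM.
      by apply: cderD; [exact: df|exact: cder_cst].
    apply: cderV; first by rewrite subr_eq0.
    by apply: cderD; [exact: cder_id|exact: cder_cst].
  exists L; apply: (@cder_near _ _ _ _ _ (nrm (z - z0))) HL.
    by rewrite nrm_gt0 subr_eq0.
  move=> w wz; rewrite /q; case: eqP => // wz0.
  by move: wz; rewrite wz0 nrmBC ltxx.
split=> // z z1; have [->{z z1}|zz0] := eqVneq z z0; last first.
  by have [L HL] := dq z z1 zz0; exact: cder_cont HL.
move=> e e0; have [d d0 Hd] := (cderP _ _ _).1 (df z0 z01) e e0.
exists d => // w wd; rewrite /q eqxx; case: eqP => [_|/eqP wz0].
  by rewrite subrr nrm0 ltW.
have wz : w - z0 != 0 by rewrite subr_eq0.
have := Hd (w - z0) wd; rewrite [z0 + _]addrC subrK => H.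
have -> : (f w - f z0) / (w - z0) - derive1 f z0 =
    (f w - f z0 - (w - z0) * derive1 f z0) / (w - z0) by field.
by rewrite nrmM nrmV ler_pdivrMr// nrm_gt0.
Qed.

Lemma ccont_discM (u v : C -> C) : ccont_disc u -> ccont_disc v ->
  ccont_disc (fun w => u w * v w).
Proof.
move=> cu cv z z1 e e0.
pose A := nrm (u z) + nrm (v z) + 1.
have A0 : 0 < A by rewrite ltr_wpDl// addr_ge0 ?nrm_ge0.
have e1 : 0 < Num.min 1 (e / (2 * A)) by rewrite lt_min ltr01 divr_gt0// mulr_gt0.
have [d1 d10 H1] := cu z z1 _ e1; have [d2 d20 H2] := cv z z1 _ e1.
exists (Num.min d1 d2); first by rewrite lt_min d10.
move=> w; rewrite lt_min => /andP[/H1 + /H2].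
rewrite !le_min => /andP[_ Hu] /andP[v1 Hv].
have -> : u w * v w - u z * v z = (u w - u z) * v w + u z * (v w - v z) by ring.
have vw : nrm (v w) <= A.
  have -> : v w = (v w - v z) + v z by rewrite subrK.
  apply: (le_trans (nrmD _ _)); rewrite /A (addrC _ 1) addrA lerD2r.
  by rewrite (le_trans v1)// lerDl nrm_ge0.
have uz : nrm (u z) <= A by rewrite /A -addrA lerDl addr_ge0 ?nrm_ge0.
apply: (le_trans (nrmD _ _)); rewrite !nrmM.
have -> : e = e / (2 * A) * A + A * (e / (2 * A)) by field; rewrite gt_eqF.
by apply: lerD; apply: ler_pM; rewrite ?nrm_ge0.
Qed.

Lemma Hol_id : Hol (fun w : C => w).
Proof. by have [] := @Hol_cder R _ (fun=> 1) (fun z _ => cder_id z). Qed.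

Lemma circle_neq z (r t : R) : nrm z < r -> r%:C * expit t - z != 0.
Proof.
move=> zr; rewrite subr_eq0; apply: contraTneq zr => <-.
have [r0|r0] := leP 0 r; first by rewrite nrm_rexpit// ltxx.
by rewrite -leNgt (le_trans (ltW r0))// nrm_ge0.
Qed.

Lemma circle_dist z (r t : R) : nrm z < r ->
  r - nrm z <= nrm (r%:C * expit t - z).
Proof.
move=> zr; have r0 : 0 <= r by rewrite (le_trans _ (ltW zr))// nrm_ge0.
by rewrite -{1}(nrm_rexpit t r0); exact: nrm_subl.
Qed.

Lemma circle_quot_iccont (u v : R -> C) (a b : R) :
  iccont a b u -> iccont a b v -> (forall t, v t != 0) ->
  iccont a b (fun t => u t / v t).
Proof.
move=> cu cv v0 t tab e e0.
pose A := nrm (u t) + nrm (v t) + 1.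
have A0 : 0 < A by rewrite ltr_wpDl// addr_ge0 ?nrm_ge0.
have vt0 : 0 < nrm (v t) by rewrite nrm_gt0.
pose e' := e * nrm (v t) ^+ 2 / (4 * A).
have e'0 : 0 < e' by rewrite divr_gt0// mulr_gt0// exprn_gt0.
have [d1 d10 H1] := cu t tab _ e'0.
have e2 : 0 < Num.min e' (nrm (v t) / 2) by rewrite lt_min e'0 divr_gt0.
have [d2 d20 H2] := cv t tab _ e2.
exists (Num.min d1 d2); first by rewrite lt_min d10.
move=> s sab; rewrite lt_min => /andP[/(H1 s sab) K1 /(H2 s sab)].
rewrite le_min => /andP[K2 K3].
have vs : nrm (v t) / 2 <= nrm (v s) by have := nrm_subr (v s) (v t); lra.
have vs0 : 0 < nrm (v s) by rewrite nrm_gt0.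
have -> : u s / v s - u t / v t =
    ((u s - u t) * v t - u t * (v s - v t)) / (v s * v t).
  by field; rewrite !v0.
rewrite nrmM nrmV ler_pdivrMr nrmM ?mulr_gt0//.
apply: (le_trans (nrmB _ _)); rewrite !nrmM.
apply: (@le_trans _ _ (e' * A + A * e')).
  apply: lerD; apply: ler_pM; rewrite ?nrm_ge0//.
    by rewrite /A -addrA addrCA lerDl addr_ge0 ?nrm_ge0.
  by rewrite /A -addrA lerDl addr_ge0 ?nrm_ge0.
have -> : e' * A + A * e' = e * (nrm (v t) / 2 * nrm (v t)).
  by rewrite /e'; field; rewrite gt_eqF.
by rewrite ler_wpM2l ?(ltW e0)// ler_wpM2r// ltW.
Qed.

Lemma iccontM (u v : R -> C) (a b : R) :
  iccont a b u -> iccont a b v -> iccont a b (fun t => u t * v t).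
Proof.
move=> cu cv t tab e e0.
pose A := nrm (u t) + nrm (v t) + 1.
have A0 : 0 < A by rewrite ltr_wpDl// addr_ge0 ?nrm_ge0.
have e1 : 0 < Num.min 1 (e / (2 * A)) by rewrite lt_min ltr01 divr_gt0// mulr_gt0.
have [d1 d10 H1] := cu t tab _ e1; have [d2 d20 H2] := cv t tab _ e1.
exists (Num.min d1 d2); first by rewrite lt_min d10.
move=> w wab; rewrite lt_min => /andP[/(H1 w wab) + /(H2 w wab)].
rewrite !le_min => /andP[_ Hu] /andP[v1 Hv].
have -> : u w * v w - u t * v t = (u w - u t) * v w + u t * (v w - v t) by ring.
have vw : nrm (v w) <= A.
  have -> : v w = (v w - v t) + v t by rewrite subrK.
  apply: (le_trans (nrmD _ _)); rewrite /A (addrC _ 1) addrA lerD2r.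
  by rewrite (le_trans v1)// lerDl nrm_ge0.
have uz : nrm (u t) <= A by rewrite /A -addrA lerDl addr_ge0 ?nrm_ge0.
apply: (le_trans (nrmD _ _)); rewrite !nrmM.
have -> : e = e / (2 * A) * A + A * (e / (2 * A)) by field; rewrite gt_eqF.
by apply: lerD; apply: ler_pM; rewrite ?nrm_ge0.
Qed.

Lemma circle_iccont_id (r a b : R) (z : C) :
  iccont a b (fun t => r%:C * expit t - z).
Proof.
move=> t _ e e0; exists (e / (2 * (`|r| + 1))).
  by rewrite divr_gt0// mulr_gt0// ltr_wpDl.
move=> s _ sd; rewrite opprB addrA subrK -mulrBr nrmM nrm_real.
apply: (@le_trans _ _ ((`|r| + 1) * (2 * `|s - t|))).
  by apply: ler_pM; rewrite ?nrm_ge0 ?lerDl ?expit_lip.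
rewrite mulrCA mulrA mulrC -ler_pdivlMr ?mulr_gt0 ?ltr_wpDl//; exact: ltW.
Qed.

Lemma iccontX (v : R -> C) (a b : R) n :
  iccont a b v -> iccont a b (fun t => v t ^+ n).
Proof.
move=> cv; elim: n => [|n IH].
  by move=> t _ e e0; exists 1 => // s _ _; rewrite !expr0 subrr nrm0 ltW.
by under eq_fun do rewrite exprS; exact: iccontM.
Qed.

Lemma cauchy_int_iccont f (r a b : R) z n : Hol f -> nrm z < r -> r < 1 ->
  iccont a b (fun t => f (r%:C * expit t)
    * (r%:C * expit t / (r%:C * expit t - z) ^+ n)).
Proof.
move=> Hf zr r1; apply: iccontM.
  apply: circle_iccont; first exact: Hol_cont.
  by rewrite r1 andbT (le_trans _ (ltW zr))// nrm_ge0.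
apply: circle_quot_iccont.
- have := @circle_iccont_id r a b 0.
  by under eq_fun do rewrite subr0.
- by apply: iccontX; exact: circle_iccont_id.
- by move=> t; rewrite expf_neq0// circle_neq.
Qed.

(** The function w q(w), with q the difference quotient of f at z, vanishes at 0 and so has mean 0;
    the exceptional circle is the one through z. Splitting the quotient leaves the Cauchy integral
    of f minus f(z) times the mean of the kernel. *)
Theorem cauchy_formula f z (r : R) : Hol f -> nrm z < r -> r < 1 ->
  (2 * pi)%:C * f z = cint 0 (2 * pi) (fun t => f (r%:C * expit t)
    * (r%:C * expit t / (r%:C * expit t - z))).
Proof.
move=> Hf zr r1; have z1 := lt_trans zr r1.
have [cq dq] := diffquot_cont Hf z1.
set q := fun w => _ in cq dq.
have r0 : 0 <= r by rewrite (le_trans _ (ltW zr))// nrm_ge0.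
have r01 : 0 <= r < 1 by rewrite r0.
have := @mean_value R (fun w => w * q w) (nrm z) r
  (ccont_discM (Hol_cont Hol_id) cq) _ r01.
rewrite mul0r mulr0 => H.
have {}H : cint 0 (2 * pi) (fun t => f (r%:C * expit t)
    * (r%:C * expit t / (r%:C * expit t - z))
    - f z * (r%:C * expit t / (r%:C * expit t - z))) = 0.
  rewrite -H.
    apply: eq_cint => t _; rewrite /q.
    have ne := circle_neq t zr.
    rewrite -subr_eq0 (negbTE ne); ring.
  move=> w w1 wz; have [|L HL] := dq w w1; first by apply: contra_neq wz => ->.
  by eexists; apply: cderM; [exact: cder_id|exact: HL].
have I1 : cintble 0 (2 * pi) (fun t => f (r%:C * expit t)
    * (r%:C * expit t / (r%:C * expit t - z))).
  exact: iccont_intble (@cauchy_int_iccont f r 0 (2 * pi) z 1 Hf zr r1).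
have I2 : cintble 0 (2 * pi)
    (fun t => r%:C * expit t / (r%:C * expit t - z)).
  apply: iccont_intble; apply: circle_quot_iccont.
  - by have := @circle_iccont_id r 0 (2 * pi) 0; under eq_fun do rewrite subr0.
  - exact: circle_iccont_id.
  - by move=> t; exact: circle_neq.
move: H; rewrite cintB//; last exact: cintbleZ.
rewrite cintZ// cauchy_kernel_mean// => /subr0_eq ->.
by rewrite mulrC.
Qed.

End cauchy.

(** * ** * Cauchy integrals and the regularity of holomorphic functions *)

Section cauchy_estimates.
Variable R : realType.
Local Notation C := R[i].
Local Notation nrm := (@Normc.normc R).
Implicit Types (f : C -> C) (z w : C).

Lemma iccont_bounded (a b : R) (F : R -> C) : a <= b -> iccont a b F ->
  exists2 A : R, 0 < A & forall t, a <= t <= b -> nrm (F t) <= A.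
Proof.
move=> ab cF.
have [c _ Hc] := @EVT_max R (fun t => nrm (F t)) a b ab
  (icont_within (iccont_nrm cF)).
exists (nrm (F c) + 1); first by rewrite ltr_wpDl ?nrm_ge0.
move=> t tab; apply: (le_trans (Hc t _)); first by rewrite in_itv.
by rewrite lerDl.
Qed.

(** For n = 1, 2, 3 these are the Cauchy integrals of f, f' and f''/2 inside the circle of radius
    r. *)
Definition cauchy_pow f (r : R) n z : C := ((2 * pi)%:C)^-1 *
  cint 0 (2 * pi) (fun t => f (r%:C * expit t)
    * (r%:C * expit t / (r%:C * expit t - z) ^+ n)).

Lemma twopiC_neq0 : (2 * pi)%:C != 0 :> C.
Proof. by rewrite -nrm_gt0 nrm_real gtr0_norm twopi_gt0. Qed.

Lemma cauchy_pow1 f (r : R) z : Hol f -> nrm z < r -> r < 1 ->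
  cauchy_pow f r 1 z = f z.
Proof.
move=> Hf zr r1; rewrite /cauchy_pow -(cauchy_formula Hf zr r1).
by rewrite mulrA mulVf ?mul1r// twopiC_neq0.
Qed.

Lemma twopiV_bound (x : C) (B : R) : nrm x <= 2 * ((2 * pi - 0) * B) ->
  nrm (((2 * pi)%:C)^-1 * x) <= 2 * B.
Proof.
move=> H; rewrite nrmM nrmV nrm_real gtr0_norm ?twopi_gt0//.
rewrite mulrC ler_pdivrMr ?twopi_gt0//; apply: (le_trans H).
by rewrite subr0 le_eqVlt; apply/orP; left; apply/eqP; ring.
Qed.

Lemma cauchy_alg (k x y u d c : C) :
  k * x - k * y - d * (c * (k * u)) = k * ((x - y) - d * c * u).
Proof. ring. Qed.

(** An expansion of the kernel (Z - w)^(-n) around w = z, uniform in Z on the circle, passes to the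
    integral. The factor [c] is n in the uses, from the derivative of the power. *)
Lemma cauchy_pow_rem f (r A K : R) (c : C) n z w : Hol f ->
  nrm z < r -> nrm w < r -> r < 1 ->
  (forall t, 0 <= t <= 2 * pi -> nrm (f (r%:C * expit t)) <= A) ->
  (forall t, nrm (((r%:C * expit t - w) ^+ n)^-1 - ((r%:C * expit t - z) ^+ n)^-1
     - (w - z) * (c / (r%:C * expit t - z) ^+ n.+1)) <= K) ->
  nrm (cauchy_pow f r n w - cauchy_pow f r n z
    - (w - z) * (c * cauchy_pow f r n.+1 z)) <= 2 * (A * K).
Proof.
move=> Hf zr wr r1 HA HK.
have r0 : 0 <= r by rewrite (le_trans _ (ltW zr))// nrm_ge0.
have I y m : nrm y < r -> cintble 0 (2 * pi) (fun t => f (r%:C * expit t)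
    * (r%:C * expit t / (r%:C * expit t - y) ^+ m)).
  by move=> yr; apply: iccont_intble; exact: cauchy_int_iccont.
have -> : cauchy_pow f r n w - cauchy_pow f r n z
    - (w - z) * (c * cauchy_pow f r n.+1 z) = ((2 * pi)%:C)^-1 *
  cint 0 (2 * pi) (fun t => (f (r%:C * expit t)
    * (r%:C * expit t / (r%:C * expit t - w) ^+ n)
    - f (r%:C * expit t)
    * (r%:C * expit t / (r%:C * expit t - z) ^+ n))
    - ((w - z) * c) * (f (r%:C * expit t)
    * (r%:C * expit t / (r%:C * expit t - z) ^+ n.+1))).
  rewrite cintB; [|by apply: cintbleB; exact: I|by apply: cintbleZ; exact: I].
  rewrite cintB; [|exact: I|exact: I].
  rewrite cintZ; last exact: I.
  exact: cauchy_alg.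
apply: twopiV_bound; apply: cint_bound; first exact: ltW (twopi_gt0 R).
  apply: cintbleB; first by apply: cintbleB; exact: I.
  by apply: cintbleZ; exact: I.
move=> t ti.
set Z := r%:C * expit t.
have -> : f Z * (Z / (Z - w) ^+ n) - f Z * (Z / (Z - z) ^+ n)
    - (w - z) * c * (f Z * (Z / (Z - z) ^+ n.+1)) =
  (f Z * Z) * (((Z - w) ^+ n)^-1 - ((Z - z) ^+ n)^-1
     - (w - z) * (c / (Z - z) ^+ n.+1)) by ring.
rewrite nrmM; apply: ler_pM; rewrite ?nrm_ge0//; last exact: HK.
rewrite nrmM [nrm Z]nrm_rexpit//; apply: le_trans (HA t ti).
by rewrite ler_piMr ?nrm_ge0 ?(ltW r1).
Qed.

Lemma kernel_rem1 (r rho t : R) z w : nrm z <= rho -> nrm w <= rho -> rho < r ->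
  nrm (((r%:C * expit t - w) ^+ 1)^-1 - ((r%:C * expit t - z) ^+ 1)^-1
     - (w - z) * (1 / (r%:C * expit t - z) ^+ 2))
  <= nrm (w - z) ^+ 2 / (r - rho) ^+ 3.
Proof.
move=> zr wr rr; set Z := r%:C * expit t.
have z0 : Z - z != 0 by apply: circle_neq; exact: le_lt_trans rr.
have w0 : Z - w != 0 by apply: circle_neq; exact: le_lt_trans rr.
have -> : ((Z - w) ^+ 1)^-1 - ((Z - z) ^+ 1)^-1 - (w - z) * (1 / (Z - z) ^+ 2)
  = (w - z) ^+ 2 / ((Z - w) * (Z - z) ^+ 2) by field; rewrite z0 w0.
have d0 : 0 < r - rho by rewrite subr_gt0.
have dz : r - rho <= nrm (Z - z).
  apply: le_trans (circle_dist t (le_lt_trans zr rr)); lra.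
have dw : r - rho <= nrm (Z - w).
  apply: le_trans (circle_dist t (le_lt_trans wr rr)); lra.
rewrite nrmM nrmX nrmV ler_wpM2l ?exprn_ge0 ?nrm_ge0// lef_pV2; last 2 first.
- by rewrite posrE nrm_gt0 mulf_neq0 ?expf_neq0.
- by rewrite posrE exprn_gt0.
rewrite nrmM nrmX exprS; apply: ler_pM; rewrite ?exprn_ge0 ?(ltW d0)//.
by rewrite lerXn2r ?nnegrE ?nrm_ge0 ?(ltW d0).
Qed.

Lemma kernel_rem2 (r rho t : R) z w : nrm z <= rho -> nrm w <= rho -> rho < r ->
  r < 1 ->
  nrm (((r%:C * expit t - w) ^+ 2)^-1 - ((r%:C * expit t - z) ^+ 2)^-1
     - (w - z) * (2 / (r%:C * expit t - z) ^+ 3))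
  <= 6 * (nrm (w - z) ^+ 2 / (r - rho) ^+ 5).
Proof.
move=> zr wr rr r1; set Z := r%:C * expit t.
have z0 : Z - z != 0 by apply: circle_neq; exact: le_lt_trans rr.
have w0 : Z - w != 0 by apply: circle_neq; exact: le_lt_trans rr.
have -> : ((Z - w) ^+ 2)^-1 - ((Z - z) ^+ 2)^-1 - (w - z) * (2 / (Z - z) ^+ 3)
  = ((Z - z) + 2 * (Z - w)) * (w - z) ^+ 2 / ((Z - w) ^+ 2 * (Z - z) ^+ 3).
  by field; rewrite z0 w0.
have d0 : 0 < r - rho by rewrite subr_gt0.
have r0 : 0 <= r by rewrite (le_trans _ (ltW rr))// (le_trans _ zr)// nrm_ge0.
have dz : r - rho <= nrm (Z - z).
  apply: le_trans (circle_dist t (le_lt_trans zr rr)); lra.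
have dw : r - rho <= nrm (Z - w).
  apply: le_trans (circle_dist t (le_lt_trans wr rr)); lra.
have Zr : nrm Z = r by rewrite nrm_rexpit.
have n2 : nrm 2 = 2 :> R.
  by rewrite (_ : 2 = 2%:C) ?nrm_real ?ger0_norm//; rewrite rmorph_nat.
(* All three points lie in the unit disc, so each difference is at most 2. *)
have N6 : nrm ((Z - z) + 2 * (Z - w)) <= 6.
  apply: (le_trans (nrmD _ _)); rewrite nrmM n2.
  have H1 := nrmB Z z; have H2 := nrmB Z w; rewrite Zr in H1 H2.
  move: (nrm (Z - z)) (nrm (Z - w)) (nrm z) (nrm w) zr wr H1 H2 {dz dw n2 Zr}.
  by clear -rr r1; move=> *; lra.
rewrite -mulrA nrmM; apply: ler_pM; rewrite ?nrm_ge0//.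
rewrite nrmM nrmX nrmV ler_wpM2l ?exprn_ge0 ?nrm_ge0// lef_pV2; last 2 first.
- by rewrite posrE nrm_gt0 mulf_neq0 ?expf_neq0.
- by rewrite posrE exprn_gt0.
rewrite nrmM !nrmX (exprD _ 2 3); apply: ler_pM; rewrite ?exprn_ge0 ?(ltW d0)//;
  by rewrite lerXn2r ?nnegrE ?nrm_ge0 ?(ltW d0).
Qed.

Lemma circle_bound f (r : R) : Hol f -> 0 <= r < 1 ->
  exists2 A : R, 0 < A & forall t, 0 <= t <= 2 * pi ->
    nrm (f (r%:C * expit t)) <= A.
Proof.
move=> Hf ri; apply: iccont_bounded; first exact: ltW (twopi_gt0 R).
by apply: circle_iccont => //; exact: Hol_cont.
Qed.

Lemma cauchy_pow_quad f (rho : R) : Hol f -> 0 <= rho < 1 ->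
  let r := (1 + rho) / 2 in
  exists2 B : R, 0 < B & forall z w, nrm z <= rho -> nrm w <= rho ->
    nrm (cauchy_pow f r 1 w - cauchy_pow f r 1 z - (w - z) * cauchy_pow f r 2 z)
      <= B * nrm (w - z) ^+ 2 /\
    nrm (cauchy_pow f r 2 w - cauchy_pow f r 2 z
      - (w - z) * (2 * cauchy_pow f r 3 z)) <= B * nrm (w - z) ^+ 2.
Proof.
move=> Hf /andP[rho0 rho1] r.
have rr : rho < r by rewrite /r; lra.
have r1 : r < 1 by rewrite /r; lra.
have r0 : 0 <= r by rewrite /r; lra.
have [|A A0 HA] := @circle_bound f r Hf; first by rewrite r0.
have d0 : 0 < r - rho by rewrite subr_gt0.
exists (2 * (A / (r - rho) ^+ 3) + 12 * (A / (r - rho) ^+ 5)).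
  by rewrite addr_gt0// mulr_gt0// divr_gt0// exprn_gt0.
move=> z w zr wr; have n2 := exprn_ge0 2 (nrm_ge0 (w - z)).
have P3 : 0 <= A / (r - rho) ^+ 3 by rewrite ltW// divr_gt0// exprn_gt0.
have P5 : 0 <= A / (r - rho) ^+ 5 by rewrite ltW// divr_gt0// exprn_gt0.
clearbody r.
split.
- rewrite -[cauchy_pow f r 2 z]mul1r.
  apply: (le_trans (@cauchy_pow_rem f r A _ 1 1 z w Hf (le_lt_trans zr rr)
    (le_lt_trans wr rr) r1 HA (fun t => @kernel_rem1 r rho t z w zr wr rr))).
  rewrite [leRHS]mulrDl.
  have -> : 2 * (A * (nrm (w - z) ^+ 2 / (r - rho) ^+ 3)) =
    2 * (A / (r - rho) ^+ 3) * nrm (w - z) ^+ 2 by ring.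
  by rewrite lerDl mulr_ge0// mulr_ge0.
- apply: (le_trans (@cauchy_pow_rem f r A _ 2 2 z w Hf (le_lt_trans zr rr)
    (le_lt_trans wr rr) r1 HA (fun t => @kernel_rem2 r rho t z w zr wr rr r1))).
  rewrite [leRHS]mulrDl.
  have -> : 2 * (A * (6 * (nrm (w - z) ^+ 2 / (r - rho) ^+ 5))) =
    12 * (A / (r - rho) ^+ 5) * nrm (w - z) ^+ 2 by ring.
  by rewrite lerDr mulr_ge0// mulr_ge0.
Qed.

Lemma Hol_derive1E f (rho : R) : Hol f -> 0 <= rho < 1 ->
  forall z, nrm z < rho ->
    derive1 f z = cauchy_pow f ((1 + rho) / 2) 2 z /\
    cder (cauchy_pow f ((1 + rho) / 2) 2) z (2 * cauchy_pow f ((1 + rho) / 2) 3 z).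
Proof.
move=> Hf ri z zr; have [B B0 HB] := cauchy_pow_quad Hf ri.
case/andP: ri => rho0 rho1.
set r := (1 + rho) / 2 in HB *.
have rr : rho < r by rewrite /r; lra.
have r1 : r < 1 by rewrite /r; lra.
have d0 : 0 < rho - nrm z by rewrite subr_gt0.
have near h : nrm h < rho - nrm z -> nrm (z + h) <= rho.
  by move=> hd; apply: (le_trans (nrmD _ _)); rewrite -lerBrDl ltW.
have addK h : z + h - z = h by rewrite addrC addKr.
split.
- suff : cder f z (cauchy_pow f r 2 z) by move/cder_derivable => [].
  apply: (@cder_quad _ _ _ _ B (rho - nrm z)) => // h hd.
  have [+ _] := HB z (z + h) (ltW zr) (near h hd).
  rewrite addK !cauchy_pow1//; first exact: lt_trans rr.
  exact: le_lt_trans (near h hd) rr.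
- apply: (@cder_quad _ _ _ _ B (rho - nrm z)) => // h hd.
  by have [_] := HB z (z + h) (ltW zr) (near h hd); rewrite addK.
Qed.

Lemma between1 (x : R) : x < 1 -> 0 <= x -> exists rho : R,
  x < rho /\ 0 <= rho < 1.
Proof. by move=> x1 x0; exists ((1 + x) / 2); split; lra. Qed.

(** Near z the derivative coincides with the Cauchy integral with squared kernel, and that integral
    is differentiable. *)
Theorem Hol_derive f : Hol f -> Hol (derive1 f).
Proof.
move=> Hf; suff H z : nrm z < 1 -> exists L, cder (derive1 f) z L.
  by move=> z /discE /H[L] /cder_derivable[].
move=> z1; have [rho [zr ri]] := between1 z1 (nrm_ge0 z).
exists (2 * cauchy_pow f ((1 + rho) / 2) 3 z).
have [_] := Hol_derive1E Hf ri zr.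
apply: (@cder_near _ _ _ _ _ (rho - nrm z)); first by rewrite subr_gt0.
move=> w wd; have wr : nrm w < rho by have := nrm_subl w z; lra.
by have [->] := Hol_derive1E Hf ri wr.
Qed.

Theorem Hol_quad f (rho : R) : Hol f -> rho < 1 ->
  exists2 B : R, 0 < B & forall z w, nrm z <= rho -> nrm w <= rho ->
    nrm (f w - f z - (w - z) * derive1 f z) <= B * nrm (w - z) ^+ 2.
Proof.
move=> Hf rho1; have [rho0|rho0] := ltP rho 0.
  by exists 1 => // z w zr; have := le_lt_trans zr rho0; rewrite ltNge nrm_ge0.
have [rho' [rr ri]] := between1 rho1 rho0.
have [B B0 HB] := cauchy_pow_quad Hf ri; exists B => // z w zr wr.
have zr' := le_lt_trans zr rr; have wr' := le_lt_trans wr rr.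
have [+ _] := HB z w (ltW zr') (ltW wr').
have [-> _] := Hol_derive1E Hf ri zr'.
case/andP: ri => rho'0 rho'1.
rewrite !cauchy_pow1//; lra.
Qed.

Theorem Hol_bound f (rho : R) : Hol f -> rho < 1 ->
  exists2 B : R, 0 < B & forall z, nrm z <= rho -> nrm (f z) <= B.
Proof.
move=> Hf rho1; have [rho0|rho0] := ltP rho 0.
  by exists 1 => // z zr; have := le_lt_trans zr rho0; rewrite ltNge nrm_ge0.
have [B B0 HB] := Hol_quad Hf rho1.
exists (nrm (f 0) + nrm (derive1 f 0) + B).
  by rewrite ltr_wpDl// addr_ge0 ?nrm_ge0.
move=> z zr; have := HB 0 z; rewrite nrm0 subr0 => /(_ rho0 zr) H.
have -> : f z = (f z - f 0 - z * derive1 f 0) + f 0 + z * derive1 f 0 by ring.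
have z1 : nrm z <= 1 by rewrite (le_trans zr)// ltW.
have t1 : nrm (f z - f 0 - z * derive1 f 0) <= B.
  by apply: (le_trans H); rewrite ler_piMr ?(ltW B0)// exprn_ile1 ?nrm_ge0.
have t2 : nrm (z * derive1 f 0) <= nrm (derive1 f 0).
  by rewrite nrmM ler_piMl ?nrm_ge0.
apply: (le_trans (nrmD _ _)); rewrite [leRHS]addrAC; apply: lerD t2.
by apply: (le_trans (nrmD _ _)); rewrite [leRHS]addrC lerD2r.
Qed.

(** The radius is free here, whereas in [Hol_derive1E] it is tied to [rho]; the growth estimate
    takes the circle halfway between z and the boundary. *)
Lemma cauchy_derivative f z (r : R) : Hol f -> nrm z < r -> r < 1 ->
  derive1 f z = cauchy_pow f r 2 z.
Proof.
move=> Hf zr r1.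
suff : cder f z (cauchy_pow f r 2 z) by move/cder_derivable => [].
pose rho := (r + nrm z) / 2; have z0 := nrm_ge0 z.
have rr : rho < r by rewrite /rho; lra.
have zrho : nrm z <= rho by rewrite /rho; lra.
have [|A A0 HA] := @circle_bound f r Hf; first by lra.
have d0 : 0 < r - rho by rewrite subr_gt0.
apply: (@cder_quad _ _ _ _ (2 * (A / (r - rho) ^+ 3)) (rho - nrm z)).
  by rewrite /rho; lra.
move=> h hd.
have whr : nrm (z + h) <= rho by apply: (le_trans (nrmD _ _)); lra.
have := @cauchy_pow_rem f r A _ 1 1 z (z + h) Hf (le_lt_trans zrho rr)
    (le_lt_trans whr rr) r1 HA (fun t => @kernel_rem1 r rho t z (z + h) zrho whr rr).
rewrite !cauchy_pow1// ?(le_lt_trans whr)// mul1r (addrC z) addrK => H.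
apply: (le_trans H); rewrite le_eqVlt; apply/orP; left; apply/eqP; ring.
Qed.

End cauchy_estimates.

(** * The Volterra operator *)

Section volterra.
Variable R : realType.
Local Notation C := R[i].
Local Notation nrm := (@Normc.normc R).
Local Notation mu := (@lebesgue_measure R).
Implicit Types (f g u : C -> C) (z w : C).

Lemma cder_real f (t : R) (l : C) : cder f t%:C l ->
  is_derive t 1 (fun s : R => complex.Re (f s%:C)) (complex.Re l) /\
  is_derive t 1 (fun s : R => complex.Im (f s%:C)) (complex.Im l).
Proof.
move=> df.
have H e : 0 < e -> exists2 d : R, 0 < d & forall h : R, `|h| < d ->
    nrm (f (t + h)%:C - f t%:C - h%:C * l) <= e * `|h|.
  move=> e0; have [d d0 Hd] := (cderP _ _ _).1 df e e0; exists d => // h hd.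
  by have := Hd h%:C; rewrite nrm_real rmorphD; exact.
split; apply/(@is_derive_eps R) => e e0; have [d d0 Hd] := H e e0;
  exists d => // h /Hd; apply: le_trans.
- apply: le_trans (nrm_Re _); rewrite !(ReD, ReN) ReM /= mul0r subr0//.
- apply: le_trans (nrm_Im _); rewrite !(ImD, ImN) ImM /= mul0r addr0//.
Qed.

Lemma cder_iccont f (a b : R) :
  (forall t, a <= t <= b -> exists L, cder f t%:C L) ->
  iccont a b (fun t => f t%:C).
Proof.
move=> H t tab e e0; have [L HL] := H t tab.
have [d d0 Hd] := cder_cont HL e0; exists d => // s _ sd.
by apply: Hd; rewrite -rmorphB nrm_real.
Qed.

Lemma rint_FTC (F k : R -> R) (a b : R) : a < b -> icont a b k ->
  (forall t, a <= t <= b -> is_derive t 1 F (k t)) ->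
  \int[mu]_(t in `[a, b]) k t = F b - F a.
Proof.
move=> ab ck dF.
have dF' t : a <= t <= b -> derivable F t 1 by move=> /dF [].
have cF t : a <= t <= b -> {for t, continuous F}.
  by move=> /dF' H; apply: differentiable_continuous; exact/derivable1_diffP.
rewrite /Rintegral (@continuous_FTC2 R k F a b ab)//.
- exact: icont_within.
- split.
  + by move=> t; rewrite in_itv/= => /andP[/ltW at_ /ltW tb]; apply: dF'; rewrite at_.
  + by apply: cvg_at_right_filter; apply: cF; rewrite lexx ltW.
  + by apply: cvg_at_left_filter; apply: cF; rewrite lexx ltW.
- move=> t; rewrite in_itv/= => /andP[/ltW at_ /ltW tb]; rewrite derive1E.
  by have [|_ ->] := dF t; rewrite ?at_.
Qed.

Lemma cint_FTC f (k : R -> C) (a b : R) : a < b -> iccont a b k ->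
  (forall t, a <= t <= b -> cder f t%:C (k t)) ->
  cint a b k = f b%:C - f a%:C.
Proof.
move=> ab ck df.
rewrite cintE (rint_FTC ab (iccont_Re ck)
  (fun t ti => (cder_real (df t ti)).1)).
rewrite (rint_FTC ab (iccont_Im ck) (fun t ti => (cder_real (df t ti)).2)).
by case: (f b%:C) => ? ?; case: (f a%:C).
Qed.

Lemma volterraE g f z :
  volterra g f z = cint 0 1 (fun t => f (t%:C * z) * derive1 g (t%:C * z) * z).
Proof. by rewrite /volterra cintegral01E. Qed.

Lemma seg_disc (t : R) z : 0 <= t <= 1 -> nrm (t%:C * z) <= nrm z.
Proof.
move=> /andP[t0 t1]; rewrite nrmM nrm_real ger0_norm//.
by rewrite ler_piMl ?nrm_ge0.
Qed.

Lemma cder_scale f z (t l : C) : cder f (t * z) l ->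
  cder (fun s => f (s * z)) t (l * z).
Proof.
move=> df.
have dz : cder (fun s => s * z) t z.
  by have := cderM (cder_id t) (cder_cst z t); rewrite mulr0 add0r mulr1.
exact: (@cder_comp _ (fun s => s * z) f t z l dz df).
Qed.

Lemma HolD f g : Hol f -> Hol g -> Hol (fun w => f w + g w).
Proof.
move=> /HolP Hf /HolP Hg.
have D z : nrm z < 1 -> cder (fun w => f w + g w) z (derive1 f z + derive1 g z).
  by move=> z1; apply: cderD; [exact: Hf|exact: Hg].
by have [] := Hol_cder D.
Qed.

Lemma HolM f g : Hol f -> Hol g -> Hol (fun w => f w * g w).
Proof.
move=> /HolP Hf /HolP Hg.
have D z : nrm z < 1 -> cder (fun w => f w * g w) z
    (f z * derive1 g z + g z * derive1 f z).
  by move=> z1; apply: cderM; [exact: Hf|exact: Hg].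
by have [] := Hol_cder D.
Qed.

Lemma Hol_cst (c : C) : Hol (fun=> c).
Proof.
have D z : nrm z < 1 -> cder (fun=> c) z 0 by move=> _; exact: cder_cst.
by have [] := Hol_cder D.
Qed.

Lemma seg_iccont u z : Hol u -> nrm z < 1 ->
  iccont 0 1 (fun t => u (t%:C * z)).
Proof.
move=> /HolP Hu z1; apply: (@cder_iccont (fun s => u (s * z))) => t ti.
eexists; apply: cder_scale; apply: Hu.
exact: le_lt_trans (seg_disc z ti) z1.
Qed.

Lemma iccont_cst (a b : R) (c : C) : iccont a b (fun=> c).
Proof. by move=> t _ e e0; exists 1 => // s _ _; rewrite subrr nrm0 ltW. Qed.

Lemma iccontD (a b : R) (u v : R -> C) : iccont a b u -> iccont a b v ->
  iccont a b (fun t => u t + v t).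
Proof.
move=> cu cv t tab e e0; have e2 : 0 < e / 2 by rewrite divr_gt0.
have [d1 d10 H1] := cu t tab _ e2; have [d2 d20 H2] := cv t tab _ e2.
exists (Num.min d1 d2); first by rewrite lt_min d10.
move=> s sab; rewrite lt_min => /andP[/(H1 s sab) K1 /(H2 s sab) K2].
rewrite opprD addrACA (splitr e); apply: (le_trans (nrmD _ _)); exact: lerD.
Qed.

Lemma real_iccont (a b : R) : iccont a b (fun t : R => t%:C).
Proof. by apply: (@cder_iccont (fun s => s)) => t _; exists 1; exact: cder_id. Qed.

(** Path independence is avoided: differentiation under the integral along the segment gives the
    integrand [k], which is the derivative of t u(tz) in t and hence integrates to u(z). *)
Lemma primitive_cder u z : Hol u -> nrm z < 1 ->
  cder (fun w => cint 0 1 (fun t => u (t%:C * w) * w)) z (u z).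
Proof.
move=> Hu z1; have Hu' := Hol_derive Hu.
have [rho [zr ri]] := between1 z1 (nrm_ge0 z); case/andP: ri => rho0 rho1.
have [B B0 HB] := Hol_quad Hu rho1.
have [A A0 HA] := Hol_bound Hu' rho1.
pose k t := t%:C * (derive1 u (t%:C * z) * z) + u (t%:C * z).
have ck : iccont 0 1 k.
  apply: iccontD; last exact: seg_iccont.
  apply: iccontM; first exact: real_iccont.
  by apply: iccontM; [exact: seg_iccont|exact: iccont_cst].
have kint : cint 0 1 k = u z.
  have := @cint_FTC (fun s => s * u (s * z)) k 0 1 ltr01 ck.
  rewrite !mul1r mul0r subr0; apply=> t ti.
  have := cderM (cder_id t%:C) (@cder_scale u z t%:C _ _).
  rewrite mulr1; apply.
  apply: (HolP u).1 => //; exact: le_lt_trans (seg_disc z ti) z1.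
apply: (@cder_quad _ _ _ _ (2 * (B + A)) (rho - nrm z)); first by rewrite subr_gt0.
move=> h hd.
have wr : nrm (z + h) <= rho.
  by apply: (le_trans (nrmD _ _)); rewrite -lerBrDl ltW.
have w1 := le_lt_trans wr rho1.
have I w : nrm w < 1 -> cintble 0 1 (fun t => u (t%:C * w) * w).
  move=> ww; apply: iccont_intble.
  by apply: iccontM; [exact: seg_iccont|exact: iccont_cst].
have Ik := iccont_intble ck.
rewrite -kint -cintZ// -cintB; [|exact: I|exact: I].
rewrite -cintB; [|by apply: cintbleB; exact: I|exact: cintbleZ].
have -> : 2 * (B + A) * nrm h ^+ 2 = 2 * ((1 - 0) * ((B + A) * nrm h ^+ 2)) by ring.
apply: cint_bound => //.
  by apply: cintbleB; [by apply: cintbleB; exact: I|exact: cintbleZ].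
move=> t ti; rewrite /k.
have -> : u (t%:C * (z + h)) * (z + h) - u (t%:C * z) * z -
    h * (t%:C * (derive1 u (t%:C * z) * z) + u (t%:C * z)) =
  (u (t%:C * (z + h)) - u (t%:C * z)
     - (t%:C * (z + h) - t%:C * z) * derive1 u (t%:C * z)) * (z + h)
  + t%:C * (h ^+ 2 * derive1 u (t%:C * z)) by ring.
have tn : nrm t%:C <= 1 by rewrite nrm_real ger0_norm; case/andP: ti.
have zr' : nrm (t%:C * z) <= rho by rewrite (le_trans (seg_disc z ti))// ltW.
apply: (le_trans (nrmD _ _)); rewrite [leRHS]mulrDl; apply: lerD.
- rewrite nrmM.
  apply: (@le_trans _ _ (B * nrm (t%:C * (z + h) - t%:C * z) ^+ 2 * 1)).
    apply: ler_pM; rewrite ?nrm_ge0//; last exact: ltW.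
    by apply: HB => //; rewrite (le_trans (seg_disc _ ti)).
  rewrite mulr1 ler_wpM2l ?(ltW B0)//.
  have -> : t%:C * (z + h) - t%:C * z = t%:C * h by ring.
  by rewrite lerXn2r ?nnegrE ?nrm_ge0// nrmM ler_piMl ?nrm_ge0.
- rewrite nrmM nrmM nrmX -[leRHS]mul1r; apply: ler_pM; rewrite ?mulr_ge0 ?exprn_ge0 ?nrm_ge0//.
  by rewrite mulrC ler_wpM2r ?exprn_ge0 ?nrm_ge0// HA.
Qed.

Theorem volterra_cder g f z : Hol g -> Hol f -> nrm z < 1 ->
  cder (volterra g f) z (f z * derive1 g z).
Proof.
move=> Hg Hf z1; have Hu := HolM Hf (Hol_derive Hg).
rewrite (_ : volterra g f = fun w =>
  cint 0 1 (fun t => f (t%:C * w) * derive1 g (t%:C * w) * w)).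
  exact: (primitive_cder Hu z1).
by apply/funext => w; rewrite volterraE.
Qed.

Lemma volterra_Hol g f : Hol g -> Hol f -> Hol (volterra g f) /\
  forall z, nrm z < 1 -> derive1 (volterra g f) z = f z * derive1 g z.
Proof. by move=> Hg Hf; apply: Hol_cder => z z1; exact: volterra_cder. Qed.

Theorem volterra_primitive g f F z : Hol g -> Hol f -> Hol F ->
  (forall w, nrm w < 1 -> derive1 F w = f w * derive1 g w) -> nrm z < 1 ->
  volterra g f z = F z - F 0.
Proof.
move=> Hg Hf HF dF z1; rewrite volterraE.
have Hu := HolM Hf (Hol_derive Hg).
rewrite (@cint_FTC (fun s => F (s * z))) ?mul1r ?mul0r//.
  apply: iccontM; last exact: iccont_cst.
  exact: (@seg_iccont (fun w => f w * derive1 g w)).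
move=> t ti; have tz := le_lt_trans (seg_disc z ti) z1.
by rewrite -dF//; apply: cder_scale; exact: (HolP F).1.
Qed.

End volterra.

(** * Circular means of superharmonic functions *)

Section strip.
Variable R : realType.
Local Notation mu := (@lebesgue_measure R).
Implicit Types (U V : R -> R -> R).

Lemma continuous_icont (f : R -> R) (a b : R) : continuous f -> icont a b f.
Proof. by move=> cf; apply: within_icont; exact: continuous_subspaceT. Qed.

Lemma continuous_rintble (f : R -> R) (a b : R) : continuous f -> rintble a b f.
Proof. by move=> cf; apply: icont_intble; exact: continuous_icont. Qed.

Lemma derive_continuous (f df : R -> R) : (forall t : R, is_derive t 1 f (df t)) ->
  continuous f.
Proof.
move=> H t; apply: differentiable_continuous; apply/derivable1_diffP.
by have [] := H t.
Qed.

Lemma is_derive_rint (f f' : R -> R -> R) (a b u v B s : R) : u < s < v ->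
  (forall x t : R, u < x < v -> is_derive x 1 (f ^~ t) (f' x t)) ->
  (forall x, u < x < v -> rintble a b (f x)) ->
  (forall x t, u < x < v -> `|f' x t| <= B) ->
  is_derive s 1 (fun x => \int[mu]_(t in `[a, b]) f x t)
    (\int[mu]_(t in `[a, b]) f' s t).
Proof.
move=> suv df fi f'B.
have Is : `]u, v[%classic s by rewrite /= in_itv.
have B0 : 0 <= B by apply: le_trans (f'B s 0 suv).
have H1 x : `]u, v[%classic x -> mu.-integrable `[a, b] (EFin \o f x).
  by rewrite /= in_itv; exact: fi.
have H2 x y : `]u, v[%classic x -> `[a, b]%classic y -> derivable (f ^~ y) x 1.
  by rewrite /= in_itv/= => xi _; have [] := df x y xi.
have dE x y : u < x < v -> derive1 (f ^~ y) x = f' x y.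
  by move=> xi; rewrite derive1E; have [_ ->] := df x y xi.
have H3 x y : `]u, v[%classic x -> `[a, b]%classic y -> `|derive1 (f ^~ y) x| <= B.
  by rewrite /= in_itv/= => xi _; rewrite dE//; exact: f'B.
have GB : forall y : R, 0 <= (fun=> B) y by [].
have iB : mu.-integrable `[a, b] (EFin \o (fun=> B)) by exact: rintble_cst.
have mab : measurable (`[a, b]%classic : set (measurableTypeR R)) by exact: measurable_itv.
split.
  exact: (derivable_under_integral mab Is H1 H2 GB iB H3).
rewrite -derive1E (differentiation_under_integral mab Is H1 H2 GB iB H3).
by apply: eq_Rintegral => t _; exact: dE.
Qed.

Lemma nonincr_derive (f df : R -> R) (a b : R) : a <= b ->
  (forall x : R, a <= x <= b -> is_derive x 1 f (df x)) ->
  (forall x, a <= x <= b -> df x <= 0) -> f b <= f a.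
Proof.
rewrite le_eqVlt => /predU1P[->//|ab] Df df0.
have cf : {within `[a, b], continuous f}.
  apply: derivable_within_continuous => x; rewrite in_itv/= => xi.
  by have [] := Df x xi.
have [|c] := @MVT R f df a b ab _ cf.
  move=> x; rewrite in_itv/= => /andP[/ltW ax /ltW xb].
  by apply: Df; rewrite ax.
rewrite in_itv/= => /andP[/ltW ac /ltW cb] E.
by rewrite -subr_le0 E mulr_le0_ge0 ?subr_ge0 ?(ltW ab)// df0// ac.
Qed.

(* [U s t] stands for the value at exp (s + it), a point of modulus expR s, of a
   function on the disc. *)
Record stripC2 (U Us Uss Ut Utt : R -> R -> R) : Prop := StripC2 {
  strip_s : forall s t : R, s < 0 -> is_derive s 1 (U ^~ t) (Us s t);
  strip_ss : forall s t : R, s < 0 -> is_derive s 1 (Us ^~ t) (Uss s t);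
  strip_t : forall s t : R, s < 0 -> is_derive t 1 (U s) (Ut s t);
  strip_tt : forall s t : R, s < 0 -> is_derive t 1 (Ut s) (Utt s t);
  strip_cs : forall s : R, s < 0 -> continuous (Us s);
  strip_css : forall s : R, s < 0 -> continuous (Uss s);
  strip_ctt : forall s : R, s < 0 -> continuous (Utt s);
  strip_per0 : forall s : R, s < 0 -> U s (2 * pi) = U s 0;
  strip_per : forall s : R, s < 0 -> Ut s (2 * pi) = Ut s 0;
  strip_bound : forall s0 : R, s0 < 0 -> exists2 B : R, 0 < B & forall s t : R, s <= s0 ->
    [/\ `|U s t| <= B, `|Us s t| <= B * expR s & `|Uss s t| <= B] }.

Lemma strip_c U Us Uss Ut Utt s : stripC2 U Us Uss Ut Utt -> s < 0 ->
  continuous (U s).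
Proof.
by move=> H s0; exact: (derive_continuous (fun t => strip_t H t s0)).
Qed.

(** Let M(s) be the integral over t. Then M'' is the integral of Uss, at most that of -Utt, which is
    0 by periodicity; so M' is nonincreasing. The bound |Us| <= B e^s, which reflects smoothness at
    the origin, makes M' tend to 0 as s tends to minus infinity, whence M' <= 0. *)
Theorem strip_mean_nonincr U Us Uss Ut Utt (s1 s2 : R) :
  stripC2 U Us Uss Ut Utt ->
  (forall s t : R, s < 0 -> Uss s t + Utt s t <= 0) -> s1 <= s2 -> s2 < 0 ->
  \int[mu]_(t in `[0, 2 * pi]) U s2 t <= \int[mu]_(t in `[0, 2 * pi]) U s1 t.
Proof.
move=> H lap s12 s20.
have p0 := twopi_gt0 R.
pose M1 s := \int[mu]_(t in `[0, 2 * pi]) Us s t.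
have dM (s : R) : s < 0 -> is_derive s 1 (fun x => \int[mu]_(t in `[0, 2 * pi]) U x t) (M1 s).
  move=> s0; have hs : s / 2 < 0 by lra.
  have [B B0 HB] := strip_bound H hs.
  apply: (@is_derive_rint _ _ _ _ (s - 1) (s / 2) B).
  - by apply/andP; split; lra.
  - by move=> x t /andP[_ xs]; apply: (strip_s H); lra.
  - move=> x /andP[_ xs]; apply: continuous_rintble; apply: (strip_c H); lra.
  - move=> x t /andP[_ xs]; have [_ h _] := HB x t (ltW xs).
    apply: (le_trans h); rewrite ler_piMr ?(ltW B0)// -expR0 ler_expR; lra.
have dM1 (s : R) : s < 0 -> is_derive s 1 M1 (\int[mu]_(t in `[0, 2 * pi]) Uss s t).
  move=> s0; have hs : s / 2 < 0 by lra.
  have [B B0 HB] := strip_bound H hs.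
  apply: (@is_derive_rint _ _ _ _ (s - 1) (s / 2) B).
  - by apply/andP; split; lra.
  - by move=> x t /andP[_ xs]; apply: (strip_ss H); lra.
  - move=> x /andP[_ xs]; apply: continuous_rintble; apply: (strip_cs H); lra.
  - by move=> x t /andP[_ xs]; have [_ _ h] := HB x t (ltW xs).
have M1' (s : R) : s < 0 -> \int[mu]_(t in `[0, 2 * pi]) Uss s t <= 0.
  move=> s0.
  have E : \int[mu]_(t in `[0, 2 * pi]) Utt s t = 0.
    have c : icont 0 (2 * pi) (Utt s) by apply: continuous_icont; exact: (strip_ctt H s0).
    by rewrite (rint_FTC p0 c (fun t _ => strip_tt H t s0)) (strip_per H s0) subrr.
  have E2 : \int[mu]_(t in `[0, 2 * pi]) (- Utt s t) = 0.
    rewrite (_ : (fun t => - Utt s t) = (fun t => -1 * Utt s t)).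
      rewrite RintegralZl// ?E ?mulr0//.
      by apply: continuous_rintble; exact: (strip_ctt H s0).
    by apply/funext => t; rewrite mulN1r.
  apply: le_trans (_ : _ <= \int[mu]_(t in `[0, 2 * pi]) (- Utt s t)) _; last by rewrite E2.
  apply: (@le_rint _ 0 (2 * pi) (Uss s) (fun t => - Utt s t)).
  - by apply: continuous_rintble; exact: (strip_css H s0).
  - by apply: rintbleN; apply: continuous_rintble; exact: (strip_ctt H s0).
  - by move=> t _; rewrite -subr_le0 opprK; exact: lap.
have M10 (s : R) : s < 0 -> M1 s <= 0.
  move=> s0; have [B B0 HB] := strip_bound H s0.
  apply: (@le_eps0 _ _ (2 * pi * B)) => e e0.
  (* This far to the left |Us| <= B e, and M' at [s] is at most its value there. *)
  pose s' := Num.min s (ln e).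
  have s's : s' <= s by rewrite ge_min lexx.
  have s'e : expR s' <= e by rewrite -[leRHS]lnK ?posrE// ler_expR ge_min lexx orbT.
  have inc : M1 s <= M1 s'.
    apply: (@nonincr_derive M1 (fun s => \int[mu]_(t in `[0, 2 * pi]) Uss s t)) => //.
      by move=> x /andP[_ xs]; apply: dM1; exact: le_lt_trans s0.
    by move=> x /andP[_ xs]; apply: M1'; exact: le_lt_trans s0.
  apply: (le_trans inc).
  have -> : e * (2 * pi * B) = \int[mu]_(t in `[0, 2 * pi]) (e * B).
    by rewrite rint_cst ?ltW// subr0; ring.
  apply: (@le_rint _ 0 (2 * pi) (Us s') (fun=> e * B)); last 1 first.
  - move=> t _; have [_ h _] := HB s' t s's; apply: (le_trans (ler_norm _)).
    by apply: (le_trans h); rewrite mulrC ler_wpM2r// ltW.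
  - by apply: continuous_rintble; apply: (strip_cs H); exact: le_lt_trans s0.
  - exact: rintble_cst.
apply: (@nonincr_derive (fun x => \int[mu]_(t in `[0, 2 * pi]) U x t) M1) => //.
  by move=> x /andP[_ xs]; apply: dM; exact: le_lt_trans s20.
by move=> x /andP[_ xs]; apply: M10; exact: le_lt_trans s20.
Qed.

Lemma is_derive_lin (f g : R -> R) (a b x df dg : R) :
  is_derive x 1 f df -> is_derive x 1 g dg ->
  is_derive x 1 (fun t => a * f t + b * g t) (a * df + b * dg).
Proof. by move=> Df Dg; apply: is_deriveD; apply: is_deriveZ. Qed.

Lemma continuous_lin (f g : R -> R) (a b : R) : continuous f -> continuous g ->
  continuous (fun t => a * f t + b * g t).
Proof.
move=> cf cg x; apply: cvgD; apply: cvgM; [exact: cvg_cst|exact: cf|exact: cvg_cst|exact: cg].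
Qed.

Lemma norm_lin_le (a b x y X Y : R) : `|x| <= X -> `|y| <= Y ->
  `|a * x + b * y| <= `|a| * X + `|b| * Y.
Proof.
move=> xX yY; apply: (le_trans (ler_normD _ _)); rewrite !normrM.
by apply: lerD; rewrite ler_wpM2l.
Qed.

Lemma stripC2_lin U Us Uss Ut Utt V Vs Vss Vt Vtt (a b : R) :
  stripC2 U Us Uss Ut Utt -> stripC2 V Vs Vss Vt Vtt ->
  stripC2 (fun s t => a * U s t + b * V s t)
    (fun s t => a * Us s t + b * Vs s t)
    (fun s t => a * Uss s t + b * Vss s t)
    (fun s t => a * Ut s t + b * Vt s t)
    (fun s t => a * Utt s t + b * Vtt s t).
Proof.
move=> HU HV; split.
- by move=> s t s0; apply: (@is_derive_lin (U ^~ t) (V ^~ t));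
    [exact: (strip_s HU t s0)|exact: (strip_s HV t s0)].
- by move=> s t s0; apply: (@is_derive_lin (Us ^~ t) (Vs ^~ t));
    [exact: (strip_ss HU t s0)|exact: (strip_ss HV t s0)].
- by move=> s t s0; apply: (@is_derive_lin (U s) (V s));
    [exact: (strip_t HU t s0)|exact: (strip_t HV t s0)].
- by move=> s t s0; apply: (@is_derive_lin (Ut s) (Vt s));
    [exact: (strip_tt HU t s0)|exact: (strip_tt HV t s0)].
- by move=> s s0; apply: continuous_lin; [exact: (strip_cs HU s0)|exact: (strip_cs HV s0)].
- by move=> s s0; apply: continuous_lin; [exact: (strip_css HU s0)|exact: (strip_css HV s0)].
- by move=> s s0; apply: continuous_lin; [exact: (strip_ctt HU s0)|exact: (strip_ctt HV s0)].
- by move=> s s0; rewrite (strip_per0 HU s0) (strip_per0 HV s0).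
- by move=> s s0; rewrite (strip_per HU s0) (strip_per HV s0).
- move=> s0 s00; have [B B0 HB] := strip_bound HU s00.
  have [D D0 HD] := strip_bound HV s00.
  exists (`|a| * B + `|b| * D + 1).
    by rewrite ltr_wpDl// addr_ge0// mulr_ge0// ltW.
  move=> s t ss0; have [h1 h2 h3] := HB s t ss0; have [k1 k2 k3] := HD s t ss0.
  split.
  + by apply: (le_trans (norm_lin_le a b h1 k1)); rewrite lerDl.
  + apply: (le_trans (norm_lin_le a b h2 k2)).
    by rewrite !mulrA -mulrDl ler_wpM2r ?expR_ge0// lerDl.
  + by apply: (le_trans (norm_lin_le a b h3 k3)); rewrite lerDl.
Qed.

Lemma stripC2_cst (c : R) : stripC2 (fun _ _ => c) (fun _ _ => 0)
  (fun _ _ => 0) (fun _ _ => 0) (fun _ _ => 0).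
Proof.
split; try by move=> s t _; exact: is_derive_cst.
- by move=> s _ x; exact: cvg_cst.
- by move=> s _ x; exact: cvg_cst.
- by move=> s _ x; exact: cvg_cst.
- by [].
- by [].
- move=> s0 _; exists (`|c| + 1); first by rewrite ltr_wpDl.
  by move=> s t _; rewrite normr0 lerDl ler01 mulr_ge0 ?expR_ge0 ?addr_ge0.
Qed.

Lemma is_derive_powR (f : R -> R) (x df q : R) : 0 < f x -> is_derive x 1 f df ->
  is_derive x 1 (fun t => f t `^ q) (q * f x `^ (q - 1) * df).
Proof.
move=> fx Df.
exact: (@is_derive1_comp R (fun y => y `^ q) f x (q * f x `^ (q - 1)) df
  (is_derive1_powR q fx) Df).
Qed.

Lemma is_derive_mul (f g : R -> R) (x df dg : R) :
  is_derive x 1 f df -> is_derive x 1 g dg ->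
  is_derive x 1 (fun t => f t * g t) (f x * dg + g x * df).
Proof. by move=> Df Dg; apply: is_deriveM. Qed.

Lemma is_derive2_powR (f f1 : R -> R) (x f2 P : R) : 0 < f x ->
  is_derive x 1 f (f1 x) -> is_derive x 1 f1 f2 ->
  is_derive x 1 (fun t => P * f t `^ (P - 1) * f1 t)
    (P * ((P - 1) * f x `^ (P - 2) * f1 x ^+ 2 + f x `^ (P - 1) * f2)).
Proof.
move=> fx D1 D2.
have D3 : is_derive x 1 (fun t => P * f t `^ (P - 1))
    (P * ((P - 1) * f x `^ (P - 1 - 1) * f1 x)).
  by apply: is_deriveZ; exact: is_derive_powR.
have := is_derive_mul D3 D2; rewrite (_ : P - 1 - 1 = P - 2); last by ring.
by move=> D; apply: (is_derive_eq D); ring.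
Qed.

Lemma continuous_powR_comp (f : R -> R) (q : R) : (forall t, 0 < f t) ->
  continuous f -> continuous (fun t => f t `^ q).
Proof.
move=> f0 cf t; apply: (@continuous_comp _ _ _ f (fun y => y `^ q)); first exact: cf.
apply: differentiable_continuous; apply/derivable1_diffP.
by have [] := is_derive1_powR q (f0 t).
Qed.

(** The absolute value serves for the exponents P - 1 and P - 2, which may be negative. *)
Lemma powR_le_abs (x B q : R) : 1 <= x -> x <= B -> x `^ q <= B `^ `|q|.
Proof.
move=> x1 xB; have x0 := le_trans ler01 x1.
apply: (@le_trans _ _ (x `^ `|q|)); first by apply: ler_powR => //; exact: ler_norm.
by apply: ge0_ler_powR => //; rewrite nnegrE// (le_trans x0).
Qed.

(** The lower bound 1 keeps U away from 0, where the power is singular, and controls its negative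
    powers. *)
Lemma stripC2_powR U Us Uss Ut Utt (P : R) : stripC2 U Us Uss Ut Utt ->
  (forall s t, 1 <= U s t) ->
  stripC2 (fun s t => U s t `^ P) (fun s t => P * U s t `^ (P - 1) * Us s t)
   (fun s t => P * ((P - 1) * U s t `^ (P - 2) * Us s t ^+ 2
      + U s t `^ (P - 1) * Uss s t))
   (fun s t => P * U s t `^ (P - 1) * Ut s t)
   (fun s t => P * ((P - 1) * U s t `^ (P - 2) * Ut s t ^+ 2
      + U s t `^ (P - 1) * Utt s t)).
Proof.
move=> H U1; have U0 s t : 0 < U s t by exact: lt_le_trans (U1 s t).
have cU (s : R) (s0 : s < 0) := strip_c H s0.
have cUt (s : R) : s < 0 -> continuous (Ut s).
  by move=> s0; exact: (derive_continuous (fun t => strip_tt H t s0)).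
have c2 (s : R) (g h : R -> R) : s < 0 -> continuous g -> continuous h ->
  continuous (fun t => P * ((P - 1) * U s t `^ (P - 2) * g t ^+ 2
      + U s t `^ (P - 1) * h t)).
  move=> s0 cg ch.
  have k1 := continuous_powR_comp (q := P - 2) (U0 s) (cU s s0).
  have k2 := continuous_powR_comp (q := P - 1) (U0 s) (cU s s0).
  move=> x; apply: cvgM; first exact: cvg_cst.
  apply: cvgD; apply: cvgM; [|by apply: cvgM; exact: cg|exact: k2|exact: ch].
  by apply: cvgM; [exact: cvg_cst|exact: k1].
split.
- by move=> s t s0; apply: (@is_derive_powR (U ^~ t)) => //; exact: (strip_s H t s0).
- by move=> s t s0; apply: (@is_derive2_powR (U ^~ t) (Us ^~ t)) => //;
    [exact: (strip_s H t s0)|exact: (strip_ss H t s0)].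
- by move=> s t s0; apply: (@is_derive_powR (U s)) => //; exact: (strip_t H t s0).
- by move=> s t s0; apply: (@is_derive2_powR (U s) (Ut s)) => //;
    [exact: (strip_t H t s0)|exact: (strip_tt H t s0)].
- move=> s s0; have K := strip_cs H s0 => x; apply: cvgM; last exact: K.
  apply: cvgM; first exact: cvg_cst.
  exact: (continuous_powR_comp (q := P - 1) (U0 s) (cU s s0)).
- by move=> s s0; apply: c2 => //; [exact: (strip_cs H s0)|exact: (strip_css H s0)].
- by move=> s s0; apply: c2 => //; [exact: cUt|exact: (strip_ctt H s0)].
- by move=> s s0; rewrite (strip_per0 H s0).
- by move=> s s0; rewrite (strip_per0 H s0) (strip_per H s0).
- move=> s0 s00; have [B B0 HB] := strip_bound H s00.
  pose K := `|P| * ((`|P - 1| * B `^ `|P - 2|) * B ^+ 2 + B `^ `|P - 1| * B).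
  have Bq q : 0 <= B `^ q by exact: powR_ge0.
  have K0 : 0 <= K by rewrite !(mulr_ge0, addr_ge0) ?exprn_ge0 ?(ltW B0).
  exists (B `^ `|P| + `|P| * B `^ `|P - 1| * B + K + 1).
    by rewrite ltr_wpDl// !(mulr_ge0, addr_ge0) ?(ltW B0).
  move=> s t ss0; have [h1 h2 h3] := HB s t ss0.
  have UB : U s t <= B by apply: le_trans h1; exact: ler_norm.
  have q_ q : `|U s t `^ q| <= B `^ `|q|.
    by rewrite ger0_norm ?powR_ge0// powR_le_abs.
  have e1 : expR s <= 1 by rewrite -expR0 ler_expR (le_trans ss0)// ltW.
  split.
  + apply: (le_trans (q_ P)); rewrite -!addrA lerDl !addr_ge0// !mulr_ge0// ltW//.
  + rewrite !normrM.
    have hP : `|P| * `|U s t `^ (P - 1)| <= `|P| * B `^ `|P - 1|.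
      by rewrite ler_wpM2l.
    have hP0 : 0 <= `|P| * `|U s t `^ (P - 1)| by rewrite mulr_ge0.
    apply: (le_trans (ler_pM hP0 (normr_ge0 _) hP h2)).
    rewrite mulrA ler_wpM2r ?expR_ge0//.
    have := Bq `|P|; move: K0 (`|P| * _ * B) (B `^ _) => K0 X Y Y0.
    by clear -K0 Y0; lra.
  + apply: (@le_trans _ _ K); last first.
      have : 0 <= `|P| * B `^ `|P - 1| * B by rewrite !mulr_ge0// ltW.
      have := Bq `|P|; move: K0 (`|P| * _ * B) (B `^ _) => K0 X Y Y0 X0.
      by clear -K0 Y0 X0; lra.
    rewrite normrM ler_wpM2l//; apply: (le_trans (ler_normD _ _)).
    apply: lerD; rewrite !normrM; apply: ler_pM; rewrite ?mulr_ge0//.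
      by rewrite ler_wpM2l.
    rewrite -normrM -expr2 normrX lerXn2r ?nnegrE ?(ltW B0)//.
    apply: (le_trans h2); rewrite ler_piMr ?(ltW B0)//.
Qed.

End strip.

(* [euler u] is the derivative of [u (exp zeta)] with respect to zeta. It is
   locked because unification of two derivatives would unfold their limits. *)
HB.lock Definition euler (R : realType) (u : R[i] -> R[i]) : R[i] -> R[i] :=
  fun z => z * derive1 u z.

(** * ** * Laplacians of powers of sums of squared moduli *)

Section modulus.
Variable R : realType.
Local Notation C := R[i].
Local Notation nrm := (@Normc.normc R).
Implicit Types (u v F G : C -> C).

Definition polX u (s t : R) : R := complex.Re (u (expc s t)).
Definition polY u (s t : R) : R := complex.Im (u (expc s t)).

Lemma eulerE u z : euler u z = z * derive1 u z.
Proof. by rewrite euler.unlock. Qed.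

Lemma nrm_euler u z : nrm (euler u z) = nrm z * nrm (derive1 u z).
Proof. by rewrite eulerE nrmM. Qed.

Lemma Hol_euler u : Hol u -> Hol (euler u).
Proof. move=> Hu; have H := HolM (@Hol_id R) (Hol_derive Hu).
rewrite (_ : euler u = fun z => z * derive1 u z)//.
by apply/funext => z; exact: eulerE. Qed.

Lemma expc_disc (s t : R) : s < 0 -> nrm (expc s t) < 1.
Proof. by move=> s0; rewrite nrm_expc -expR0 ltr_expR. Qed.

(** The Cauchy-Riemann equations in s + it: the derivative in s is [euler u], the one in t is i
    times it. *)
Lemma polar_derive u (s t : R) : Hol u -> s < 0 ->
  [/\ is_derive s 1 (polX u ^~ t) (polX (euler u) s t),
      is_derive s 1 (polY u ^~ t) (polY (euler u) s t),
      is_derive t 1 (polX u s) (- polY (euler u) s t) &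
      is_derive t 1 (polY u s) (polX (euler u) s t)].
Proof.
move=> Hu s0; have du := (HolP u).1 Hu _ (expc_disc t s0).
have Hs e : 0 < e -> exists2 d : R, 0 < d & forall h : R, `|h| < d ->
    nrm (u (expc (s + h) t) - u (expc s t) - h%:C * euler u (expc s t)) <= e * `|h|.
  move=> e0; have [d d0 Hd] := cder_polar du e0; exists d => // h hd.
  have := Hd (s + h) t; rewrite (addrC s) addrK subrr normr0 addr0 => /(_ hd d0).
  rewrite (_ : h%:C * euler u (expc s t) =
    derive1 u (expc s t) * expc s t * h%:C)//.
  by rewrite eulerE; ring.
have Ht e : 0 < e -> exists2 d : R, 0 < d & forall h : R, `|h| < d ->
    nrm (u (expc s (t + h)) - u (expc s t)
      - h%:C * ('i%C * euler u (expc s t))) <= e * `|h|.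
  move=> e0; have [d d0 Hd] := cder_polar du e0; exists d => // h hd.
  have := Hd s (t + h); rewrite (addrC t) addrK subrr normr0 add0r => /(_ d0 hd).
  rewrite (_ : 0 +i* h = h%:C * 'i%C); last first.
    by apply/eqP; rewrite eq_complex/= !mulr0 mul0r mulr1 subrr addr0 !eqxx.
  rewrite (_ : h%:C * ('i%C * euler u (expc s t)) =
    derive1 u (expc s t) * expc s t * (h%:C * 'i%C))//.
  by rewrite eulerE; ring.
split; apply/(@is_derive_eps R) => e e0.
- have [d d0 Hd] := Hs e e0; exists d => // h /Hd; apply: le_trans.
  apply: le_trans (nrm_Re _).
  by rewrite !(ReD, ReN) ReM /= mul0r subr0.
- have [d d0 Hd] := Hs e e0; exists d => // h /Hd; apply: le_trans.
  apply: le_trans (nrm_Im _).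
  by rewrite !(ImD, ImN) ImM /= mul0r addr0.
- have [d d0 Hd] := Ht e e0; exists d => // h /Hd; apply: le_trans.
  apply: le_trans (nrm_Re _).
  rewrite /polX /polY; move: (euler u (expc s t)) => w.
  rewrite !(ReD, ReN) !ReM !ImM /= le_eqVlt; apply/orP; left; apply/eqP.
  by congr (`|_|); ring.
- have [d d0 Hd] := Ht e e0; exists d => // h /Hd; apply: le_trans.
  apply: le_trans (nrm_Im _).
  rewrite /polX /polY; move: (euler u (expc s t)) => w.
  rewrite !(ImD, ImN) !ImM !ReM /= le_eqVlt; apply/orP; left; apply/eqP.
  by congr (`|_|); ring.
Qed.

Lemma polXE u s t : polX u s t = complex.Re (u (expc s t)).
Proof. by []. Qed.

Lemma polYE u s t : polY u s t = complex.Im (u (expc s t)).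
Proof. by []. Qed.

(** [dotp] and [crossp] are the real and imaginary parts of u conj(v). *)
Definition dotp u v (s t : R) : R := polX u s t * polX v s t + polY u s t * polY v s t.
Definition crossp u v (s t : R) : R :=
  polY u s t * polX v s t - polX u s t * polY v s t.

Lemma is_derive_dot (a b c d : R -> R) (x a' b' c' d' : R) :
  is_derive x 1 a a' -> is_derive x 1 b b' -> is_derive x 1 c c' ->
  is_derive x 1 d d' ->
  is_derive x 1 (fun t => a t * b t + c t * d t)
    (a x * b' + b x * a' + (c x * d' + d x * c')).
Proof. by move=> *; apply: is_deriveD; apply: is_derive_mul. Qed.

Lemma dot_alg1 (a b c d a' b' c' d' : R) :
  a * b' + b * a' + (c * d' + d * c') = a' * b + c' * d + (a * b' + c * d').
Proof. ring. Qed.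

Lemma dot_alg2 (a b c d a' b' c' d' : R) :
  a * - d' + b * - c' + (c * b' + d * a') = c * b' - a * d' + (d * a' - b * c').
Proof. ring. Qed.

Lemma dot_alg3 (a b c d a' b' c' d' : R) :
  c * - d' + b * a' + (- a * b' + d * c') = a' * b + c' * d - (a * b' + c * d').
Proof. ring. Qed.

Lemma dotpC u v s t : dotp u v s t = dotp v u s t.
Proof. by rewrite /dotp mulrC (mulrC (polY u s t)). Qed.

Lemma dotp_s u v (s t : R) : Hol u -> Hol v -> s < 0 ->
  is_derive s 1 (dotp u v ^~ t) (dotp (euler u) v s t + dotp u (euler v) s t).
Proof.
move=> Hu Hv s0; have [a b _ _] := polar_derive t Hu s0.
have [c d _ _] := polar_derive t Hv s0.
exact: (is_derive_eq (is_derive_dot a c b d) (dot_alg1 _ _ _ _ _ _ _ _)).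
Qed.

Lemma dotp_t u v (s t : R) : Hol u -> Hol v -> s < 0 ->
  is_derive t 1 (dotp u v s) (crossp u (euler v) s t + crossp v (euler u) s t).
Proof.
move=> Hu Hv s0; have [_ _ a b] := polar_derive t Hu s0.
have [_ _ c d] := polar_derive t Hv s0.
exact: (is_derive_eq (is_derive_dot a c b d) (dot_alg2 _ _ _ _ _ _ _ _)).
Qed.

Lemma crossp_t u v (s t : R) : Hol u -> Hol v -> s < 0 ->
  is_derive t 1 (crossp u v s) (dotp (euler u) v s t - dotp u (euler v) s t).
Proof.
move=> Hu Hv s0; have [_ _ a b] := polar_derive t Hu s0.
have [_ _ c d] := polar_derive t Hv s0.
have a' : is_derive t 1 (fun t => - polX u s t) (polY (euler u) s t).
  by have := is_deriveN a; rewrite opprK.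
have D := is_derive_dot b c a' d.
rewrite (_ : crossp u v s = fun t => polY u s t * polX v s t + - polX u s t * polY v s t).
  exact: (is_derive_eq D (dot_alg3 _ _ _ _ _ _ _ _)).
by apply/funext => x; rewrite /crossp mulNr.
Qed.

Lemma dotp_bound u v (s t A B : R) : nrm (u (expc s t)) <= A ->
  nrm (v (expc s t)) <= B -> `|dotp u v s t| <= 2 * (A * B).
Proof.
move=> uA vB; apply: (le_trans (ler_normD _ _)); rewrite !normrM mulr_natl mulr2n !polXE !polYE.
have h1 := nrm_Re (u (expc s t)); have h2 := nrm_Im (u (expc s t)).
have h3 := nrm_Re (v (expc s t)); have h4 := nrm_Im (v (expc s t)).
apply: lerD; apply: ler_pM; rewrite ?normr_ge0//.
- exact: le_trans h1 uA.
- exact: le_trans h3 vB.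
- exact: le_trans h2 uA.
- exact: le_trans h4 vB.
Qed.

Lemma dotp_cont u v s : Hol u -> Hol v -> s < 0 -> continuous (dotp u v s).
Proof.
by move=> Hu Hv s0; exact: (derive_continuous (fun t => dotp_t t Hu Hv s0)).
Qed.

Lemma stripC2_sq u : Hol u -> stripC2 (dotp u u)
  (fun s t => 2 * dotp u (euler u) s t)
  (fun s t => 2 * (dotp (euler u) (euler u) s t + dotp u (euler (euler u)) s t))
  (fun s t => 2 * crossp u (euler u) s t)
  (fun s t => 2 * (dotp (euler u) (euler u) s t - dotp u (euler (euler u)) s t)).
Proof.
move=> Hu; have He := Hol_euler Hu; have Hee := Hol_euler He.
have D2 (f : R -> R) (x l : R) : is_derive x 1 f l -> is_derive x 1 (fun t => 2 * f t) (2 * l).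
  by move=> D; exact: is_deriveZ.
have c2 (f : R -> R) : continuous f -> continuous (fun t => 2 * f t).
  by move=> cf x; apply: cvgM; [exact: cvg_cst|exact: cf].
have cD (f g : R -> R) (k : R) : continuous f -> continuous g ->
    continuous (fun t => 2 * (f t + k * g t)).
  move=> cf cg; apply: c2 => x; apply: cvgD; first exact: cf.
  by apply: cvgM; [exact: cvg_cst|exact: cg].
have ler0n2 : 0 <= 2 :> R by [].
have per (s : R) : expc s (2 * pi) = expc s 0.
  by rewrite /expc -[2 * pi]add0r expitDpi.
split.
- move=> s t s0; apply: (is_derive_eq (dotp_s t Hu Hu s0)).
  by rewrite dotpC mulr_natl mulr2n.
- move=> s t s0; apply: D2; exact: dotp_s.
- move=> s t s0; apply: (is_derive_eq (dotp_t t Hu Hu s0)).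
  by rewrite mulr_natl mulr2n.
- move=> s t s0; apply: D2; exact: crossp_t.
- by move=> s s0; apply: c2; exact: dotp_cont.
- move=> s s0; have := cD _ _ 1 (dotp_cont He He s0) (dotp_cont Hu Hee s0).
  by under eq_fun do rewrite mul1r.
- move=> s s0; have := cD _ _ (-1) (dotp_cont He He s0) (dotp_cont Hu Hee s0).
  by under eq_fun do rewrite mulN1r.
- by move=> s _; rewrite /dotp !polXE !polYE per.
- by move=> s _; rewrite /crossp !polXE !polYE per.
- move=> s0 s00; have e1 : expR s0 < 1 by rewrite -expR0 ltr_expR.
  have [A A0 HA] := Hol_bound Hu e1.
  have [A' A'0 HA'] := Hol_bound (Hol_derive Hu) e1.
  have [B B0 HB] := Hol_bound He e1.
  have [D D0 HD] := Hol_bound Hee e1.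
  have h1 : 0 <= A * A by rewrite mulr_ge0// ltW.
  have h2 : 0 <= A * A' by rewrite mulr_ge0// ltW.
  have h3 : 0 <= B * B by rewrite mulr_ge0// ltW.
  have h4 : 0 <= A * D by rewrite mulr_ge0// ltW.
  exists (2 * (A * A) + 4 * (A * A') + 4 * (B * B) + 4 * (A * D) + 1).
    by clear -h1 h2 h3 h4; lra.
  move=> s t ss0.
  have zr : nrm (expc s t) <= expR s0 by rewrite nrm_expc ler_expR.
  have kA := HA _ zr; have kB := HB _ zr; have kD := HD _ zr.
  have kE : nrm (euler u (expc s t)) <= A' * expR s.
    rewrite eulerE nrmM nrm_expc mulrC ler_wpM2r ?expR_ge0//.
    exact: HA' _ zr.
  have b1 := dotp_bound kA kA; have b2 := dotp_bound kA kE.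
  have b3 := dotp_bound kB kB; have b4 := dotp_bound kA kD.
  split.
  + by apply: (le_trans b1); clear -h1 h2 h3 h4; lra.
  + rewrite normrM ger0_norm//.
    apply: (@le_trans _ _ (4 * (A * A') * expR s)).
      rewrite (_ : 4 * (A * A') * expR s = 2 * (2 * (A * (A' * expR s)))).
        by rewrite ler_wpM2l.
      by move: (expR s) => x; clear; ring.
    by rewrite ler_wpM2r ?expR_ge0//; clear -h1 h2 h3 h4; lra.
  + rewrite normrM ger0_norm//.
    apply: (le_trans (ler_wpM2l ler0n2 (le_trans (ler_normD _ _) (lerD b3 b4)))).
    by clear -h1 h2 h3 h4; lra.
Qed.

Lemma dotp_nrm u (s t : R) : dotp u u s t = nrm (u (expc s t)) ^+ 2.
Proof. by rewrite nrm_sqr /dotp !polXE !polYE -!expr2. Qed.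

Definition quadN (a b : R) F G (s t : R) : R :=
  1 + (a * dotp F F s t + b * dotp G G s t).

Lemma quadN_ge1 a b F G s t : 0 <= a -> 0 <= b -> 1 <= quadN a b F G s t.
Proof.
by move=> a0 b0; rewrite /quadN lerDl addr_ge0// mulr_ge0// dotp_nrm exprn_ge0// nrm_ge0.
Qed.

(** Weighted Cauchy-Schwarz inequality for the complex vectors (f, g) and (f', g'), through
    Lagrange's identity: the defect is a b |f g' - g f'|^2. *)
Lemma lagrange_sq (a b x1 y1 x2 y2 u1 v1 u2 v2 : R) : 0 <= a -> 0 <= b ->
  (a * (x1 * u1 + y1 * v1) + b * (x2 * u2 + y2 * v2)) ^+ 2
  + (a * (y1 * u1 - x1 * v1) + b * (y2 * u2 - x2 * v2)) ^+ 2 <=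
  (a * (x1 * x1 + y1 * y1) + b * (x2 * x2 + y2 * y2))
  * (a * (u1 * u1 + v1 * v1) + b * (u2 * u2 + v2 * v2)).
Proof.
move=> a0 b0; rewrite -subr_ge0.
rewrite (_ : _ - _ = a * b * ((x1 * u2 - x2 * u1 + (y2 * v1 - y1 * v2)) ^+ 2
   + (x1 * v2 + y1 * u2 - x2 * v1 - y2 * u1) ^+ 2)).
  by rewrite mulr_ge0 ?mulr_ge0// addr_ge0// sqr_ge0.
ring.
Qed.

Lemma dotp_cauchy (a b : R) F G s t : 0 <= a -> 0 <= b ->
  (a * dotp F (euler F) s t + b * dotp G (euler G) s t) ^+ 2
  + (a * crossp F (euler F) s t + b * crossp G (euler G) s t) ^+ 2 <=
  (a * dotp F F s t + b * dotp G G s t)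
  * (a * dotp (euler F) (euler F) s t + b * dotp (euler G) (euler G) s t).
Proof.
move=> a0 b0.
exact: (@lagrange_sq a b (polX F s t) (polY F s t) (polX G s t) (polY G s t)
    (polX (euler F) s t) (polY (euler F) s t) (polX (euler G) s t)
    (polY (euler G) s t) a0 b0).
Qed.

(* The variables stand for the scalar and cross products of F, G and of their
   derivatives; the first order terms are controlled by N D. *)
Lemma laplacian_bounds (P a b N n1 n2 c1 c2 e1 e2 k1 k2 : R) :
  0 < P -> 1 <= N -> 0 <= a * e1 + b * e2 ->
  (a * n1 + b * n2) ^+ 2 + (a * c1 + b * c2) ^+ 2 <= N * (a * e1 + b * e2) ->
  let D := a * e1 + b * e2 in
  let L := P * ((P - 1) * N `^ (P - 2) * (1 * 0 + 1 * (a * (2 * n1) + b * (2 * n2))) ^+ 2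
      + N `^ (P - 1) * (1 * 0 + 1 * (a * (2 * (e1 + k1)) + b * (2 * (e2 + k2)))))
    + P * ((P - 1) * N `^ (P - 2) * (1 * 0 + 1 * (a * (2 * c1) + b * (2 * c2))) ^+ 2
      + N `^ (P - 1) * (1 * 0 + 1 * (a * (2 * (e1 - k1)) + b * (2 * (e2 - k2))))) in
  Num.min P (P ^+ 2) * (4 * N `^ (P - 1) * D) <= L /\
  L <= Num.max P (P ^+ 2) * (4 * N `^ (P - 1) * D).
Proof.
move=> P0 N1 D0 Wle D L.
have N0 : 0 < N by exact: lt_le_trans N1.
have NP : N `^ (P - 1) = N * N `^ (P - 2).
  rewrite -{2}[N]powRr1 ?(ltW N0)// -powRD; first by congr (_ `^ _); ring.
  by rewrite (gt_eqF N0) implybT.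
rewrite /L NP; have A0 : 0 <= N `^ (P - 2) by exact: powR_ge0.
move: (N `^ (P - 2)) A0 {L NP} => A A0.
(* [W] is the squared gradient of N and 4 D its Laplacian. So L = P A ((P - 1) W + 4 N D) with A =
   N^(P-2), and as 0 <= W <= 4 N D the sign of P - 1 decides which end gives which bound. *)
pose W := 4 * ((a * n1 + b * n2) ^+ 2 + (a * c1 + b * c2) ^+ 2).
have W0 : 0 <= W by rewrite mulr_ge0// addr_ge0// sqr_ge0.
have WN : W <= 4 * (N * D) by rewrite ler_wpM2l.
rewrite (_ : P * _ + P * _ = P * ((P - 1) * (A * W) + 4 * (A * (N * D)))); last first.
  by rewrite /W /D; ring.
have -> : 4 * (N * A) * D = 4 * (A * (N * D)) by ring.
clearbody W; have AW : A * W <= 4 * (A * (N * D)).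
  by have := ler_wpM2l A0 WN; rewrite [A * (4 * _)]mulrCA.
have AW0 : 0 <= A * W by rewrite mulr_ge0.
move: (A * W) (4 * (A * (N * D))) AW AW0 => x y xy x0.
have y0 := le_trans x0 xy; clear -P0 xy x0 y0.
have [P1|P1] := leP P 1.
- have PP : P ^+ 2 <= P by rewrite expr2 ler_piMr// ltW.
  rewrite min_r// max_l// expr2 -mulrA; split; rewrite ler_pM2l//; nra.
- have PP : P <= P ^+ 2 by rewrite expr2 ler_peMr ?ltW.
  rewrite min_l// max_r// expr2 -mulrA; split; rewrite ler_pM2l//; nra.
Qed.

(** Only the size of the Laplacian matters afterwards, so the partial derivatives are hidden behind
    existentials. *)
Lemma stripC2_quadN_pow (a b P : R) F G : Hol F -> Hol G -> 0 <= a -> 0 <= b ->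
  0 < P ->
  exists Us Uss Ut Utt,
    stripC2 (fun s t => quadN a b F G s t `^ P) Us Uss Ut Utt /\
    forall s t, let D := a * dotp (euler F) (euler F) s t
                         + b * dotp (euler G) (euler G) s t in
      Num.min P (P ^+ 2) * (4 * quadN a b F G s t `^ (P - 1) * D)
        <= Uss s t + Utt s t /\
      Uss s t + Utt s t
        <= Num.max P (P ^+ 2) * (4 * quadN a b F G s t `^ (P - 1) * D).
Proof.
move=> HF HG a0 b0 P0.
have S1 := stripC2_lin a b (stripC2_sq HF) (stripC2_sq HG).
(* The summand 1 enters as a constant function with zero derivatives: hence the terms [1 * 0] in
   [laplacian_bounds]. *)
have S2 := stripC2_lin 1 1 (stripC2_cst 1) S1.
have E : (fun s t => 1 * 1 + 1 * (a * dotp F F s t + b * dotp G G s t)) = quadN a b F G.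
  by apply/funext => s; apply/funext => t; rewrite !mul1r.
rewrite E in S2.
have S3 := stripC2_powR P S2 (fun s t => quadN_ge1 F G s t a0 b0).
do 4 eexists; split; first exact: S3.
move=> s t; apply: laplacian_bounds => //.
- exact: quadN_ge1.
- by rewrite addr_ge0// mulr_ge0// dotp_nrm exprn_ge0// nrm_ge0.
- apply: (le_trans (dotp_cauchy F G s t a0 b0)).
  apply: ler_wpM2r; last by rewrite /quadN lerDr.
  by rewrite addr_ge0// mulr_ge0// dotp_nrm exprn_ge0// nrm_ge0.
Qed.

End modulus.

(** * ** * Comparison of the means of two functions with comparable derivatives *)

Section comparison.
Variable R : realType.
Local Notation C := R[i].
Local Notation nrm := (@Normc.normc R).
Local Notation mu := (@lebesgue_measure R).
Implicit Types (u v F G : C -> C).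

Lemma rintble_dom (a b : R) (f g : R -> R) : measurable_fun `[a, b] f ->
  rintble a b g -> (forall t, a <= t <= b -> 0 <= f t <= g t) -> rintble a b f.
Proof.
move=> mf gi fg.
have mab : measurable (`[a, b]%classic : set (measurableTypeR R)) by exact: measurable_itv.
apply: (le_integrable mab _ _ gi); first exact/measurable_EFinP.
move=> t; rewrite /= in_itv/= => /fg /andP[f0 fg'].
by rewrite lee_fin !ger0_norm// (le_trans f0).
Qed.

Lemma rintble_powR (a b p : R) (f : R -> R) : a <= b -> 0 <= p -> icont a b f ->
  (forall t, 0 <= f t) -> rintble a b (fun t => f t `^ p).
Proof.
move=> ab p0 cf f0.
have [c ci Hc] := @EVT_max R f a b ab (icont_within cf).
apply: (@rintble_dom _ _ _ (fun=> f c `^ p)); last 1 first.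
- move=> t ti; rewrite powR_ge0/=; apply: ge0_ler_powR; rewrite ?nnegrE//.
  by apply: Hc; rewrite in_itv.
- apply: (@measurableT_comp _ _ _ _ _ _ (fun x : R => x `^ p)) => //.
  by apply/measurable_EFinP; exact: (measurable_int mu (icont_intble cf)).
- exact: rintble_cst.
Qed.

Lemma rint_lin (a b c d : R) (f g : R -> R) : rintble a b f -> rintble a b g ->
  \int[mu]_(t in `[a, b]) (c * f t + d * g t) =
  c * \int[mu]_(t in `[a, b]) f t + d * \int[mu]_(t in `[a, b]) g t.
Proof.
by move=> If Ig; rewrite RintegralD ?RintegralZl//; exact: rintbleZ.
Qed.

Lemma powR_nincr (x y q : R) : 1 <= x -> x <= y -> q <= 0 -> y `^ q <= x `^ q.
Proof.
move=> x1 xy q0.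
have e (z : R) : z `^ q = (z `^ (- q))^-1 by rewrite -powRN opprK.
rewrite !{}e.
have x0 : 0 < x by exact: lt_le_trans x1.
have y0 : 0 < y by exact: lt_le_trans xy.
rewrite lef_pV2 ?posrE ?powR_gt0//.
by apply: ge0_ler_powR; rewrite ?nnegrE ?oppr_ge0 ?(ltW x0) ?(ltW y0).
Qed.

(** Take d with (1 + d)^P = 3/2. If y <= d x, then x + y <= (1 + d) x; otherwise x < y / d and the
    term in y alone suffices. *)
Lemma powR_split (P : R) : 0 < P -> exists2 K : R, 0 < K &
  forall x y, 0 <= x -> 0 <= y -> (x + y) `^ P <= 3 / 2 * x `^ P + K * y `^ P.
Proof.
move=> P0; pose d := (3 / 2) `^ P^-1 - 1.
have h : (3 / 2 : R) `^ P^-1 > 1.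
  rewrite -[ltLHS](powRr0 (3 / 2)).
  rewrite /powR gt_eqF; last by lra.
  rewrite mul0r ltr_expR mulr_gt0 ?invr_gt0// ln_gt0//; lra.
have d0 : 0 < d by rewrite subr_gt0.
have dE : (1 + d) `^ P = 3 / 2.
  rewrite /d addrC subrK -powRrM mulVf ?gt_eqF// powRr1//; lra.
clearbody d; exists ((1 + d^-1) `^ P); first by rewrite powR_gt0// ltr_wpDr// invr_ge0 ltW.
move=> x y x0 y0; have [yx|xy] := leP y (d * x).
- apply: (@le_trans _ _ (((1 + d) * x) `^ P)).
    apply: ge0_ler_powR; rewrite ?nnegrE ?(ltW P0) ?addr_ge0// ?mulr_ge0 ?addr_ge0 ?(ltW d0)//.
    by rewrite mulrDl mul1r lerD2l.
  rewrite powRM ?addr_ge0 ?(ltW d0)// dE lerDl mulr_ge0 ?powR_ge0//.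
- apply: (@le_trans _ _ (((1 + d^-1) * y) `^ P)).
    apply: ge0_ler_powR; rewrite ?nnegrE ?(ltW P0) ?addr_ge0// ?mulr_ge0 ?addr_ge0 ?invr_ge0 ?(ltW d0)//.
    by rewrite mulrDl mul1r addrC lerD2l mulrC ler_pdivlMr// mulrC ltW.
  rewrite powRM ?addr_ge0 ?invr_ge0 ?(ltW d0)// lerDr mulr_ge0 ?powR_ge0//; lra.
Qed.

Lemma powR_add1 (P x : R) : 0 < P -> 0 <= x -> (1 + x) `^ P <= 2 `^ P * (1 + x `^ P).
Proof.
move=> P0 x0; have xP := powR_ge0 x P; have tP := powR_ge0 2 P.
have [x1|x1] := leP x 1.
- apply: (@le_trans _ _ (2 `^ P)); last by rewrite ler_peMr// lerDl.
  by apply: ge0_ler_powR; rewrite ?nnegrE ?(ltW P0) ?addr_ge0//; lra.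
- apply: (@le_trans _ _ ((2 * x) `^ P)).
    by apply: ge0_ler_powR; rewrite ?nnegrE ?(ltW P0) ?addr_ge0// ?mulr_ge0//; lra.
  by rewrite powRM// ler_wpM2l// lerDr.
Qed.

Definition pint (p : R) u (r : R) : R :=
  \int[mu]_(t in `[0, 2 * pi]) nrm (u (r%:C * expit t)) `^ p.

Lemma circle_rintble (p r : R) u : 0 <= p -> Hol u -> 0 <= r < 1 ->
  rintble 0 (2 * pi) (fun t => nrm (u (r%:C * expit t)) `^ p).
Proof.
move=> p0 Hu ri; apply: rintble_powR => //; first exact: ltW (twopi_gt0 R).
  by apply: iccont_nrm; apply: circle_iccont => //; exact: Hol_cont.
by move=> t; exact: nrm_ge0.
Qed.

Lemma expc_ln (r t : R) : 0 < r -> expc (ln r) t = r%:C * expit t.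
Proof. by move=> r0; rewrite /expc lnK. Qed.

(** As the means decrease with the radius, a pointwise bound near the centre bounds all of them. *)
Lemma strip_mean_bound U Us Uss Ut Utt (s0 K s : R) : stripC2 U Us Uss Ut Utt ->
  (forall s t : R, s < 0 -> Uss s t + Utt s t <= 0) -> s0 < 0 -> s < 0 ->
  (forall s t, s <= s0 -> U s t <= K) ->
  \int[mu]_(t in `[0, 2 * pi]) U s t <= 2 * pi * K.
Proof.
move=> S lap s00 sn HK; have p0 := ltW (twopi_gt0 R).
have h : Num.min s s0 <= s by rewrite ge_min lexx.
apply: (le_trans (strip_mean_nonincr S lap h sn)).
rewrite -[2 * pi * K]/(2 * pi * K) -{2}[2 * pi]subr0 -(rint_cst K p0).
apply: (@le_rint _ 0 (2 * pi) (U (Num.min s s0)) (fun=> K)).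
- apply: continuous_rintble; apply: (strip_c S); exact: le_lt_trans sn.
- exact: rintble_cst.
- by move=> t _; apply: HK; rewrite ge_min lexx orbT.
Qed.

Lemma euler_le F G s t : (forall z, nrm z < 1 -> nrm (derive1 G z) <= nrm (derive1 F z)) ->
  s < 0 -> dotp (euler G) (euler G) s t <= dotp (euler F) (euler F) s t.
Proof.
move=> H s0; rewrite !dotp_nrm; apply: lerXn2r; rewrite ?nnegrE ?nrm_ge0//.
rewrite (nrm_euler G) (nrm_euler F); apply: ler_wpM2l; first exact: nrm_ge0.
by apply: H; exact: expc_disc.
Qed.

(** The radius depends on F and G but the bound 1 does not; this is why the constant of the
    comparison is the same for all pairs. *)
Lemma near0_bound F G : Hol F -> Hol G -> F 0 = 0 -> G 0 = 0 ->
  exists2 s0 : R, s0 < 0 & forall s t, s <= s0 ->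
    dotp F F s t <= 1 /\ dotp G G s t <= 1.
Proof.
move=> HF HG F0 G0; have n0 : nrm 0 < 1 :> R by rewrite nrm0.
have [d1 d10 H1] := Hol_cont HF n0 ltr01.
have [d2 d20 H2] := Hol_cont HG n0 ltr01.
pose d := Num.min (2^-1) (Num.min d1 d2).
have d0 : 0 < d by rewrite !lt_min d10 d20 invr_gt0 ltr0n.
have d_1 : d < 1 by rewrite gt_min; apply/orP; left; rewrite invf_lt1// ltr1n.
exists (ln d - 1); first by have := ln_lt0 (x := d); rewrite d0 d_1 => /(_ isT); lra.
move=> s t sd.
have e : nrm (expc s t - 0) < d.
  by rewrite subr0 nrm_expc -[ltRHS]lnK ?posrE// ltr_expR; lra.
have [e1 e2] : nrm (expc s t - 0) < d1 /\ nrm (expc s t - 0) < d2.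
  by move: e; rewrite !lt_min => /andP[_ /andP[]].
have := H1 _ e1; have := H2 _ e2; rewrite F0 G0 !subr0 => g1 f1.
by rewrite !dotp_nrm !exprn_ile1 ?nrm_ge0.
Qed.

Lemma powR_sq (x p : R) : 0 <= x -> (x ^+ 2) `^ (p / 2) = x `^ p.
Proof. by move=> x0; rewrite -powR_mulrn// -powRrM mulrC divfK. Qed.

Lemma dotp_pow u s t (p : R) : dotp u u s t `^ (p / 2) = nrm (u (expc s t)) `^ p.
Proof. by rewrite dotp_nrm powR_sq// nrm_ge0. Qed.

(** For P <= 1 the Laplacian of the first function is at most P 4 N^(P-1) 2 |F'|^2, and dropping
    |G|^2 from N increases N^(P-1). That of the second is at least P^2 4 N^(P-1) |F'|^2 with the
    smaller N; the factor 2/P makes the two sides match. *)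
Lemma comparison_le2 (p : R) : 0 < p -> p <= 2 -> exists2 K : R, 0 < K &
  forall F G, Hol F -> Hol G -> F 0 = 0 -> G 0 = 0 ->
  (forall z, nrm z < 1 -> nrm (derive1 G z) <= nrm (derive1 F z)) ->
  forall r, 0 < r < 1 -> pint p G r <= K * (1 + pint p F r).
Proof.
move=> p0 p2; set P := p / 2.
have P0 : 0 < P by rewrite divr_gt0.
have P1 : P <= 1 by rewrite /P; lra.
have pp := twopi_gt0 R; have tP : 0 < 2 `^ P :> R by rewrite powR_gt0.
have P3 : 0 < 3 `^ P :> R by rewrite powR_gt0.
exists (2 * pi * 3 `^ P + 2 / P * 2 `^ P * (2 * pi + 1)).
  apply: addr_gt0; first by rewrite mulr_gt0.
  by apply: mulr_gt0; [rewrite mulr_gt0// divr_gt0|rewrite addr_gt0].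
move=> F G HF HG F0 G0 FG r /andP[r0 r1].
have s0 : ln r < 0 by rewrite ln_lt0// r0.
have [Us [Uss [Ut [Utt [SU LU]]]]] := stripC2_quadN_pow HF HG ler01 ler01 P0.
have [Vs [Vss [Vt [Vtt [SV LV]]]]] := stripC2_quadN_pow HF HG ler01 (lexx 0) P0.
have S := stripC2_lin 1 (- (2 / P)) SU SV.
have lap (s t : R) : s < 0 ->
  1 * Uss s t + - (2 / P) * Vss s t + (1 * Utt s t + - (2 / P) * Vtt s t) <= 0.
  move=> sn; have [_ hU] := LU s t; have [hV _] := LV s t.
  have PP : P ^+ 2 <= P by rewrite expr2 ler_piMr// ltW.
  rewrite (max_l PP) in hU; rewrite (min_r PP) in hV.
  have eG := euler_le t FG sn.
  have e0 : 0 <= dotp (euler F) (euler F) s t by rewrite dotp_nrm exprn_ge0// nrm_ge0.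
  have N1 : 1 <= quadN 1 0 F G s t by exact: quadN_ge1.
  have NN : quadN 1 0 F G s t <= quadN 1 1 F G s t.
    by rewrite /quadN lerD2l lerD2l ler_wpM2r// dotp_nrm exprn_ge0// nrm_ge0.
  have Nq : quadN 1 1 F G s t `^ (P - 1) <= quadN 1 0 F G s t `^ (P - 1).
    by apply: powR_nincr => //; rewrite subr_le0.
  have x0 := powR_ge0 (quadN 1 1 F G s t) (P - 1).
  rewrite !mul1r ?mul0r ?addr0 in hU hV.
  move: (quadN 1 1 F G s t `^ (P - 1)) (quadN 1 0 F G s t `^ (P - 1)) Nq x0 hU hV.
  move: (dotp (euler F) (euler F) s t) (dotp (euler G) (euler G) s t) e0 eG.
  move: (Uss s t) (Vss s t) (Utt s t) (Vtt s t).
  clear -P0 => u v u' v' e e' e0 ee x y xy x0 hU hV.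
  have hU2 : u + u' <= P * (4 * x * (2 * e)).
    apply: (le_trans hU); rewrite ler_pM2l// ler_wpM2l ?mulr_ge0//; lra.
  have hV2 : 2 / P * (P ^+ 2 * (4 * y * e)) <= 2 / P * (v + v').
    by rewrite ler_wpM2l// divr_ge0// ltW.
  have E : 2 / P * (P ^+ 2 * (4 * y * e)) = P * (4 * y * (2 * e)).
    by field; rewrite gt_eqF.
  rewrite E in hV2.
  have hxy : P * (4 * x * (2 * e)) <= P * (4 * y * (2 * e)).
    by rewrite ler_pM2l// ler_wpM2r ?mulr_ge0// ler_wpM2l.
  rewrite (_ : _ + _ = (u + u') - 2 / P * (v + v')); last by ring.
  by rewrite subr_le0 (le_trans hU2)// (le_trans hxy).
have [sn sn0 Hn] := near0_bound HF HG F0 G0.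
have := @strip_mean_bound _ _ _ _ _ sn (3 `^ P) (ln r) S lap sn0 s0.
(* Near the centre |F| and |G| are at most 1, so that 1 + |F|^2 + |G|^2 <= 3. *)
have bound : forall s t, s <= sn ->
    1 * quadN 1 1 F G s t `^ P + - (2 / P) * quadN 1 0 F G s t `^ P <= 3 `^ P.
  move=> s t /(Hn s t)[f1 g1]; rewrite mul1r mulNr.
  apply: (@le_trans _ _ (quadN 1 1 F G s t `^ P)).
    by rewrite gerBl mulr_ge0 ?powR_ge0// divr_ge0// ltW.
  apply: ge0_ler_powR; rewrite ?nnegrE ?(ltW P0)//.
    by rewrite (le_trans ler01)// quadN_ge1.
  by rewrite /quadN !mul1r; lra.
move=> /(_ bound) main.
have IU : rintble 0 (2 * pi) (fun t => quadN 1 1 F G (ln r) t `^ P).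
  by apply: continuous_rintble; exact: (strip_c SU s0).
have IV : rintble 0 (2 * pi) (fun t => quadN 1 0 F G (ln r) t `^ P).
  by apply: continuous_rintble; exact: (strip_c SV s0).
have ri : 0 <= r < 1 by rewrite ltW.
have IF := circle_rintble (ltW p0) HF ri.
have IG := circle_rintble (ltW p0) HG ri.
have mainE : \int[mu]_(t in `[0, 2 * pi]) quadN 1 1 F G (ln r) t `^ P <=
    2 * pi * 3 `^ P + 2 / P * \int[mu]_(t in `[0, 2 * pi]) quadN 1 0 F G (ln r) t `^ P.
  by move: main; rewrite (rint_lin _ _ IU IV) mul1r mulNr lerBlDr.
have hG : pint p G r <= \int[mu]_(t in `[0, 2 * pi]) quadN 1 1 F G (ln r) t `^ P.
  apply: le_rint => // t _; rewrite -expc_ln// -dotp_pow.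
  apply: ge0_ler_powR; rewrite ?nnegrE ?(ltW P0)//.
  + by rewrite dotp_nrm exprn_ge0// nrm_ge0.
  + by rewrite (le_trans ler01)// quadN_ge1.
  + by rewrite /quadN !mul1r addrA lerDr addr_ge0// dotp_nrm exprn_ge0// nrm_ge0.
have hF : \int[mu]_(t in `[0, 2 * pi]) quadN 1 0 F G (ln r) t `^ P <=
    2 `^ P * (2 * pi + pint p F r).
  have I1 : rintble 0 (2 * pi) (fun t => 1 + nrm (F (r%:C * expit t)) `^ p).
    by apply: rintbleD => //; exact: rintble_cst.
  have -> : 2 * pi + pint p F r =
      \int[mu]_(t in `[0, 2 * pi]) (1 + nrm (F (r%:C * expit t)) `^ p).
    rewrite RintegralD//; last exact: rintble_cst.
    by rewrite rint_cst ?(ltW pp)// subr0 mulr1.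
  rewrite -RintegralZl//; apply: le_rint => //; first exact: rintbleZ.
  move=> t _; rewrite -expc_ln// -dotp_pow /quadN mul1r mul0r addr0.
  by apply: powR_add1 => //; rewrite dotp_nrm exprn_ge0// nrm_ge0.
apply: (le_trans hG); apply: (le_trans mainE).
have F_0 : 0 <= pint p F r by apply: Rintegral_ge0 => t _; exact: powR_ge0.
have PV : 0 < 2 / P by rewrite divr_gt0.
apply: (@le_trans _ _ (2 * pi * 3 `^ P + 2 / P * (2 `^ P * (2 * pi + pint p F r)))).
  by rewrite lerD2l ler_pM2l.
rewrite [leRHS]mulrDl; apply: lerD.
  by apply: ler_peMr; [rewrite mulr_ge0// ltW|rewrite lerDl].
move: (pint p F r) F_0 (2 * pi) pp => x x0 y y0.
rewrite (_ : 2 / P * 2 `^ P * (y + 1) * (1 + x) =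
  2 / P * (2 `^ P * ((y + 1) * (1 + x)))); last by ring.
rewrite ler_pM2l// ler_pM2l//; clear -x0 y0; nra.
Qed.

(** For P >= 1 the factor N^(P-1) increases with N, so the subtracted function must keep |G|^2; the
    coefficient 2P compensates for 2 P^2 against P. With U and V the two means this gives 2 U <= X +
    V, and V <= (3/2) U + B times the mean of |F|^p by [powR_split]; so U/2 remains on the left. *)
Lemma comparison_ge2 (p : R) : 2 <= p -> exists2 K : R, 0 < K &
  forall F G, Hol F -> Hol G -> F 0 = 0 -> G 0 = 0 ->
  (forall z, nrm z < 1 -> nrm (derive1 G z) <= nrm (derive1 F z)) ->
  forall r, 0 < r < 1 -> pint p G r <= K * (1 + pint p F r).
Proof.
move=> p2; set P := p / 2; have p0 : 0 < p by lra.
have P0 : 0 < P by rewrite divr_gt0.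
have P1 : 1 <= P by rewrite /P; lra.
have pp := twopi_gt0 R; have tP : 0 < 2 `^ P :> R by rewrite powR_gt0.
have [A A0 HA] := powR_split P0.
have aP : 0 < (2 * P) `^ P by rewrite powR_gt0// mulr_gt0.
pose B := A * (2 * P) `^ P; have B0 : 0 < B by rewrite mulr_gt0.
exists (2 * (2 * pi * (2 * 2 `^ P)) + 2 * B).
  by rewrite addr_gt0// !mulr_gt0// pi_gt0.
move=> F G HF HG F0 G0 FG r /andP[r0 r1].
have s0 : ln r < 0 by rewrite ln_lt0// r0.
have a0 : 0 <= 2 * P by rewrite mulr_ge0// ltW.
have [Us [Uss [Ut [Utt [SU LU]]]]] := stripC2_quadN_pow HF HG (lexx 0) ler01 P0.
have [Vs [Vss [Vt [Vtt [SV LV]]]]] := stripC2_quadN_pow HF HG a0 ler01 P0.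
have S := stripC2_lin 2 (- 1) SU SV.
have dot0 v s t : 0 <= dotp v v s t by rewrite dotp_nrm exprn_ge0// nrm_ge0.
have lap (s t : R) : s < 0 ->
  2 * Uss s t + - 1 * Vss s t + (2 * Utt s t + - 1 * Vtt s t) <= 0.
  move=> sn; have [_ hU] := LU s t; have [hV _] := LV s t.
  have PP : P <= P ^+ 2 by rewrite expr2 ler_peMr// ltW.
  rewrite (max_r PP) in hU; rewrite (min_l PP) in hV.
  have eG := euler_le t FG sn.
  have e0 := dot0 (euler G) s t.
  have NN : quadN 0 1 F G s t <= quadN (2 * P) 1 F G s t.
    by rewrite /quadN lerD2l lerD2r ler_wpM2r.
  have Nq : quadN 0 1 F G s t `^ (P - 1) <= quadN (2 * P) 1 F G s t `^ (P - 1).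
    apply: ge0_ler_powR; rewrite ?subr_ge0 ?nnegrE//;
    by rewrite (le_trans ler01)// quadN_ge1.
  have x0 := powR_ge0 (quadN 0 1 F G s t) (P - 1).
  rewrite !mul1r ?mul0r ?add0r in hU hV.
  move: (quadN 0 1 F G s t `^ (P - 1)) (quadN (2 * P) 1 F G s t `^ (P - 1)) Nq x0 hU hV.
  move: (dotp (euler F) (euler F) s t) (dotp (euler G) (euler G) s t) e0 eG.
  move: (Uss s t) (Vss s t) (Utt s t) (Vtt s t).
  clear -P0 => u v u' v' e e' e0 ee x y xy x0 hU hV.
  have ePe : 0 <= 2 * P * e by apply: mulr_ge0; [rewrite mulr_ge0// ltW|exact: le_trans ee].
  have y0 := le_trans x0 xy.
  have hU2 : 2 * (u + u') <= P * (4 * x * (2 * P * e)).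
    apply: (@le_trans _ _ (2 * (P ^+ 2 * (4 * x * e')))); first by rewrite ler_wpM2l.
    rewrite (_ : P * (4 * x * (2 * P * e)) = 2 * (P ^+ 2 * (4 * x * e))); last by ring.
    by rewrite ler_wpM2l// ler_wpM2l ?exprn_ge0 ?(ltW P0)// ler_wpM2l// mulr_ge0.
  have hV2 : P * (4 * y * (2 * P * e)) <= v + v'.
    apply: le_trans hV; rewrite ler_pM2l//.
    by rewrite ler_wpM2l ?mulr_ge0// lerDl.
  have hxy : P * (4 * x * (2 * P * e)) <= P * (4 * y * (2 * P * e)).
    by rewrite ler_pM2l// ler_wpM2r// ler_wpM2l.
  rewrite (_ : _ + _ = 2 * (u + u') - (v + v')); last by ring.
  by rewrite subr_le0 (le_trans hU2)// (le_trans hxy).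
have [sn sn0 Hn] := near0_bound HF HG F0 G0.
have := @strip_mean_bound _ _ _ _ _ sn (2 * 2 `^ P) (ln r) S lap sn0 s0.
have bound : forall s t, s <= sn ->
    2 * quadN 0 1 F G s t `^ P + - 1 * quadN (2 * P) 1 F G s t `^ P <= 2 * 2 `^ P.
  move=> s t /(Hn s t)[f1 g1]; rewrite mulN1r.
  apply: (@le_trans _ _ (2 * quadN 0 1 F G s t `^ P)).
    by rewrite gerBl powR_ge0.
  rewrite ler_pM2l//; apply: ge0_ler_powR; rewrite ?nnegrE ?(ltW P0)//.
    by rewrite (le_trans ler01)// quadN_ge1.
  by rewrite /quadN mul0r mul1r add0r (_ : 2 = 1 + 1 :> R) ?lerD2l// -natr1.
move=> /(_ bound) main.
have IU : rintble 0 (2 * pi) (fun t => quadN 0 1 F G (ln r) t `^ P).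
  by apply: continuous_rintble; exact: (strip_c SU s0).
have IV : rintble 0 (2 * pi) (fun t => quadN (2 * P) 1 F G (ln r) t `^ P).
  by apply: continuous_rintble; exact: (strip_c SV s0).
have ri : 0 <= r < 1 by rewrite ltW.
have IF := circle_rintble (ltW p0) HF ri.
have IG := circle_rintble (ltW p0) HG ri.
pose IntU := \int[mu]_(t in `[0, 2 * pi]) quadN 0 1 F G (ln r) t `^ P.
pose IntV := \int[mu]_(t in `[0, 2 * pi]) quadN (2 * P) 1 F G (ln r) t `^ P.
have mainE : 2 * IntU <= 2 * pi * (2 * 2 `^ P) + IntV.
  by move: main; rewrite (rint_lin _ _ IU IV) mulN1r lerBlDr.
have hG : pint p G r <= IntU.
  apply: le_rint => // t _; rewrite -expc_ln// -dotp_pow.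
  apply: ge0_ler_powR; rewrite ?nnegrE ?(ltW P0)//.
  + by rewrite (le_trans ler01)// quadN_ge1.
  + by rewrite /quadN mul0r mul1r add0r lerDr.
have hV : IntV <= 3 / 2 * IntU + B * pint p F r.
  rewrite /pint -(rint_lin _ _ IU IF).
  apply: le_rint => //; first by apply: rintbleD; exact: rintbleZ.
  move=> t _; rewrite -expc_ln// -dotp_pow -/P.
  rewrite /B -mulrA -powRM//.
  have -> : quadN (2 * P) 1 F G (ln r) t =
      quadN 0 1 F G (ln r) t + 2 * P * dotp F F (ln r) t.
    by rewrite /quadN; move: (dotp F F _ _) (dotp G G _ _) => x y; ring.
  apply: HA; last by rewrite mulr_ge0.
  by rewrite (le_trans ler01)// quadN_ge1.
have F_0 : 0 <= pint p F r by apply: Rintegral_ge0 => t _; exact: powR_ge0.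
have h0 : 0 <= 2 * pi * (2 * 2 `^ P) by rewrite !mulr_ge0 ?pi_ge0 ?powR_ge0.
move: IntU IntV mainE hG hV => U V mainE hG hV.
apply: (le_trans hG).
move: (2 * pi * (2 * 2 `^ P)) (pint p F r) h0 F_0 mainE hV => X x X0 x0 h1 h2.
have h3 : U <= 2 * X + 2 * (B * x) by clear -h1 h2; lra.
apply: (le_trans h3).
have h4 : 0 <= X * x by rewrite mulr_ge0.
clear -h4 B0; nra.
Qed.

Theorem comparison (p : R) : 0 < p -> exists2 K : R, 0 < K &
  forall F G, Hol F -> Hol G -> F 0 = 0 -> G 0 = 0 ->
  (forall z, nrm z < 1 -> nrm (derive1 G z) <= nrm (derive1 F z)) ->
  forall r, 0 <= r < 1 -> pint p G r <= K * (1 + pint p F r).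
Proof.
move=> p0; have [K K0 HK] : exists2 K : R, 0 < K &
  forall F G, Hol F -> Hol G -> F 0 = 0 -> G 0 = 0 ->
  (forall z, nrm z < 1 -> nrm (derive1 G z) <= nrm (derive1 F z)) ->
  forall r, 0 < r < 1 -> pint p G r <= K * (1 + pint p F r).
  by have [p2|/ltW p2] := leP p 2; [exact: comparison_le2|exact: comparison_ge2].
exists K => // F G HF HG F0 G0 FG r /andP[].
rewrite le_eqVlt => /predU1P[<- _|r0 r1]; last by apply: HK => //; rewrite r0.
(* The radius 0 has no logarithm and is treated apart. *)
have z u : u 0 = 0 -> pint p u 0 = 0.
  move=> u0; rewrite /pint (_ : (fun t => _) = fun=> 0).
    by rewrite rint_cst ?mulr0// ltW// twopi_gt0.
  by apply/funext => t; rewrite mul0r u0 nrm0 powR0// gt_eqF.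
by rewrite !z// addr0 mulr1 ltW.
Qed.

End comparison.

(** * Hardy spaces and BMOA *)

Section hardy.
Variable R : realType.
Local Notation C := R[i].
Local Notation nrm := (@Normc.normc R).
Implicit Types (f g h u v F G : C -> C).

Lemma circle_meanE (p r : R) u : 0 <= p -> Hol u -> 0 <= r < 1 ->
  circle_mean p u r = ((2 * pi)^-1 * pint p u r)%:E.
Proof.
move=> p0 Hu ri; rewrite /circle_mean EFinM /pint; congr (_ * _)%E.
rewrite /Rintegral fineK//.
have mab : measurable (`[0, 2 * pi]%classic : set (measurableTypeR R)) by exact: measurable_itv.
exact: (integrable_fin_num mab (circle_rintble p0 Hu ri)).
Qed.

Lemma pint_ge0 (p r : R) u : 0 <= pint p u r.
Proof. by apply: Rintegral_ge0 => t _; exact: powR_ge0. Qed.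

Lemma hardy_sup_ge0 (p : R) u : 0 <= p -> Hol u ->
  (0 <= ereal_sup [set circle_mean p u r | r in `[0%R, 1%R[])%E.
Proof.
move=> p0 Hu; apply: le_trans (_ : (circle_mean p u 0 <= _)%E).
  rewrite circle_meanE ?lexx ?ltr01// lee_fin mulr_ge0 ?pint_ge0//.
  by rewrite invr_ge0 ltW// twopi_gt0.
by apply: ereal_sup_ubound; exists 0 => //; rewrite /= in_itv/= lexx ltr01.
Qed.

Lemma pint_le_hardy (p S : R) u : 0 < p -> 0 <= S -> Hol u ->
  (Hardy_norm p u <= S%:E)%E ->
  forall r, 0 <= r < 1 -> pint p u r <= 2 * pi * S `^ p.
Proof.
move=> p0 S0 Hu; rewrite /Hardy_norm => H r ri.
set s := ereal_sup _ in H.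
have s0 : (0 <= s)%E by exact: hardy_sup_ge0 (ltW p0) Hu.
have sS : (s <= (S `^ p)%:E)%E.
  rewrite -poweR_EFin -(poweRe1 s0) -(mulVf (lt0r_neq0 p0)) poweRrM.
  apply: gt0_ler_poweR => //; first exact: ltW.
    by rewrite in_itv/= poweR_ge0 leey.
  by rewrite in_itv/= leey lee_fin S0.
have : (circle_mean p u r <= (S `^ p)%:E)%E.
  by apply: le_trans sS; apply: ereal_sup_ubound; exists r => //; rewrite /= in_itv.
rewrite circle_meanE ?(ltW p0)// lee_fin mulrC ler_pdivrMr ?twopi_gt0//.
by rewrite mulrC.
Qed.

Lemma hardy_le_pint (p B : R) u : 0 < p -> Hol u ->
  (forall r, 0 <= r < 1 -> pint p u r <= B) ->
  (Hardy_norm p u <= (((2 * pi)^-1 * B) `^ p^-1)%:E)%E.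
Proof.
move=> p0 Hu HB; rewrite /Hardy_norm -poweR_EFin.
have B0 : 0 <= B by apply: le_trans (HB 0 _); rewrite ?pint_ge0 ?lexx ?ltr01.
have p2 := twopi_gt0 R.
apply: gt0_ler_poweR.
- by rewrite invr_ge0 ltW.
- by rewrite in_itv/= leey andbT; exact: hardy_sup_ge0 (ltW p0) Hu.
- by rewrite in_itv/= leey andbT lee_fin mulr_ge0// invr_ge0 ltW.
- apply: ge_ereal_sup => _ [r ri <-]; rewrite /= in_itv/= in ri.
  rewrite circle_meanE ?(ltW p0)// lee_fin ler_wpM2l ?invr_ge0 ?(ltW p2)//.
  exact: HB.
Qed.

Lemma ereal_lty_bound (x : \bar R) : (x < +oo)%E ->
  exists2 S : R, 0 <= S & (x <= S%:E)%E.
Proof.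
case: x => [r| |]//.
- by move=> _; exists `|r| => //; rewrite lee_fin ler_norm.
- by move=> _; exists 0 => //; exact: leNye.
Qed.

(** From here on membership in H^p is handled through real integrals with a common bound, without
    extended reals. *)
Lemma HardyP (p : R) u : 0 < p -> Hol u ->
  Hardy p u <-> exists B : R, forall r, 0 <= r < 1 -> pint p u r <= B.
Proof.
move=> p0 Hu; split.
- move=> [_ /ereal_lty_bound[S S0 HS]]; exists (2 * pi * S `^ p).
  exact: pint_le_hardy.
- move=> [B HB]; split => //; apply: le_lt_trans (hardy_le_pint p0 Hu HB) _.
  by rewrite ltry.
Qed.

Lemma comparisonK (p K : R) : 0 < p -> 0 < K -> exists2 A : R, 0 < A &
  forall F G, Hol F -> Hol G -> F 0 = 0 -> G 0 = 0 ->
  (forall z, nrm z < 1 -> nrm (derive1 G z) <= K * nrm (derive1 F z)) ->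
  forall r, 0 <= r < 1 -> pint p G r <= A * (1 + pint p F r).
Proof.
move=> p0 K0; have [A A0 HA] := comparison p0.
have KP : 0 < K `^ p by rewrite powR_gt0.
exists (A * (1 + K `^ p)); first by rewrite mulr_gt0// addr_gt0.
move=> F G HF HG F0 G0 FG r ri.
have [HKF dKF] : Hol (fun z => K%:C * F z) /\
    forall z, nrm z < 1 -> derive1 (fun z => K%:C * F z) z = K%:C * derive1 F z.
  apply: (@Hol_cder _ _ (fun z => K%:C * derive1 F z)) => z z1.
  have := cderM (cder_cst K%:C z) ((HolP F).1 HF z z1).
  by rewrite mulr0 addr0.
have F0' : K%:C * F 0 = 0 by rewrite F0 mulr0.
have FG' z : nrm z < 1 -> nrm (derive1 G z) <= nrm (derive1 (fun z => K%:C * F z) z).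
  by move=> z1; rewrite (dKF z z1) nrmM nrm_real gtr0_norm//; exact: FG.
apply: (le_trans (HA _ _ HKF HG F0' G0 FG' r ri)).
have -> : pint p (fun z => K%:C * F z) r = K `^ p * pint p F r.
  rewrite /pint -RintegralZl//; last exact: circle_rintble (ltW p0) HF ri.
  apply: eq_Rintegral => t _.
  by rewrite nrmM nrm_real gtr0_norm// powRM ?nrm_ge0// ltW.
rewrite -mulrA ler_pM2l//; have := pint_ge0 p r F.
by move: (pint p F r) KP => x y x0; clear -x0 y; nra.
Qed.

(* Rewriting with the equations instead would make unification compare the
   derivatives of distinct functions. *)
Lemma le_scale_eq (K : R) (x y x' y' : C) : x = x' -> y = y' ->
  nrm x' <= K * nrm y' -> nrm x <= K * nrm y.
Proof. by move=> -> ->. Qed.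

Lemma le_scaleMr (K : R) (x y a b c : C) : x = a * c -> y = b * c ->
  nrm a <= K * nrm b -> nrm x <= K * nrm y.
Proof.
by move=> -> -> ab; rewrite !nrmM mulrA; apply: ler_wpM2r; first exact: nrm_ge0.
Qed.

Lemma le_scaleMl (K : R) (x y a b c : C) : x = c * a -> y = c * b ->
  nrm a <= K * nrm b -> nrm x <= K * nrm y.
Proof. by move=> ex ey; apply: (@le_scaleMr _ _ _ _ _ c); rewrite mulrC. Qed.

Lemma Hol_addc u (c : C) : Hol u -> Hol (fun z => u z + c) /\
  forall z, nrm z < 1 -> derive1 (fun z => u z + c) z = derive1 u z.
Proof.
move=> Hu; apply: Hol_cder => z z1.
have := cderD ((HolP u).1 Hu z z1) (cder_cst c z).
by rewrite addr0.
Qed.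

Lemma powRD_le (x y p : R) : 0 <= x -> 0 <= y -> 0 <= p ->
  (x + y) `^ p <= 2 `^ p * (x `^ p + y `^ p).
Proof.
move=> x0 y0 p0; wlog xy : x y x0 y0 / x <= y.
  move=> W; have [xy|/ltW yx] := leP x y; first exact: W.
  by rewrite addrC [X in _ * X]addrC; exact: W.
apply: (@le_trans _ _ ((2 * y) `^ p)).
  apply: ge0_ler_powR; rewrite ?nnegrE ?addr_ge0 ?mulr_ge0//.
  by rewrite mulr_natl mulr2n lerD2r.
by rewrite powRM// ler_wpM2l ?powR_ge0// lerDr powR_ge0.
Qed.

Lemma pintD (p r : R) u F : 0 <= p -> Hol u -> Hol F -> 0 <= r < 1 ->
  pint p (fun z => u z + F z) r <= 2 `^ p * (pint p u r + pint p F r).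
Proof.
move=> p0 Hu HF ri.
have I1 := circle_rintble p0 Hu ri; have I2 := circle_rintble p0 HF ri.
have I3 := circle_rintble p0 (HolD Hu HF) ri.
rewrite /pint -RintegralD// -RintegralZl//; last exact: rintbleD.
apply: le_rint => //; first by apply: rintbleZ; exact: rintbleD.
move=> t _; apply: le_trans (powRD_le (nrm_ge0 _) (nrm_ge0 _) p0).
by apply: ge0_ler_powR; rewrite ?nnegrE ?addr_ge0 ?nrm_ge0// nrmD.
Qed.

Lemma pint_addc (p r : R) u (c : C) : 0 <= p -> Hol u -> 0 <= r < 1 ->
  pint p (fun z => u z + c) r <= 2 `^ p * (pint p u r + 2 * pi * nrm c `^ p).
Proof.
move=> p0 Hu ri; have := pintD p0 Hu (@Hol_cst R c) ri.
by rewrite [in X in _ -> X]/pint /pint rint_cst ?subr0// ltW// twopi_gt0.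
Qed.

Lemma Hardy_addc (p : R) u (c : C) : 0 < p -> Hardy p u ->
  Hardy p (fun z => u z + c).
Proof.
move=> p0 Hu; have Hu1 := Hu.1; have [Hc _] := Hol_addc c Hu1.
have [B HB] := (HardyP p0 Hu1).1 Hu.
apply/(HardyP p0 Hc); exists (2 `^ p * (B + 2 * pi * nrm c `^ p)) => r ri.
apply: (le_trans (pint_addc c (ltW p0) Hu1 ri)).
by rewrite ler_wpM2l ?powR_ge0// lerD2r HB.
Qed.

Lemma Hardy_dominated (p K : R) F G : 0 < p -> 0 < K -> Hardy p F -> Hol G ->
  (forall z, nrm z < 1 -> nrm (derive1 G z) <= K * nrm (derive1 F z)) ->
  Hardy p G.
Proof.
move=> p0 K0 HF HG FG.
have F1 := Hardy_addc (- F 0) p0 HF.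
have [HF' dF'] := Hol_addc (- F 0) HF.1; have [HG' dG'] := Hol_addc (- G 0) HG.
have [A A0 HA] := comparisonK p0 K0.
have [B HB] := (HardyP p0 HF').1 F1.
have FG' z : nrm z < 1 -> nrm (derive1 (fun z => G z - G 0) z) <=
    K * nrm (derive1 (fun z => F z - F 0) z).
  by move=> z1; apply: (le_scale_eq (dG' z z1) (dF' z z1)); exact: FG.
have G1 : Hardy p (fun z => G z - G 0).
  apply/(HardyP p0 HG'); exists (A * (1 + B)) => r ri.
  apply: (le_trans (HA _ _ HF' HG' (subrr _) (subrr _) FG' r ri)).
  by rewrite ler_pM2l// lerD2l HB.
have := Hardy_addc (G 0) p0 G1.
rewrite (_ : (fun z => _) = G)//.
by apply/funext => z; rewrite subrK.
Qed.

Lemma disc_aut0 (a : C) : disc_aut a 0 = a.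
Proof. by rewrite /disc_aut mulr0 !subr0 divr1. Qed.

Lemma disc_aut_den (a z : C) : nrm a < 1 -> nrm z < 1 -> 1 - a^*%C * z != 0.
Proof.
move=> a1 z1; rewrite subr_eq0; apply/eqP => /(congr1 nrm).
rewrite nrm1 nrmM nrm_conj => E.
have : nrm a * nrm z < 1 by rewrite mulr_ilt1 ?nrm_ge0.
by rewrite -E ltxx.
Qed.

Lemma disc_aut_disc (a z : C) : nrm a < 1 -> nrm z < 1 -> nrm (disc_aut a z) < 1.
Proof.
move=> a1 z1; have d0 := disc_aut_den a1 z1.
rewrite /disc_aut nrmM nrmV ltr_pdivrMr ?nrm_gt0// mul1r.
rewrite -(@ltr_pXn2r _ 2) ?nnegrE ?nrm_ge0// -subr_gt0.
have -> : nrm (1 - a^*%C * z) ^+ 2 - nrm (a - z) ^+ 2 =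
    (1 - nrm a ^+ 2) * (1 - nrm z ^+ 2).
  by rewrite !nrm_sqr; case: a {a1 d0} => x y; case: z {z1} => u v /=; ring.
by rewrite mulr_gt0 ?subr_gt0 ?exprn_ilt1 ?nrm_ge0.
Qed.

Lemma disc_aut_cder (a z : C) : nrm a < 1 -> nrm z < 1 ->
  exists L, cder (disc_aut a) z L.
Proof.
move=> a1 z1; have d0 := disc_aut_den a1 z1.
have D1 : exists L, cder (fun w => (a - w)) z L.
  eexists; apply: cderD; first exact: cder_cst.
  have := cderM (cder_cst (-1) z) (cder_id z).
  rewrite (_ : (fun t => -1 * t) = (fun t : C => - t)); first exact.
  by apply/funext => t; rewrite mulN1r.
have D2 : exists L, cder (fun w => 1 - a^*%C * w) z L.
  eexists; apply: cderD; first exact: cder_cst.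
  have := cderM (cder_cst (- a^*%C) z) (cder_id z).
  rewrite (_ : (fun t => - a^*%C * t) = (fun t : C => - (a^*%C * t))); first exact.
  by apply/funext => t; rewrite mulNr.
case: D1 D2 => L1 D1 [L2 D2]; eexists; apply: cderM; first exact: D1.
apply: cderV; [exact: d0|exact: D2].
Qed.

Lemma disc_aut_comp u (a : C) : Hol u -> nrm a < 1 ->
  Hol (fun z => u (disc_aut a z) - u a) /\
  forall z, nrm z < 1 -> derive1 (fun z => u (disc_aut a z) - u a) z =
    derive1 u (disc_aut a z) * derive1 (disc_aut a) z.
Proof.
move=> Hu a1; apply: Hol_cder => z z1.
have [L HL] := disc_aut_cder a1 z1; have [_ ->] := cder_derivable HL.
have D := cder_comp HL ((HolP u).1 Hu _ (disc_aut_disc a1 z1)).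
have := cderD D (cder_cst (- u a) z).
by rewrite addr0.
Qed.

(** After composition with [disc_aut a] both derivatives acquire the same factor, so the domination
    persists with the same K. The constant of [comparisonK] does not depend on a, which bounds the
    supremum over a. *)
Lemma BMOA_dominated (K : R) g h : 0 < K -> BMOA g -> Hol h ->
  (forall z, nrm z < 1 -> nrm (derive1 h z) <= K * nrm (derive1 g z)) ->
  BMOA h.
Proof.
move=> K0 [g2 gs] Hh gh; have Hg := g2.1.
have two0 : 0 < 2 :> R by [].
split; first exact: (Hardy_dominated two0 K0 g2 Hh gh).
have [S S0 HS] := ereal_lty_bound gs.
have [A A0 HA] := comparisonK two0 K0.
pose B := A * (1 + 2 * pi * S `^ 2).
apply: (@le_lt_trans _ _ (((2 * pi)^-1 * B) `^ 2^-1)%:E); last by rewrite ltry.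
apply: ge_ereal_sup => _ [a /discE a1 <-].
have [HG dG] := disc_aut_comp Hh a1; have [HF dF] := disc_aut_comp Hg a1.
apply: hardy_le_pint => // r ri.
have FG z : nrm z < 1 -> nrm (derive1 (fun z => h (disc_aut a z) - h a) z) <=
    K * nrm (derive1 (fun z => g (disc_aut a z) - g a) z).
  move=> z1; apply: (le_scaleMr (dG z z1) (dF z z1)).
  by apply: gh; exact: disc_aut_disc.
have F0 : g (disc_aut a 0) - g a = 0 by rewrite disc_aut0 subrr.
have G0 : h (disc_aut a 0) - h a = 0 by rewrite disc_aut0 subrr.
apply: (le_trans (HA _ _ HF HG F0 G0 FG r ri)).
rewrite ler_pM2l// lerD2l; apply: pint_le_hardy => //.
apply: le_trans HS; apply: ereal_sup_ubound; exists a => //.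
exact/discE.
Qed.

(** From h' = k g' one gets (T_h f)' = k (T_g f)', so one bound for k gives both the membership of h
    in BMOA and the inclusion of the domains. The constant is left arbitrary in order to serve both
    descriptions of the space. *)
Theorem volterra_bounded_Vspace g p k h (c : C) : 1 <= p -> BMOA g -> Hinf k ->
  eq_on_disc h (fun z => volterra g k z + c) -> Vspace g p h.
Proof.
move=> p1 gB [Hk [M HM]] hE; have p0 : 0 < p := lt_le_trans ltr01 p1.
have Hg : Hol g := gB.1.1.
have [Hh dh] : Hol h /\ forall z, nrm z < 1 -> derive1 h z = k z * derive1 g z.
  apply: Hol_cder => z z1.
  apply: (@cder_near _ (fun z => volterra g k z + c) _ _ _ (1 - nrm z)).
  - by rewrite subr_gt0.
  - move=> w wz; rewrite hE//; apply/discE.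
    by have := nrm_subl w z; move: wz; lra.
  - by have := cderD (volterra_cder Hg Hk z1) (cder_cst c z); rewrite addr0.
pose K := `|M| + 1; have K0 : 0 < K by rewrite ltr_wpDl.
have kK z : nrm z < 1 -> nrm (k z) <= K.
  move=> z1; apply: (le_trans (HM z ((discE z).2 z1))).
  by rewrite (le_trans (ler_norm M))// lerDl.
have gh z : nrm z < 1 -> nrm (derive1 h z) <= K * nrm (derive1 g z).
  by move=> z1; rewrite (dh z z1) nrmM; apply: ler_wpM2r; [exact: nrm_ge0|exact: kK].
split; first exact: (BMOA_dominated K0 gB Hh gh).
move=> f [Hf Hvf]; split; first exact: Hf.
have [HG dG] := volterra_Hol Hh Hf; have [HF dF] := volterra_Hol Hg Hf.
apply: (Hardy_dominated p0 K0 Hvf HG) => z z1.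
apply: (le_scaleMl (dG z z1) (dF z z1)); exact: gh.
Qed.

End hardy.

(** * Geometric series of holomorphic functions *)

Section geometric_sums.
Variable R : realType.
Local Notation C := R[i].
Local Notation nrm := (@Normc.normc R).
Variable b : R.
Hypotheses (b0 : 0 < b) (b2 : b <= 2^-1).

Lemma b_lt1 : b < 1.
Proof. by apply: le_lt_trans b2 _; rewrite invf_lt1// ltr1n. Qed.

Lemma geometric_vanish (A e : R) : 0 < e -> exists m, A * b ^+ m <= e.
Proof.
move=> e0; pose m := (Num.truncn (`|A| / e)).+1; exists m.
have mA : `|A| / e < m%:R by exact: truncnS_gt.
have m0 : 0 < m%:R :> R by rewrite ltr0n.
have bm : b ^+ m <= m%:R^-1.
  apply: (@le_trans _ _ (2^-1 ^+ m)).
    by rewrite lerXn2r// nnegrE ?(ltW b0)// invr_ge0.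
  by rewrite exprVn lef_pV2 ?posrE ?exprn_gt0// -natrX ler_nat ltnW// ltn_expl.
apply: (@le_trans _ _ (`|A| * m%:R^-1)).
  apply: le_trans (ler_wpM2l (normr_ge0 A) bm).
  by rewrite ler_wpM2r ?ler_norm// exprn_ge0// ltW.
by rewrite ler_pdivrMr// mulrC -ler_pdivrMr// ltW.
Qed.

Lemma geometric_limit (x c A : R) : (forall m, x <= c + A * b ^+ m) -> x <= c.
Proof.
move=> H; rewrite -subr_le0; apply: (@le_eps0 _ _ 1) => e e0.
have [m Hm] := geometric_vanish A e0.
by rewrite mulr1 lerBlDl (le_trans (H m))// lerD2l.
Qed.

(** The intervals around the partial sums, with the geometric tails [t N] as radii, are nested
    because [t N] exceeds [t N.+1] by exactly M b^N. *)
Lemma real_sum_exists (M : R) (v : nat -> R) : (forall n, `|v n| <= M * b ^+ n) ->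
  exists s, forall N, `|s - \sum_(n < N) v n| <= M * b ^+ N / (1 - b).
Proof.
move=> Hv; have d0 : 0 < 1 - b by rewrite subr_gt0 b_lt1.
pose t N := M * b ^+ N / (1 - b).
have tS N : t N = t N.+1 + M * b ^+ N.
  by rewrite /t exprS; field; rewrite gt_eqF.
have t0 N : 0 <= t N.
  by rewrite /t divr_ge0 ?(ltW d0)//; exact: le_trans (normr_ge0 _) (Hv N).
pose S N := \sum_(n < N) v n.
have SS N : S N.+1 = S N + v N by rewrite /S big_ord_recr.
have [||n|s Hs] := @nested_point R (fun N => S N - t N) (fun N => t N + t N).
- move=> n; rewrite SS tS; have := Hv n; rewrite ler_norml => /andP[h _]; lra.
- move=> n; rewrite SS (tS n); have := Hv n; rewrite ler_norml => /andP[_ h]; lra.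
- by rewrite addr_ge0.
- exists s => N; rewrite -/(t N) -/(S N) ler_norml; have := Hs N; lra.
Qed.

Lemma Re_sum N (u : nat -> C) :
  complex.Re (\sum_(n < N) u n) = \sum_(n < N) complex.Re (u n).
Proof.
by elim: N => [|N IH]; [rewrite !big_ord0|rewrite !big_ord_recr/= ReD IH].
Qed.

Lemma Im_sum N (u : nat -> C) :
  complex.Im (\sum_(n < N) u n) = \sum_(n < N) complex.Im (u n).
Proof.
by elim: N => [|N IH]; [rewrite !big_ord0|rewrite !big_ord_recr/= ImD IH].
Qed.

Lemma complex_sum_exists (M : R) (u : nat -> C) :
  (forall n, nrm (u n) <= M * b ^+ n) ->
  exists s : C, forall N, nrm (s - \sum_(n < N) u n) <= 2 * (M * b ^+ N / (1 - b)).
Proof.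
move=> Hu.
have [s1 H1] := @real_sum_exists M (fun n => complex.Re (u n))
  (fun n => le_trans (nrm_Re _) (Hu n)).
have [s2 H2] := @real_sum_exists M (fun n => complex.Im (u n))
  (fun n => le_trans (nrm_Im _) (Hu n)).
exists (s1 +i* s2) => N; apply: (le_trans (nrm_ReIm _)).
rewrite ReD ImD ReN ImN /= Re_sum Im_sum mulr_natl mulr2n.
by apply: lerD.
Qed.

Lemma nrm_sum N (u : nat -> C) (v : nat -> R) : (forall n, nrm (u n) <= v n) ->
  nrm (\sum_(n < N) u n) <= \sum_(n < N) v n.
Proof.
move=> H; elim: N => [|N IH]; first by rewrite !big_ord0 nrm0.
by rewrite !big_ord_recr/=; apply: (le_trans (nrmD _ _)); apply: lerD.
Qed.

Lemma geometric_sum_le N : \sum_(n < N) b ^+ n <= 2.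
Proof.
suff : \sum_(n < N) b ^+ n + 2 * b ^+ N <= 2.
  by have := exprn_ge0 N (ltW b0); lra.
elim: N => [|N IH]; first by rewrite big_ord0 expr0; lra.
rewrite big_ord_recr/= exprS.
have h : b * b ^+ N <= 2^-1 * b ^+ N by rewrite ler_wpM2r// exprn_ge0// ltW.
move: h IH; move: (b * b ^+ N) (b ^+ N) (\sum_(n < N) b ^+ n); clear; move=> *; lra.
Qed.

(** A tail bound with some unspecified A identifies s as the sum; then the tail obeys the bound
    given by any M for the terms. The sum can thus be fixed first and M chosen afterwards. *)
Lemma sum_tail (s : C) (A M : R) (u : nat -> C) :
  (forall N, nrm (s - \sum_(n < N) u n) <= A * b ^+ N) ->
  (forall n, nrm (u n) <= M * b ^+ n) ->
  forall N, nrm (s - \sum_(n < N) u n) <= 2 * M * b ^+ N.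
Proof.
move=> HA HM N; apply: (@geometric_limit _ _ (A * b ^+ N)) => m.
have M0 : 0 <= M by have := HM 0%N; rewrite expr0 mulr1; exact: le_trans (nrm_ge0 _).
have -> : s - \sum_(n < N) u n =
    (s - \sum_(n < N + m) u n) + \sum_(n < m) u (N + n)%N.
  by rewrite big_split_ord/= opprD addrA subrK.
apply: (le_trans (nrmD _ _)); rewrite addrC; apply: lerD; last first.
  by rewrite -mulrA -exprD.
apply: (le_trans (@nrm_sum m (fun n => u (N + n)%N) (fun n => M * b ^+ N * b ^+ n) _)).
  by move=> n; rewrite -mulrA -exprD.
have MB : 0 <= M * b ^+ N by rewrite mulr_ge0// exprn_ge0// ltW.
rewrite -mulr_sumr (_ : 2 * M * b ^+ N = M * b ^+ N * 2); last by ring.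
by rewrite ler_wpM2l// geometric_sum_le.
Qed.

Definition sum_bounds (T T' : nat -> C -> C) (rho M : R) :=
  forall n z w, nrm z <= rho -> nrm w <= rho ->
    [/\ nrm (T n z) <= M * b ^+ n, nrm (T' n z) <= M * b ^+ n &
      nrm (T n w - T n z - (w - z) * T' n z) <= M * b ^+ n * nrm (w - z) ^+ 2].

(** The quadratic remainders of the terms add up to at most 2 M |h|^2, and the truncation errors
    disappear in the limit. The last tail bound takes any M valid at the single point z, which
    allows the sharper, point dependent bounds of the derivatives of the test functions. *)
Theorem sum_derivable (T T' : nat -> C -> C) :
  (forall rho, rho < 1 -> exists2 M : R, 0 < M & sum_bounds T T' rho M) ->
  exists F F' : C -> C, [/\ (forall z, nrm z < 1 -> cder F z (F' z)),
    (forall rho M : R, rho < 1 -> sum_bounds T T' rho M -> forall z N, nrm z <= rho ->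
      nrm (F z - \sum_(n < N) T n z) <= 2 * M * b ^+ N) &
    (forall z M, nrm z < 1 -> (forall n, nrm (T' n z) <= M * b ^+ n) -> forall N,
      nrm (F' z - \sum_(n < N) T' n z) <= 2 * M * b ^+ N)].
Proof.
move=> H; have d0 : 0 < 1 - b by rewrite subr_gt0 b_lt1.
have ex (z : C) : exists s : C * C, nrm z < 1 -> exists A : R, forall N,
    nrm (s.1 - \sum_(n < N) T n z) <= A * b ^+ N /\
    nrm (s.2 - \sum_(n < N) T' n z) <= A * b ^+ N.
  have [z1|z1] := boolP (nrm z < 1); last by exists (0, 0).
  have [M M0 HM] := H _ z1.
  have [s1 H1] := @complex_sum_exists M (fun n => T n z)
    (fun n => let: And3 h _ _ := HM n z z (lexx _) (lexx _) in h).
  have [s2 H2] := @complex_sum_exists M (fun n => T' n z)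
    (fun n => let: And3 _ h _ := HM n z z (lexx _) (lexx _) in h).
  exists (s1, s2) => _; exists (2 * (M / (1 - b))) => N.
  have E : 2 * (M / (1 - b)) * b ^+ N = 2 * (M * b ^+ N / (1 - b)) by ring.
  by rewrite E; split; [exact: H1|exact: H2].
have [S HS] := choice ex.
pose F z := (S z).1; pose F' z := (S z).2.
have tailF rho M : rho < 1 -> sum_bounds T T' rho M -> forall z N, nrm z <= rho ->
    nrm (F z - \sum_(n < N) T n z) <= 2 * M * b ^+ N.
  move=> rho1 HM z N zr; have [A HA] := HS z (le_lt_trans zr rho1).
  apply: (@sum_tail _ A M (fun n => T n z)) => n; first by have [] := HA n.
  by have [] := HM n z z zr zr.
have tailF' z M : nrm z < 1 -> (forall n, nrm (T' n z) <= M * b ^+ n) -> forall N,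
    nrm (F' z - \sum_(n < N) T' n z) <= 2 * M * b ^+ N.
  move=> z1 HM N; have [A HA] := HS z z1.
  by apply: (@sum_tail _ A M (fun n => T' n z)) => n //; have [] := HA n.
exists F, F'; split => // z z1.
have [rho [zr /andP[rho0 rho1]]] := between1 z1 (nrm_ge0 z).
have [M M0 HM] := H _ rho1.
apply: (@cder_quad _ _ _ _ (2 * M) (rho - nrm z)); first by rewrite subr_gt0.
move=> h hd.
have wr : nrm (z + h) <= rho.
  by apply: (le_trans (nrmD _ _)); rewrite -lerBrDl ltW.
have zr' := ltW zr.
have h1 : nrm h <= 1.
  by rewrite (le_trans (ltW hd))// lerBlDr (le_trans (ltW rho1))// lerDl nrm_ge0.
(* Three tails, each at most 2 M b^N: at z + h, at z, and for the derivative. *)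
apply: (@geometric_limit _ _ (6 * M)) => N.
pose Q n := T n (z + h) - T n z - h * T' n z.
have -> : F (z + h) - F z - h * F' z =
   (F (z + h) - \sum_(n < N) T n (z + h)) - (F z - \sum_(n < N) T n z)
   - h * (F' z - \sum_(n < N) T' n z) + \sum_(n < N) Q n.
  by rewrite /Q !sumrB -mulr_sumr; ring.
have q1 := tailF _ _ rho1 HM _ N wr; have q2 := tailF _ _ rho1 HM _ N zr'.
have q3 : nrm (F' z - \sum_(n < N) T' n z) <= 2 * M * b ^+ N.
  by apply: tailF' => // n; have [] := HM n z z zr' zr'.
have q4 : nrm (\sum_(n < N) Q n) <= 2 * M * nrm h ^+ 2.
  apply: (le_trans (@nrm_sum N Q (fun n => M * nrm h ^+ 2 * b ^+ n) _)).
    move=> n; have [_ _] := HM n z (z + h) zr' wr.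
    by rewrite (addrC z) addrK mulrAC (addrC h).
  rewrite -mulr_sumr (_ : 2 * M * nrm h ^+ 2 = M * nrm h ^+ 2 * 2); last by ring.
  by rewrite ler_wpM2l ?geometric_sum_le// mulr_ge0 ?(ltW M0)// exprn_ge0// nrm_ge0.
have q5 : nrm (h * (F' z - \sum_(n < N) T' n z)) <= 2 * M * b ^+ N.
  by apply: le_trans q3; rewrite nrmM ler_piMl// nrm_ge0.
apply: (le_trans (nrmD _ _)); rewrite addrC; apply: lerD q4 _.
apply: (le_trans (nrmB _ _)).
rewrite (_ : 6 * M * b ^+ N = 2 * M * b ^+ N + 2 * M * b ^+ N + 2 * M * b ^+ N); last by ring.
apply: lerD q5; apply: (le_trans (nrmB _ _)); exact: lerD.
Qed.

End geometric_sums.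

(** * Growth of the derivative of a Hardy function *)

Section poisson.
Variable R : realType.
Local Notation C := R[i].
Local Notation nrm := (@Normc.normc R).
Local Notation mu := (@lebesgue_measure R).
Implicit Types (F G : C -> C).

Lemma Re_cayley (x : C) : 1 - x != 0 ->
  complex.Re ((1 + x) / (1 - x)) = (1 - nrm x ^+ 2) / nrm (1 - x) ^+ 2.
Proof.
move=> x1; have n0 : nrm (1 - x) ^+ 2 != 0 by rewrite expf_neq0// nrm_eq0.
have -> : (1 + x) / (1 - x) = ((1 - nrm x ^+ 2) / nrm (1 - x) ^+ 2)
    +i* (2 * complex.Im x / nrm (1 - x) ^+ 2); last by [].
apply: (mulIf x1); rewrite divfK//.
move: n0; rewrite !nrm_sqr; case: x {x1} => a b /= n0.
apply/eqP; rewrite eq_complex/=; apply/andP; split; apply/eqP; field;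
  by rewrite add0r in n0.
Qed.

Lemma cayley_den (c : C) (t : R) : nrm c < 1 -> 1 - c * expit t != 0.
Proof.
move=> c1; rewrite subr_eq0; apply/eqP => /(congr1 nrm).
by rewrite nrm1 nrmM nrm_expit mulr1 => E; move: c1; rewrite -E ltxx.
Qed.

Lemma poisson_icont (c : C) (a b : R) : nrm c < 1 ->
  icont a b (fun t => (nrm (1 - c * expit t) ^+ 2)^-1).
Proof.
move=> c1.
have H : iccont a b (fun t => 1 / ((1 - c * expit t) ^+ 2)).
  apply: circle_quot_iccont; first exact: iccont_cst.
    apply: iccontX; apply: iccontD; first exact: iccont_cst.
    have -> : (fun t => - (c * expit t)) = (fun t : R => (- c) * (1%:C * expit t - 0)).
      by apply/funext => t; rewrite subr0 mul1r mulNr.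
    by apply: iccontM; [exact: iccont_cst|exact: circle_iccont_id].
  by move=> t; rewrite expf_neq0// cayley_den.
have := iccont_nrm H.
rewrite (_ : (fun t => nrm _) = fun t => (nrm (1 - c * expit t) ^+ 2)^-1)//.
by apply/funext => t; rewrite mul1r nrmV nrmX.
Qed.

(** Up to the factor 1 - |c|^2 the integrand is the real part of (1 + x) / (1 - x) at x = c e^(it),
    and the mean value at the centre is 1. The rescaling [k = c / r] moves the unit circle inside
    the disc, where [mean_value] applies; its argument -1 means that no circle is exceptional. *)
Theorem poisson_kernel (c : C) : nrm c < 1 ->
  \int[mu]_(t in `[0, 2 * pi]) (nrm (1 - c * expit t) ^+ 2)^-1 =
  2 * pi / (1 - nrm c ^+ 2).
Proof.
move=> c1; have c0 := nrm_ge0 c.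
pose r := (1 + nrm c) / 2.
have rr : nrm c < r by rewrite /r; lra.
have r1 : r < 1 by rewrite /r; lra.
have r0 : 0 < r by exact: le_lt_trans rr.
pose k := c / r%:C.
have kn : nrm k < 1 by rewrite nrmM nrmV nrm_real gtr0_norm// ltr_pdivrMr// mul1r.
have den z : nrm z < 1 -> 1 - k * z != 0.
  move=> z1; rewrite subr_eq0; apply/eqP => /(congr1 nrm); rewrite nrm1 nrmM => E.
  have : nrm k * nrm z < 1 by rewrite mulr_ilt1 ?nrm_ge0.
  by rewrite -E ltxx.
pose u z := (1 + k * z) / (1 - k * z).
have du z : nrm z < 1 -> exists L, cder u z L.
  move=> z1; eexists; apply: cderM.
    apply: cderD; first exact: cder_cst.
    by apply: cderM; [exact: cder_cst|exact: cder_id].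
  apply: cderV; first exact: den.
  have -> : (fun t => 1 - k * t) = (fun t : C => 1 + (- k) * t).
    by apply/funext => t; rewrite mulNr.
  apply: cderD; first exact: cder_cst.
  by apply: cderM; [exact: cder_cst|exact: cder_id].
have cu : ccont_disc u by move=> z z1; have [L HL] := du z z1; exact: cder_cont HL.
have ri : 0 <= r < 1 by rewrite (ltW r0).
have := @mean_value R u (-1) r cu (fun z z1 _ => du z z1) ri.
rewrite {2}/u mulr0 addr0 subr0 divr1 mulr1 /cmean2pi cintE => /(congr1 (fun w : C => complex.Re w)) /=.
have N t : nrm (c * expit t) = nrm c by rewrite nrmM nrm_expit mulr1.
rewrite (_ : (fun t => _) = fun t => (1 - nrm c ^+ 2) * (nrm (1 - c * expit t) ^+ 2)^-1).
  rewrite RintegralZl//; last exact/icont_intble/poisson_icont.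
  have D0 : 1 - nrm c ^+ 2 != 0 by rewrite gt_eqF// subr_gt0 exprn_ilt1.
  by move=> E; apply: (canRL (mulfK D0)); rewrite mulrC.
apply/funext => t; rewrite /u.
have -> : k * (r%:C * expit t) = c * expit t.
  by rewrite mulrA /k divfK// -nrm_eq0 nrm_real gtr0_norm// gt_eqF.
by rewrite Re_cayley ?cayley_den// N.
Qed.

(** Since |e^(it)| = 1, conjugation gives |r e^(it) - z| = |r - conj(z) e^(it)|, which brings the
    Cauchy kernel to the form of the Poisson kernel. *)
Lemma circle_kernel (z : C) (r t : R) : nrm z < r ->
  nrm (r%:C * expit t - z) = r * nrm (1 - (z^*%C / r%:C) * expit t).
Proof.
move=> zr; have r0 : 0 < r by exact: le_lt_trans (nrm_ge0 _) zr.
have rC : r%:C != 0 :> C by rewrite -nrm_eq0 nrm_real gtr0_norm// gt_eqF.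
apply/eqP; rewrite -(@eqrXn2 _ 2) ?nrm_ge0 ?mulr_ge0 ?nrm_ge0 ?(ltW r0)//; apply/eqP.
have rE : r ^+ 2 = nrm r%:C ^+ 2 by rewrite nrm_real gtr0_norm.
rewrite exprMn rE -exprMn -nrmM.
have -> : r%:C * (1 - z^*%C / r%:C * expit t) = r%:C - z^*%C * expit t.
  by rewrite mulrBr mulr1 mulrA mulrCA divff// mulr1.
have cs := cos2Dsin2 t.
rewrite !nrm_sqr /expit; case: z zr => a b /= _.
move: (cos t) (sin t) cs => x y cs.
have -> : (r * x - 0 * y - a) ^+ 2 + (r * y + 0 * x - b) ^+ 2 =
  r ^+ 2 * (x ^+ 2 + y ^+ 2) + a ^+ 2 + b ^+ 2 - 2 * r * (a * x + b * y) by ring.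
have -> : (r - (a * x - - b * y)) ^+ 2 + (0 - (a * y + - b * x)) ^+ 2 =
  r ^+ 2 + (a ^+ 2 + b ^+ 2) * (x ^+ 2 + y ^+ 2) - 2 * r * (a * x + b * y) by ring.
rewrite cs; ring.
Qed.

Lemma circle_kernel_int (z : C) (r : R) : nrm z < r ->
  rintble 0 (2 * pi) (fun t => (nrm (r%:C * expit t - z) ^+ 2)^-1) /\
  \int[mu]_(t in `[0, 2 * pi]) (nrm (r%:C * expit t - z) ^+ 2)^-1 =
  2 * pi / (r ^+ 2 - nrm z ^+ 2).
Proof.
move=> zr; have r0 : 0 < r by exact: le_lt_trans (nrm_ge0 _) zr.
pose c := z^*%C / r%:C.
have cn : nrm c = nrm z / r by rewrite nrmM nrmV nrm_real gtr0_norm// nrm_conj.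
have c1 : nrm c < 1 by rewrite cn ltr_pdivrMr// mul1r.
have E : (fun t => (nrm (r%:C * expit t - z) ^+ 2)^-1) =
    fun t => (r ^+ 2)^-1 * (nrm (1 - c * expit t) ^+ 2)^-1.
  by apply/funext => t; rewrite circle_kernel// exprMn invfM.
have I := icont_intble (@poisson_icont c 0 (2 * pi) c1).
rewrite E; split; first exact: rintbleZ.
rewrite RintegralZl// poisson_kernel// cn.
have D : r ^+ 2 - nrm z ^+ 2 != 0.
  by rewrite gt_eqF// subr_gt0 ltr_pXn2r// nnegrE ?nrm_ge0 ?(ltW r0).
by field; rewrite D gt_eqF.
Qed.

(** A substitute for Holder's inequality: beyond l one has x/l <= (x/l)^p. The level l is free and
    is adapted to the distance to the circle. *)
Lemma powR_young (p l x : R) : 1 <= p -> 0 < l -> 0 <= x ->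
  x <= l + l * l^-1 `^ p * x `^ p.
Proof.
move=> p1 l0 x0; have [xl|lx] := leP x l.
  by apply: (le_trans xl); rewrite lerDl !mulr_ge0 ?powR_ge0// ltW.
have h : 1 <= x / l by rewrite ler_pdivlMr// mul1r ltW.
have := le1r_powR h p1; rewrite ler_pdivrMr// => H.
apply: (le_trans H); rewrite [x / l]mulrC powRM ?invr_ge0 ?(ltW l0)//.
by rewrite mulrC mulrA lerDr ltW.
Qed.

(** This is (1 - |z|)^(1 + 1/p), the inverse of the growth rate of derivatives in H^p. *)
Definition weight (p : R) (z : C) : R := (1 - nrm z) * (1 - nrm z) `^ p^-1.

(** Let d be the distance from z to the circle halfway to the boundary and k the squared kernel.
    Young's inequality at level d^(-1/p) gives |G| k <= d^(-1/p) (k + d |G|^p k). The integral of k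
    is of order 1/d by the Poisson kernel, and k <= d^(-2) in the second term, so both are of order
    d^(-1-1/p). *)
Theorem Hardy_derivative_growth (p : R) G : 1 <= p -> Hardy p G ->
  exists2 A : R, 0 < A & forall z, nrm z < 1 -> nrm (derive1 G z) * weight p z <= A.
Proof.
move=> p1 HG; have p0 : 0 < p by exact: lt_le_trans p1.
have HG1 := HG.1; have [B HB] := (HardyP p0 HG1).1 HG.
have B0 : 0 <= B.
  by apply: le_trans (HB 0 _); rewrite ?pint_ge0// lexx ltr01.
have pp := twopi_gt0 R.
exists (4 * (8 * pi + 2 * B) / (2 * pi) + 1).
  by rewrite ltr_wpDl// divr_ge0 ?(ltW pp)// mulr_ge0// addr_ge0// mulr_ge0// pi_ge0.
move=> z z1; have z0 := nrm_ge0 z.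
pose y := 1 - nrm z; have y0 : 0 < y by rewrite subr_gt0.
have y1 : y <= 1 by rewrite /y; lra.
pose d := y / 2; have d0 : 0 < d by rewrite divr_gt0.
pose r := (1 + nrm z) / 2.
have rz : nrm z < r by rewrite /r; lra.
have r1 : r < 1 by rewrite /r; lra.
have r0 : 0 <= r by rewrite /r; lra.
have rd : r - nrm z = d by rewrite /r /d /y; lra.
have r12 : 2^-1 <= r by rewrite /r; lra.
clearbody r.
pose e := d `^ p^-1; have e0 : 0 < e by rewrite powR_gt0.
have ei : 0 < e^-1 by rewrite invr_gt0.
have ep : e `^ p = d by rewrite /e -powRrM mulVf ?gt_eqF// powRr1// ltW.
have [Ik Ek] := circle_kernel_int rz.
have ri : 0 <= r < 1 by rewrite r0.
have IG := circle_rintble (ltW p0) HG1 ri.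
pose k t := (nrm (r%:C * expit t - z) ^+ 2)^-1.
pose P t := nrm (G (r%:C * expit t)) `^ p.
have kd t : k t <= (d ^+ 2)^-1.
  rewrite /k lef_pV2 ?posrE ?exprn_gt0// ?nrm_gt0 ?circle_neq//.
  rewrite lerXn2r ?nnegrE ?nrm_ge0 ?(ltW d0)// -rd.
  exact: circle_dist.
have k0 t : 0 <= k t by rewrite invr_ge0 exprn_ge0// nrm_ge0.
have main : nrm (cint 0 (2 * pi) (fun t => G (r%:C * expit t)
    * (r%:C * expit t / (r%:C * expit t - z) ^+ 2))) <=
    2 * \int[mu]_(t in `[0, 2 * pi]) (e^-1 * k t + (e^-1 * d * (d ^+ 2)^-1) * P t).
  apply: cint_le.
  - by apply: iccont_intble; exact: cauchy_int_iccont.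
  - by apply: rintbleD; exact: rintbleZ.
  - move=> t _; rewrite nrmM nrmM nrmV nrmX nrm_rexpit// -/(k t).
    have H := powR_young p1 ei (nrm_ge0 (G (r%:C * expit t))).
    rewrite invrK ep in H.
    apply: (@le_trans _ _ ((e^-1 + e^-1 * d * P t) * k t)).
      apply: ler_pM; rewrite ?nrm_ge0 ?mulr_ge0//.
      by rewrite ler_piMl// ltW.
    rewrite mulrDl lerD2l [leLHS]mulrAC; apply: ler_wpM2r; first exact: powR_ge0.
    by apply: ler_wpM2l => //; rewrite mulr_ge0// ltW.
rewrite (rint_lin _ _ Ik IG) Ek in main.
have dr : d / 2 <= r ^+ 2 - nrm z ^+ 2.
  rewrite subr_sqr rd ler_wpM2l ?(ltW d0)//; lra.
have K1 : 2 * pi / (r ^+ 2 - nrm z ^+ 2) <= 4 * pi / d.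
  have -> : 4 * pi / d = 2 * pi / (d / 2) by field; rewrite gt_eqF.
  rewrite ler_pM2l// lef_pV2 ?posrE//; last by rewrite divr_gt0.
  by apply: lt_le_trans dr; rewrite divr_gt0.
have K2 : e^-1 * d / d ^+ 2 * pint p G r <= e^-1 * (B / d).
  rewrite (_ : e^-1 * d / d ^+ 2 * pint p G r = e^-1 * (pint p G r / d)); last first.
    by field; rewrite !gt_eqF.
  by rewrite ler_pM2l ?invr_gt0// ler_pM2r ?invr_gt0// HB.
have main2 : nrm (derive1 G z) * (2 * pi) <= (8 * pi + 2 * B) / (d * e).
  rewrite (cauchy_derivative HG1 rz r1) /cauchy_pow nrmM nrmV nrm_real gtr0_norm//.
  rewrite mulrAC mulVf ?gt_eqF// mul1r; apply: (le_trans main).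
  rewrite (_ : (8 * pi + 2 * B) / (d * e) = 2 * (e^-1 * (4 * pi / d) + e^-1 * (B / d))).
    rewrite ler_wpM2l//; apply: lerD K2.
    by rewrite ler_pM2l ?invr_gt0.
  by field; rewrite !gt_eqF.
have ey : y `^ p^-1 <= 2 * e.
  rewrite {1}(_ : y = 2 * d); last by rewrite /d; field.
  rewrite powRM ?(ltW d0)// ler_pM2r//.
  by apply: ler1_powR; rewrite ?ler1n// invf_le1.
have W : weight p z <= 4 * (d * e).
  rewrite /weight -/y (_ : 4 * (d * e) = y * (2 * e)); last by rewrite /d; field.
  by rewrite ler_pM2l.
apply: (@le_trans _ _ (4 * (8 * pi + 2 * B) / (2 * pi))); last by rewrite lerDl.
rewrite ler_pdivlMr// mulrAC.
have de : 0 < d * e by rewrite mulr_gt0.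
rewrite ler_pdivlMr// in main2.
apply: (@le_trans _ _ (nrm (derive1 G z) * (2 * pi) * (4 * (d * e)))).
  by rewrite ler_wpM2l// mulr_ge0 ?nrm_ge0// ltW.
by rewrite mulrCA ler_wpM2l.
Qed.

End poisson.

(** * ** * Test functions concentrated near a point of the disc *)

Section test_functions.
Variable R : realType.
Local Notation C := R[i].
Local Notation nrm := (@Normc.normc R).
Local Notation mu := (@lebesgue_measure R).
Implicit Types (F G : C -> C) (z w : C).

(* The normalisation makes [test p w] bounded in H^p uniformly in w, with a
   derivative of size 1 / weight p w at w. *)
Definition kap (p : R) w : R := (1 - nrm w) ^+ 2 / (1 - nrm w) `^ p^-1.

Definition test (p : R) w z : C := (kap p w)%:C / (1 - w^*%C * z) ^+ 2.

Definition dtest (p : R) w z : C :=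
  (kap p w)%:C * (2 * w^*%C) / (1 - w^*%C * z) ^+ 3.

Lemma test_den w z : nrm w < 1 -> nrm z < 1 ->
  1 - nrm w <= nrm (1 - w^*%C * z) /\ 1 - nrm z <= nrm (1 - w^*%C * z).
Proof.
move=> w1 z1; have := nrm_subl 1 (w^*%C * z); rewrite nrm1 nrmM nrm_conj => H.
have z0 := nrm_ge0 z; have w0 := nrm_ge0 w.
by split; apply: le_trans H; rewrite lerD2l lerN2 ?ler_piMr ?ler_piMl// ltW.
Qed.

Lemma inv_p_le1 (p : R) : 1 <= p -> 0 <= p^-1 <= 1.
Proof. by move=> p1; rewrite invr_ge0 invf_le1 ?(lt_le_trans ltr01 p1)// p1 (le_trans ler01 p1). Qed.

Lemma kap_bounds (p : R) w : 1 <= p -> nrm w < 1 -> 0 < kap p w <= 1 - nrm w.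
Proof.
move=> p1 w1; have /andP[q0 q1] := inv_p_le1 p1.
have x0 : 0 < 1 - nrm w by rewrite subr_gt0.
have x1 : 1 - nrm w <= 1 by rewrite gerBl nrm_ge0.
rewrite /kap divr_gt0 ?exprn_gt0 ?powR_gt0//=.
rewrite ler_pdivrMr ?powR_gt0// expr2 ler_pM2l//.
by apply: ger1_powR => //; rewrite x0.
Qed.

Lemma kap_le1 (p : R) w : 1 <= p -> nrm w < 1 -> nrm (kap p w)%:C <= 1.
Proof.
move=> p1 w1; have /andP[k0 k1] := kap_bounds p1 w1.
by rewrite nrm_real gtr0_norm// (le_trans k1)// gerBl nrm_ge0.
Qed.

(** The bounds are uniform in w, because kap <= 1 and |1 - conj(w) z| >= 1 - rho; so they hold for a
    series whose points w are arbitrary. *)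
Lemma test_bounds (p rho : R) w z z' : 1 <= p -> rho < 1 -> nrm w < 1 ->
  nrm z <= rho -> nrm z' <= rho ->
  let M := 6 / (1 - rho) ^+ 5 in
  [/\ nrm (test p w z) <= M, nrm (dtest p w z) <= M &
    nrm (test p w z' - test p w z - (z' - z) * dtest p w z)
      <= M * nrm (z' - z) ^+ 2].
Proof.
move=> p1 rho1 w1 zr zr' M.
have z1 := le_lt_trans zr rho1; have z1' := le_lt_trans zr' rho1.
have rho0 : 0 <= rho by apply: le_trans zr; exact: nrm_ge0.
have d0 : 0 < 1 - rho by rewrite subr_gt0.
have d1 : 1 - rho <= 1 by rewrite gerBl.
set B := 1 - w^*%C * z; set A := 1 - w^*%C * z'.
have dB : 1 - rho <= nrm B.
  by apply: le_trans (test_den w1 z1).2; rewrite lerD2l lerN2.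
have dA : 1 - rho <= nrm A.
  by apply: le_trans (test_den w1 z1').2; rewrite lerD2l lerN2.
have B0 : B != 0 by rewrite -nrm_gt0 (lt_le_trans d0).
have A0 : A != 0 by rewrite -nrm_gt0 (lt_le_trans d0).
have k1 := kap_le1 p1 w1.
have small n : (n <= 5)%N -> ((1 - rho) ^+ n)^-1 <= ((1 - rho) ^+ 5)^-1.
  move=> n5; rewrite lef_pV2 ?posrE ?exprn_gt0//.
  by apply: ler_wiXn2l => //; exact: ltW.
have inv n (E : C) : 1 - rho <= nrm E -> E != 0 -> nrm (E ^+ n)^-1 <= ((1 - rho) ^+ n)^-1.
  move=> dE E0; rewrite nrmV nrmX lef_pV2 ?posrE ?exprn_gt0 ?nrm_gt0//.
  by rewrite lerXn2r// nnegrE ?nrm_ge0// ltW.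
have w1' : nrm w^*%C <= 1 by rewrite nrm_conj ltW.
have i5 : 0 < ((1 - rho) ^+ 5)^-1 by rewrite invr_gt0 exprn_gt0.
split.
- rewrite /test nrmM -/B; apply: (@le_trans _ _ (1 * ((1 - rho) ^+ 5)^-1)).
    by apply: ler_pM; rewrite ?nrm_ge0// (le_trans (inv _ _ dB B0))// small.
  by rewrite ler_pM2r// ler1n.
- rewrite /dtest !nrmM nrm_nat -/B; apply: (@le_trans _ _ (2 * ((1 - rho) ^+ 5)^-1)).
    apply: ler_pM; rewrite ?mulr_ge0 ?nrm_ge0//.
      apply: (@le_trans _ _ (1 * (2 * 1))); last by rewrite mul1r mulr1.
      by apply: ler_pM; rewrite ?mulr_ge0 ?nrm_ge0// ler_wpM2l.
    by rewrite (le_trans (inv _ _ dB B0))// small.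
  by rewrite ler_pM2r// ler_nat.
- have -> : test p w z' - test p w z - (z' - z) * dtest p w z =
     ((kap p w)%:C * w^*%C ^+ 2) * ((B + 2 * A) * (z' - z) ^+ 2)
     * ((A ^+ 2)^-1 * (B ^+ 3)^-1).
    by rewrite /test /dtest -/A -/B /A /B; field; rewrite A0 B0.
  have n1 : nrm ((kap p w)%:C * w^*%C ^+ 2) <= 1.
    by rewrite nrmM nrmX mulr_ile1 ?exprn_ge0 ?nrm_ge0// exprn_ile1 ?nrm_ge0.
  have b2 (y : C) : nrm y < 1 -> nrm (1 - w^*%C * y) <= 2.
    move=> y1; apply: (le_trans (nrmB _ _)); rewrite nrm1 nrmM nrm_conj.
    by rewrite lerD2l mulr_ile1 ?nrm_ge0// ltW.
  have n2 : nrm (B + 2 * A) <= 6.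
    apply: (le_trans (nrmD _ _)); rewrite nrmM nrm_nat.
    have := b2 z z1; have := b2 z' z1'; rewrite -/A -/B => hA hB.
    by move: (nrm A) (nrm B) hA hB; clear => x y *; lra.
  have n3 : nrm ((A ^+ 2)^-1 * (B ^+ 3)^-1) <= ((1 - rho) ^+ 5)^-1.
    rewrite (_ : ((1 - rho) ^+ 5)^-1 = ((1 - rho) ^+ 2)^-1 * ((1 - rho) ^+ 3)^-1).
      by rewrite nrmM; apply: ler_pM; rewrite ?nrm_ge0//; exact: inv.
    by rewrite -invfM -exprD.
  rewrite nrmM (nrmM (_ * _)) (nrmM (B + _)) nrmX.
  have -> : M * nrm (z' - z) ^+ 2 = 1 * (6 * nrm (z' - z) ^+ 2) * ((1 - rho) ^+ 5)^-1.
    by rewrite /M; ring.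
  apply: ler_pM; rewrite ?mulr_ge0 ?nrm_ge0 ?exprn_ge0 ?nrm_ge0//.
  apply: ler_pM; rewrite ?mulr_ge0 ?nrm_ge0 ?exprn_ge0 ?nrm_ge0//.
  by rewrite ler_wpM2r// exprn_ge0// nrm_ge0.
Qed.

Lemma test_Hol (p : R) w : 1 <= p -> nrm w < 1 -> Hol (test p w).
Proof.
move=> p1 w1; have [] // := @Hol_cder R (test p w) (dtest p w) _.
move=> z z1; have [rho [zr /andP[rho0 rho1]]] := between1 z1 (nrm_ge0 z).
apply: (@cder_quad _ _ _ _ (6 / (1 - rho) ^+ 5) (rho - nrm z)).
  by rewrite subr_gt0.
move=> h hd.
have wr : nrm (z + h) <= rho.
  by apply: (le_trans (nrmD _ _)); rewrite -lerBrDl ltW.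
have [_ _] := test_bounds p1 rho1 w1 (ltW zr) wr.
by rewrite (addrC z) addrK (addrC h).
Qed.

Lemma powR_frac_mono (q x y : R) : q <= 1 -> 0 < x -> x <= y ->
  x / x `^ q <= y / y `^ q.
Proof.
move=> q1 x0 xy; have y0 := lt_le_trans x0 xy.
have E t : 0 < t -> t / t `^ q = t `^ (1 - q).
  by move=> t0; rewrite powRB ?powRr1 ?(ltW t0)// (gt_eqF t0) implybT.
by rewrite !E//; apply: ge0_ler_powR; rewrite ?subr_ge0 ?nnegrE ?(ltW x0) ?(ltW y0).
Qed.

(** Put x = 1 - |w|, y = 1 - |z| and D = |1 - conj(w) z|, which is at least x and y. The point is
    x^(2-1/p) y^(1/p) <= D^2: replace y by x in the power if y <= x, and x by y in x^(1-1/p)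
    otherwise. The third factor D absorbs the remaining y. *)
Lemma dtest_weight_le (p : R) w z : 1 <= p -> nrm w < 1 -> nrm z < 1 ->
  nrm (dtest p w z) * weight p z <= 2.
Proof.
move=> p1 w1 z1; have [dw dz] := test_den w1 z1.
have /andP[q0 q1] := inv_p_le1 p1.
have x0 : 0 < 1 - nrm w by rewrite subr_gt0.
have y0 : 0 < 1 - nrm z by rewrite subr_gt0.
have D0 := lt_le_trans y0 dz.
have w1' : nrm w^*%C <= 1 by rewrite nrm_conj ltW.
have /andP[k0 _] := kap_bounds p1 w1.
rewrite /dtest /weight !nrmM nrmV nrmX nrm_nat nrm_real gtr0_norm//.
have key : kap p w * (1 - nrm z) `^ p^-1 <= nrm (1 - w^*%C * z) ^+ 2.
  move: (nrm (1 - _)) dw dz D0 => D dw dz D0; rewrite /kap.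
  move: (1 - nrm w) (1 - nrm z) x0 y0 dw dz => x y x0 y0 dw dz.
  have [yx|/ltW xy] := leP y x.
  - rewrite mulrAC; apply: (@le_trans _ _ (x ^+ 2)).
      rewrite ler_pdivrMr ?powR_gt0// ler_pM2l ?exprn_gt0//.
      by apply: ge0_ler_powR; rewrite ?nnegrE ?(ltW x0) ?(ltW y0).
    by rewrite lerXn2r// nnegrE ltW.
  - apply: (@le_trans _ _ (x * (y / y `^ p^-1) * y `^ p^-1)).
      rewrite ler_pM2r ?powR_gt0// expr2 -mulrA ler_pM2l//.
      exact: powR_frac_mono.
    rewrite -mulrA divfK ?gt_eqF ?powR_gt0// expr2.
    by apply: ler_pM; rewrite ?(ltW x0) ?(ltW y0).
rewrite (_ : _ * _ = 2 * nrm w^*%C * ((kap p w * (1 - nrm z) `^ p^-1) * (1 - nrm z)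
   / nrm (1 - w^*%C * z) ^+ 3)); last by ring.
rewrite -[leRHS]mulr1; apply: ler_pM.
- by rewrite mulr_ge0 ?nrm_ge0.
- apply: divr_ge0; last by rewrite exprn_ge0// nrm_ge0.
  by apply: mulr_ge0; rewrite ?(ltW y0)// mulr_ge0 ?powR_ge0// ltW.
- by rewrite -[leRHS]mulr1 ler_wpM2l.
- rewrite ler_pdivrMr ?exprn_gt0// mul1r exprSr.
  by apply: ler_pM; rewrite ?(ltW y0)// mulr_ge0 ?powR_ge0// ltW.
Qed.

(** At z = w the powers of 1 - |w| cancel and 2 |w| / (1 + |w|)^3 remains. The derivative contains
    the factor conj(w), so w has to stay away from 0. *)
Lemma dtest_weight_ge (p : R) w : 1 <= p -> 2^-1 <= nrm w -> nrm w < 1 ->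
  8^-1 <= nrm (dtest p w w) * weight p w.
Proof.
move=> p1 wh w1; have x0 : 0 < 1 - nrm w by rewrite subr_gt0.
have /andP[k0 _] := kap_bounds p1 w1.
rewrite /dtest; have -> : 1 - w^*%C * w = (1 - nrm w ^+ 2)%:C.
  rewrite nrm_sqr; case: w {wh w1 x0 k0} => a b.
  by apply/eqP; rewrite eq_complex/=; apply/andP; split; apply/eqP; ring.
have P0 : 0 < (1 - nrm w) `^ p^-1 by rewrite powR_gt0.
have D0 : 0 < 1 - nrm w ^+ 2 by rewrite subr_gt0 exprn_ilt1 ?nrm_ge0.
rewrite /weight !nrmM nrmV nrmX nrm_nat nrm_conj !nrm_real.
rewrite (gtr0_norm k0) (gtr0_norm D0) /kap.
move: (nrm w) ((1 - nrm w) `^ p^-1) wh w1 x0 P0 D0 => x P xh x1 x0 P0 D0.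
have -> : (1 - x) ^+ 2 / P * (2 * x) / (1 - x ^+ 2) ^+ 3 * ((1 - x) * P) =
    2 * x / (1 + x) ^+ 3.
  rewrite (_ : 1 - x ^+ 2 = (1 - x) * (1 + x)); last by ring.
  by field; rewrite !gt_eqF//; lra.
rewrite ler_pdivlMr; last by rewrite exprn_gt0//; lra.
have h : (1 + x) ^+ 3 <= 2 ^+ 3 by rewrite lerXn2r// ?nnegrE; lra.
apply: (@le_trans _ _ (8^-1 * 2 ^+ 3)); first by rewrite ler_wpM2l// invr_ge0.
rewrite (_ : 8^-1 * 2 ^+ 3 = 1); last by field.
lra.
Qed.

(** With D = |1 - conj(w) z|, the bound D >= 1 - |w| is applied to all of D^(-2p) except a factor
    D^(-2). The integrand is then at most (1 - |w|) D^(-2), whose integral is known from the Poisson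
    kernel. *)
Lemma test_pint (p : R) w (r : R) : 1 <= p -> nrm w < 1 -> 0 <= r < 1 ->
  pint p (test p w) r <= 2 * pi.
Proof.
move=> p1 w1 /andP[r0 r1]; have p0 : 0 < p by exact: lt_le_trans p1.
have x0 : 0 < 1 - nrm w by rewrite subr_gt0.
have /andP[k0 _] := kap_bounds p1 w1.
pose c := w^*%C * r%:C.
have cn : nrm c = nrm w * r by rewrite nrmM nrm_conj nrm_real ger0_norm.
have c1 : nrm c < 1 by rewrite cn mulr_ilt1 ?nrm_ge0.
have I := icont_intble (@poisson_icont R c 0 (2 * pi) c1).
have ri : 0 <= r < 1 by rewrite r0.
have It := circle_rintble (ltW p0) (test_Hol p1 w1) ri.
apply: (@le_trans _ _ (\int[mu]_(t in `[0, 2 * pi])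
    ((1 - nrm w) * (nrm (1 - c * expit t) ^+ 2)^-1))).
  apply: le_rint => //; first exact: rintbleZ.
  move=> t _; rewrite /test -mulrA -/c.
  rewrite (_ : w^*%C * (r%:C * expit t) = c * expit t); last by rewrite mulrA.
  rewrite nrmM nrmV nrmX nrm_real gtr0_norm//.
  have n1 : nrm (r%:C * expit t) < 1 by rewrite nrm_rexpit.
  have [dw _] := test_den w1 n1.
  rewrite mulrA -/c in dw.
  have D0 := lt_le_trans x0 dw.
  move: (nrm (1 - _)) dw D0 => D dw D0.
  have X0 : 0 < (1 - nrm w) ^+ 2 by rewrite exprn_gt0.
  have kp : kap p w `^ p = ((1 - nrm w) ^+ 2) `^ p / (1 - nrm w).
    rewrite /kap powRM ?invr_ge0 ?powR_ge0 ?(ltW X0)//; congr (_ * _).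
    rewrite -powRN -powRrM mulNr mulVf ?gt_eqF//.
    by rewrite powRN powRr1// ltW.
  rewrite powRM ?invr_ge0 ?(ltW k0) ?exprn_ge0 ?(ltW D0)// kp.
  have DX : (D ^+ 2)^-1 <= ((1 - nrm w) ^+ 2)^-1.
    by rewrite lef_pV2 ?posrE ?exprn_gt0// lerXn2r// nnegrE ltW.
  have D2 : 0 < (D ^+ 2)^-1 by rewrite invr_gt0 exprn_gt0.
  have e1 : ((D ^+ 2)^-1) `^ p = (D ^+ 2)^-1 * ((D ^+ 2)^-1) `^ (p - 1).
    by rewrite mulr_powRB1// ltW.
  have e2 : ((D ^+ 2)^-1) `^ (p - 1) <= (((1 - nrm w) ^+ 2)^-1) `^ (p - 1).
    by apply: ge0_ler_powR; rewrite ?subr_ge0// ?nnegrE ?(ltW D2)// invr_ge0 ltW.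
  have e3 : ((1 - nrm w) ^+ 2) `^ p * (((1 - nrm w) ^+ 2)^-1) `^ (p - 1) =
      (1 - nrm w) ^+ 2.
    rewrite -(mulr_powRB1 (ltW X0) p0) -mulrA -powRM ?invr_ge0 ?(ltW X0)//.
    by rewrite divff ?gt_eqF// powR1 mulr1.
  rewrite e1 mulrCA [leRHS]mulrC ler_pM2l// [leLHS]mulrC.
  apply: (@le_trans _ _ ((((1 - nrm w) ^+ 2)^-1) `^ (p - 1) *
      (((1 - nrm w) ^+ 2) `^ p / (1 - nrm w)))).
    by apply: ler_wpM2r => //; rewrite divr_ge0 ?powR_ge0// ltW.
  by rewrite mulrA [X in X / _]mulrC e3 expr2 mulfK ?gt_eqF.
rewrite RintegralZl// poisson_kernel// cn mulrCA -[leRHS]mulr1.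
rewrite ler_pM2l ?twopi_gt0// ler_pdivrMr; last first.
  by rewrite subr_gt0 -cn exprn_ilt1 ?nrm_ge0.
rewrite mul1r lerD2l lerN2 exprMn.
have w0 := nrm_ge0 w.
apply: (@le_trans _ _ (nrm w ^+ 2)).
  by rewrite ler_piMr ?exprn_ge0// exprn_ile1// ltW.
by rewrite expr2 ler_piMr// ltW.
Qed.

End test_functions.

(** * The gliding hump *)

Section gliding_hump.
Variable R : realType.
Local Notation C := R[i].
Local Notation nrm := (@Normc.normc R).
Local Notation mu := (@lebesgue_measure R).
Implicit Types (u F G : C -> C) (p : R) (z w : C).

Lemma HolZ (c : C) u : Hol u -> Hol (fun z => c * u z).
Proof. by move=> Hu; have := HolM (@Hol_cst R c) Hu. Qed.

Lemma Hol_sum N (u : nat -> C -> C) : (forall n, Hol (u n)) ->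
  Hol (fun z => \sum_(n < N) u n z).
Proof.
move=> Hu; elim: N => [|N IH].
  rewrite (_ : (fun z => _) = fun=> 0); first exact: Hol_cst.
  by apply/funext => z; rewrite big_ord0.
rewrite (_ : (fun z => _) = fun z => \sum_(n < N) u n z + u N z).
  exact: (HolD IH (Hu N)).
by apply/funext => z; rewrite big_ord_recr.
Qed.

Lemma pintZ p (c : C) u (r : R) : 0 <= p -> Hol u -> 0 <= r < 1 ->
  pint p (fun z => c * u z) r = nrm c `^ p * pint p u r.
Proof.
move=> p0 Hu ri; have I1 := circle_rintble p0 Hu ri.
rewrite /pint -RintegralZl//; apply: eq_Rintegral => t _.
by rewrite nrmM powRM ?nrm_ge0.
Qed.

Lemma pint_le1 p u (r : R) : 0 <= p -> Hol u -> 0 <= r < 1 ->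
  (forall z, nrm z = r -> nrm (u z) <= 1) -> pint p u r <= 2 * pi.
Proof.
move=> p0 Hu ri H; have I1 := circle_rintble p0 Hu ri.
have pp := ltW (twopi_gt0 R).
have -> : 2 * pi = \int[mu]_(t in `[0, 2 * pi]) 1 by rewrite rint_cst// subr0 mulr1.
apply: le_rint => //; first exact: rintble_cst.
move=> t _; have <- : 1 `^ p = 1 :> R by rewrite powR1.
apply: ge0_ler_powR; rewrite ?nnegrE ?nrm_ge0//.
by apply: H; rewrite nrm_rexpit//; case/andP: ri.
Qed.

(** The first term is split off and b factored out of the others, so that each use of the inequality
    with 2^p is paid for by 2^p b^p <= 1/2. The bound K' = 2 2^p K reproduces itself: 2^p K + K'/2 =
    K'. *)
Lemma pint_sum p (b K r : R) N (u : nat -> C -> C) : 1 <= p -> 0 < b ->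
  b <= 4^-1 -> 0 <= r < 1 -> (forall n, Hol (u n)) ->
  (forall n, pint p (u n) r <= K) ->
  pint p (fun z => \sum_(n < N) (b ^+ n)%:C * u n z) r <= 2 * 2 `^ p * K.
Proof.
move=> p1 b0 b4 ri; have p0 : 0 < p by exact: lt_le_trans p1.
elim: N u => [|N IH] u Hu HK.
  have K0 : 0 <= K by apply: le_trans (HK 0%N); exact: pint_ge0.
  rewrite /pint (_ : (fun t => _) = fun=> 0).
    by rewrite rint_cst ?(ltW (twopi_gt0 R))// mulr0 !mulr_ge0 ?powR_ge0.
  by apply/funext => t; rewrite big_ord0 nrm0 powR0// gt_eqF.
pose v z := \sum_(n < N) (b ^+ n)%:C * u n.+1 z.
have Hv : Hol v by apply: (@Hol_sum N (fun n z => (b ^+ n)%:C * u n.+1 z)) => n; exact: HolZ.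
rewrite (_ : (fun z => _) = fun z => u 0%N z + b%:C * v z); last first.
  apply/funext => z; rewrite big_ord_recl expr0 mul1r /v mulr_sumr; congr (_ + _).
  by apply: eq_bigr => i _; rewrite /= exprS rmorphM mulrA.
apply: (le_trans (pintD (ltW p0) (Hu 0%N) (@HolZ b%:C _ Hv) ri)).
rewrite pintZ ?(ltW p0)// nrm_real gtr0_norm//.
have := IH (fun n => u n.+1) (fun n => Hu n.+1) (fun n => HK n.+1).
rewrite -/v; have := HK 0%N; have := pint_ge0 p r v.
have : 2 `^ p * b `^ p <= 2^-1.
  rewrite -powRM ?(ltW b0)//.
  apply: (@le_trans _ _ (2 * b)); last by lra.
  have b1 : 0 < 2 * b <= 1 by lra.
  by rewrite -[leRHS]powRr1 ?mulr_ge0 ?(ltW b0)//; apply: ger_powR.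
have : 0 <= 2 `^ p :> R by exact: powR_ge0.
move: (2 `^ p) (b `^ p) (pint p (u 0%N) r) (pint p v r); clear => P B x y P0 PB y0 xK yK.
have h1 : P * x <= P * K by rewrite ler_wpM2l.
have h2 : P * B * y <= 2^-1 * y by rewrite ler_wpM2r.
rewrite mulrDr mulrA; lra.
Qed.

Fixpoint greedy (d : nat -> C -> C) (z : nat -> C) n : C -> C :=
  if n is k.+1 then fun w => greedy d z k w +
    (nrm (greedy d z k (z k)) < nrm (d k (z k)) / 2)%R%:R * d k w
  else fun=> 0.

(* The n-th term is kept exactly when the partial sum before it is small at
   [z n]; either way the new partial sum is not small there. *)
Lemma greedy_selection (d : nat -> C -> C) (z : nat -> C) :
  exists e : nat -> bool, forall n,
    nrm (d n (z n)) / 2 <= nrm (\sum_(k < n.+1) (e k)%:R * d k (z n)).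
Proof.
pose e k : bool := nrm (greedy d z k (z k)) < nrm (d k (z k)) / 2.
exists e => n.
have E m w : \sum_(k < m) (e k)%:R * d k w = greedy d z m w.
  by elim: m => [|m IH]; [rewrite big_ord0|rewrite big_ord_recr/= IH].
rewrite E /= -/(e n); have [h|h] := boolP (e n).
  rewrite mul1r; move: h; rewrite /e.
  have := nrm_subr (greedy d z n (z n)) (- d n (z n)); rewrite opprK nrmN.
  by move: (nrm _) (nrm _) (nrm _); clear => x y t *; lra.
by rewrite mul0r addr0 leNgt.
Qed.

End gliding_hump.

(** * ** * Multipliers of the derivatives of Hardy functions *)

Section multiplier.
Variable R : realType.
Local Notation C := R[i].
Local Notation nrm := (@Normc.normc R).
Implicit Types (u F G : C -> C) (p : R) (z w : C).

(** The series lies in H^p for every selection [e], and the weighted tail of its derivative is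
    bounded uniformly on the disc, so the tail can be neglected at each hump. *)
Lemma test_series p (b : R) (z : nat -> C) (e : nat -> bool) : 1 <= p -> 0 < b ->
  b <= 4^-1 -> (forall n, nrm (z n) < 1) ->
  exists2 F, Hardy p F & forall w N, nrm w < 1 ->
    nrm (derive1 F w - \sum_(n < N) (e n)%:R * ((b ^+ n)%:C * dtest p (z n) w))
      * weight p w <= 4 * b ^+ N.
Proof.
move=> p1 b0 b4 z1; have p0 : 0 < p by exact: lt_le_trans p1.
have b2 : b <= 2^-1 by lra.
pose u n w := (e n)%:R * test p (z n) w.
pose T n w := (b ^+ n)%:C * u n w.
pose T' n w := (e n)%:R * ((b ^+ n)%:C * dtest p (z n) w).
have bn n : 0 <= b ^+ n by rewrite exprn_ge0// ltW.
have nb n : nrm (b ^+ n)%:C = b ^+ n by rewrite nrm_real ger0_norm.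
have eb n (c : C) (M : R) : nrm c <= M -> nrm ((e n)%:R * ((b ^+ n)%:C * c)) <= M * b ^+ n.
  move=> cM; rewrite nrmM nrmM nb [M * _]mulrC.
  rewrite -[leRHS]mul1r; apply: ler_pM; rewrite ?mulr_ge0 ?nrm_ge0 ?nrm_bool//.
  by rewrite ler_wpM2l.
pose M rho : R := 6 / (1 - rho) ^+ 5.
have HM rho : rho < 1 -> sum_bounds b T T' rho (M rho).
  move=> rho1 n x y xr yr; have [h1 h2 h3] := test_bounds p1 rho1 (z1 n) xr yr.
  split.
  - by rewrite /T /u mulrCA; exact: eb.
  - exact: eb.
  - have -> : T n y - T n x - (y - x) * T' n x = (e n)%:R * ((b ^+ n)%:C *
        (test p (z n) y - test p (z n) x - (y - x) * dtest p (z n) x)).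
      by rewrite /T /T' /u; ring.
    by rewrite mulrAC; exact: eb.
have M0 rho : rho < 1 -> 0 < M rho.
  by move=> rho1; rewrite /M divr_gt0// exprn_gt0// subr_gt0.
have [F [F' [cF tF tF']]] := sum_derivable b0 b2
  (fun rho h => ex_intro2 _ _ (M rho) (M0 rho h) (HM rho h)).
have [HF dF] := Hol_cder cF.
have Hu n : Hol (u n) by exact: HolZ (test_Hol p1 (z1 n)).
pose S N w := \sum_(n < N) T n w.
have HS N : Hol (S N).
  by apply: (@Hol_sum _ N T) => n; exact: (@HolZ R _ _ (Hu n)).
exists F.
  apply/(HardyP p0 HF); exists (2 `^ p * (2 * 2 `^ p * (2 * pi) + 2 * pi)) => r ri.
  have /andP[r0 r1] := ri.
  (* [N] depends on the radius, and makes the remainder at most 1 on the circle. The bound for the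
     partial sum depends neither on N nor on r, so the total is uniform in r. *)
  have [N HN] := geometric_vanish b0 b2 (2 * M r) ltr01.
  have HD : Hol (fun w => F w + (-1) * S N w) by exact: HolD HF (@HolZ R _ _ (HS N)).
  rewrite (_ : F = fun w => S N w + (F w + (-1) * S N w)); last first.
    by apply/funext => w; rewrite mulN1r addrCA subrr addr0.
  apply: (le_trans (pintD (ltW p0) (HS N) HD ri)).
  apply: ler_wpM2l; first exact: powR_ge0.
  apply: lerD.
    apply: (@pint_sum R p b (2 * pi) r N u p1 b0 b4 ri Hu) => n.
    rewrite (pintZ _ (ltW p0) (test_Hol p1 (z1 n)) ri).
    rewrite -[leRHS]mul1r; apply: ler_pM; rewrite ?powR_ge0 ?pint_ge0 ?test_pint//.
    have <- : 1 `^ p = 1 :> R by rewrite powR1.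
    by apply: ge0_ler_powR; rewrite ?nnegrE ?nrm_ge0 ?nrm_bool ?(ltW p0).
  apply: pint_le1 => //; first exact: ltW.
  move=> w wr; rewrite mulN1r; apply: le_trans HN.
  by apply: (tF r (M r) r1 (HM r r1)); rewrite wr.
move=> w N w1; rewrite (dF w w1).
have W0 : 0 < weight p w by rewrite mulr_gt0 ?powR_gt0// subr_gt0.
(* The weight at [w] itself enters the constant, in place of a bound on a smaller disc. *)
have bd n : nrm (T' n w) <= 2 / weight p w * b ^+ n.
  by apply: eb; rewrite ler_pdivlMr//; exact: dtest_weight_le.
rewrite -ler_pdivlMr//; apply: (le_trans (tF' w _ w1 bd N)).
by rewrite le_eqVlt; apply/orP; left; apply/eqP; field; rewrite gt_eqF.
Qed.

Lemma weight_half p z : 1 <= p -> nrm z <= 2^-1 -> 4^-1 <= weight p z.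
Proof.
move=> p1 zh; have /andP[q0 q1] := inv_p_le1 p1; have z0 := nrm_ge0 z.
have h : 2^-1 <= 1 - nrm z by lra.
have h0 : 0 < 1 - nrm z <= 1 by lra.
apply: (@le_trans _ _ (2^-1 * 2^-1)); first by lra.
apply: ler_pM; rewrite ?invr_ge0//; apply: (le_trans h).
exact: ger1_powR.
Qed.

Lemma Hardy_id p : 0 < p -> Hardy p (fun z : C => z).
Proof.
move=> p0; apply/(HardyP p0 (@Hol_id R)); exists (2 * pi) => r ri.
apply: (pint_le1 (ltW p0) (@Hol_id R) ri).
by move=> z ->; have /andP[_ /ltW] := ri.
Qed.

Theorem multiplier_bounded p (m : C -> C) : 1 <= p ->
  (forall F, Hardy p F -> exists A : R, forall z, nrm z < 1 ->
    nrm (m z * derive1 F z) * weight p z <= A) ->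
  exists M : R, forall z, nrm z < 1 -> nrm (m z) <= M.
Proof.
move=> p1 Hm; have p0 : 0 < p by exact: lt_le_trans p1.
(* Testing with F(z) = z bounds m on |z| <= 1/2, so that points with large |m| satisfy the
   hypothesis |w| >= 1/2 of [dtest_weight_ge]. *)
have [A0 HA0] := Hm _ (Hardy_id p0).
have small z : nrm z <= 2^-1 -> nrm (m z) <= 4 * A0.
  move=> zh; have z1 : nrm z < 1 by lra.
  have := HA0 z z1; have [_ ->] := cder_derivable (cder_id z); rewrite mulr1.
  have := weight_half p1 zh; have := nrm_ge0 (m z).
  by move: (nrm _) (weight _ _); clear => x y; nra.
apply: contrapT => /forallNP H.
(* In weighted size the selected sum at [z n] is at least b^n / 16, half of b^n / 8, and the tail at
   most 4 b^(n+1) <= b^n / 64; so at least b^n / 32 survives. *)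
have [b [b0 b4 b256]] : exists b : R, [/\ 0 < b, b <= 4^-1 & 256 * b <= 1].
  by exists 256^-1; split; lra.
(* The first summand forces |z| > 1/2; the second outweighs the factor b^n of the n-th hump. *)
have big n : exists z, nrm z < 1 /\ 4 * `|A0| + n%:R / b ^+ n < nrm (m z).
  have /existsNP[z /not_implyP[z1 /negP]] := H (4 * `|A0| + n%:R / b ^+ n).
  by rewrite -ltNge; exists z.
have [z Hz] := choice big.
have z1 n : nrm (z n) < 1 by have [] := Hz n.
have bn n : 0 < b ^+ n by rewrite exprn_gt0.
have zn n : n%:R / b ^+ n < nrm (m (z n)).
  by apply: le_lt_trans (Hz n).2; rewrite lerDr mulr_ge0.
have zh n : 2^-1 <= nrm (z n).
  rewrite leNgt; apply/negP => /ltW /small.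
  apply/negP; rewrite -ltNge; apply: le_lt_trans (Hz n).2.
  rewrite -[leLHS]addr0; apply: lerD; first by rewrite ler_wpM2l// ler_norm.
  by rewrite divr_ge0// ltW.
have [e He] := greedy_selection (fun n w => (b ^+ n)%:C * dtest p (z n) w) z.
have [F HF tF] := test_series e p1 b0 b4 z1.
have [A HA] := Hm F HF.
(* At the n-th hump the weighted product exceeds n / 32, and this [n] makes it exceed A. *)
pose n := (Num.truncn (32 * `|A|)).+1.
have nA : 32 * `|A| < n%:R by exact: truncnS_gt.
have := HA (z n) (z1 n); rewrite nrmM; have := tF (z n) n.+1 (z1 n).
have := He n; rewrite (nrmM _ (dtest _ _ _)); have := dtest_weight_ge p1 (zh n) (z1 n); have := zn n.
have W0 : 0 < weight p (z n) by rewrite mulr_gt0 ?powR_gt0// subr_gt0.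
rewrite (nrm_real (b ^+ n)) (gtr0_norm (bn n)) exprSr ltr_pdivrMr//.
have := nrm_subr (derive1 F (z n)) (\sum_(k < n.+1) (e k)%:R * ((b ^+ k)%:C * dtest p (z k) (z n))).
move: (derive1 F (z n)) (dtest _ _ _) (m (z n)) => f q mz.
move: (\sum_(k < _) _) => s; move: (weight _ _) W0 (b ^+ n) (bn n) => W W0 B B0.
move: (nrm (f - s)) (nrm s) (nrm f) (nrm q) (nrm mz) (nrm_ge0 mz).
have := ler_norm A; move: nA; move: n%:R `|A|.
clear -b0 b256 W0 B0.
move=> n a nA Aa fs s' f' q' m' m0 h1 h2 h3 h4 h5 h6.
have k1 : B * (8^-1) / 2 <= s' * W.
  apply: (@le_trans _ _ (B * (q' * W) / 2)); last first.
    by rewrite (_ : _ / 2 = B * q' / 2 * W); [rewrite ler_pM2r|ring].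
  by rewrite ler_pM2r// ler_pM2l.
have k2 : B / 32 <= f' * W.
  have k : (s' - f') * W <= fs * W by rewrite ler_pM2r.
  have Bb : 4 * (B * b) <= B / 64.
    by rewrite mulrCA mulrC; have : 256 * b * B <= 1 * B by [rewrite ler_pM2r]; lra.
  rewrite mulrBl in k; lra.
have k3 : m' * (B / 32) <= A.
  by apply: le_trans h6; rewrite -mulrA ler_wpM2l.
lra.
Qed.

End multiplier.

(** * ** * Boundedness of the quotient h'/g' *)

Section converse.
Variable R : realType.
Local Notation C := R[i].
Local Notation nrm := (@Normc.normc R).
Implicit Types (u f g h F G : C -> C) (p : R) (z w : C).

Lemma Hol_quot u g : Hol u -> Hol g -> (forall z, nrm z < 1 -> g z != 0) ->
  Hol (fun z => u z / g z).
Proof.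
move=> Hu Hg g0.
have D z : nrm z < 1 -> cder (fun w => (g w)^-1) z (- derive1 g z / g z ^+ 2).
  by move=> z1; apply: cderV; [exact: g0|exact: ((HolP g).1 Hg)].
have [Hi _] := Hol_cder D.
exact: (HolM Hu Hi).
Qed.

(** For F in H^p the function f = F'/g' lies in the domain of T_g, hence in that of T_h; the growth
    estimate for (T_h f)' = (h'/g') F' is the hypothesis of [multiplier_bounded]. *)
Theorem Vspace_quotient_bounded g p h : locally_univalent g -> 1 <= p ->
  Vspace g p h -> Hinf (fun z => derive1 h z / derive1 g z).
Proof.
move=> [Hg g'0] p1 [[[Hh _] _] gh].
have g0 z : nrm z < 1 -> derive1 g z != 0 by move=> z1; apply: g'0; apply/discE.
split; first exact: (Hol_quot (Hol_derive Hh) (Hol_derive Hg) g0).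
have p0 : 0 < p by exact: lt_le_trans p1.
have [F HF|M HM] := @multiplier_bounded R p (fun z => derive1 h z / derive1 g z) p1;
  last by exists M => z /discE; exact: HM.
pose f z := derive1 F z / derive1 g z.
have Hf : Hol f by exact: (Hol_quot (Hol_derive HF.1) (Hol_derive Hg) g0).
have Ff z : nrm z < 1 -> derive1 F z = f z * derive1 g z.
  by move=> z1; rewrite /f divfK// g0.
(* T_g f and F have the same derivative, which is domination with constant 1. *)
have Hgf : Hardy p (volterra g f).
  have [HV dV] := volterra_Hol Hg Hf.
  apply: (Hardy_dominated p0 ltr01 HF HV) => z z1.
  by apply: (le_scale_eq (dV z z1) (Ff z z1)); rewrite mul1r.
have [_ Hhf] := gh f (conj Hf Hgf).
have [A A0 HA] := Hardy_derivative_growth p1 Hhf.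
have [_ dh] := volterra_Hol Hh Hf.
exists A => z z1; apply: le_trans (HA z z1).
rewrite (dh z z1) /f; apply: ler_wpM2r.
  by rewrite mulr_ge0 ?powR_ge0// subr_ge0 ltW.
move: (derive1 h z) (derive1 g z) (derive1 F z) => x y t.
by rewrite mulrAC -mulrA mulrC mulrAC.
Qed.

End converse.

Theorem proposition5p1 (R : realType) (g : R[i] -> R[i]) (p : R)
    (g_BMOA : BMOA g) (g_lu : locally_univalent g) (p_ge1 : 1 <= p) :
  (forall h : R[i] -> R[i],
     Vspace g p h <->
     exists2 f, (volterra g @` @Hinf R) f &
                eq_on_disc h (fun z => f z + h 0)) /\
  Vspace g p =
    [set h | exists2 f, (volterra g @` @Hinf R) f &
             exists c : R[i], eq_on_disc h (fun z => f z + c)].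
Proof.
(* Both descriptions use the preimage k = h'/g', and h(0) as constant because T_g k is the primitive
   of h' that vanishes at 0. *)
have onto h : Vspace g p h -> exists2 f, (volterra g @` @Hinf R) f &
    eq_on_disc h (fun z => f z + h 0).
  move=> Vh; have Hk := Vspace_quotient_bounded g_lu p_ge1 Vh.
  set k := (fun z => _) in Hk.
  exists (volterra g k); first by exists k.
  have [Hg g'0] := g_lu; have Hh : Hol h := Vh.1.1.1.
  have hk z : Normc.normc z < 1 -> derive1 h z = k z * derive1 g z.
    by move=> z1; rewrite /k divfK// g'0//; apply/discE.
  move=> z /discE z1.
  by rewrite (volterra_primitive Hg Hk.1 Hh hk z1) subrK.
split.
  move=> h; split; first exact: onto.
  by move=> [_ [k Hk <-]]; exact: volterra_bounded_Vspace.
apply/seteqP; split => h.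
  by move=> /onto[f fV hf]; exists f => //; exists (h 0).
by move=> [_ [k Hk <-] [c hc]]; exact: (volterra_bounded_Vspace p_ge1 g_BMOA Hk hc).
Qed.
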